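(* Let $1\le p<\infty$, let $W$ be a $d$-dimensional Brownian motion on $[0,T]$, fix $n\in\mathbb{N}$, and let $W^{\pi_n}$ be the piecewise linear interpolation of $W$ along the partition $\pi_n$ of $[0,T]$. Let $y_0\in\mathbb{R}^m$, and let $\mu\colon[0,T]\times\mathbb{R}^m\to\mathbb{R}^m$ and $\sigma\colon[0,T]\times\mathbb{R}^m\to\mathbb{R}^{m\times d}$ be continuous functions which are globally Lipschitz continuous and satisfy, for some constant $C>0$, $$|\mu(t,x)|+|\sigma(t,x)|\le C(1+|x|),\qquad t\in[0,T],\ x\in\mathbb{R}^m.$$ Let $Y^{\pi_n}$ be the solution of the random ordinary differential equation $$Y^{\pi_n}_t=y_0+\int_0^t\mu(s,Y^{\pi_n}_s)\,ds+\int_0^t\sigma(s,Y^{\pi_n}_s)\,dW^{\pi_n}_s,\qquad t\in[0,T].$$ Then for every $\varepsilon>0$ there exists a linear functional $\boldsymbol\ell\colon T((\mathbb{R}^{d+1}))\to\mathbb{R}^m$ of the form $\boldsymbol\ell(\widehat{\mathbb W}^{\pi_n}_t)=\sum_{|I|\le N}\ell_I\langle e_I,\widehat{\mathbb W}^{\pi_n}_t\rangle$, for some $N\in\mathbb{N}_0$ and $\ell_I\in\mathbb{R}^m$, such that $$\mathbb E\Bigl[\int_0^T|Y^{\pi_n}_t-\boldsymbol\ell(\widehat{\mathbb W}^{\pi_n}_t)|^p\,dt\Bigr]<\varepsilon^p.$$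
   Context: $(\pi_n)_{n\in\mathbb{N}}$ is a nested sequence of partitions of $[0,T]$ with mesh $|\pi_n|\to0$. For $\pi=\{0=t_0<\cdots<t_m=T\}$, $W^{\pi}_t=W_{t_k}+\frac{t-t_k}{t_{k+1}-t_k}(W_{t_{k+1}}-W_{t_k})$ for $t\in[t_k,t_{k+1}]$. The integral $\int\sigma\,dW^{\pi_n}$ is a pathwise Riemann–Stieltjes integral ($W^{\pi_n}$ has bounded variation). Set $\widehat W^{\pi_n}_t=(t,W^{\pi_n}_t)\in\mathbb{R}^{d+1}$. The coordinates of $\mathbb{R}^{d+1}$ are indexed by $0,\ldots,d$, index $0$ being time, with canonical basis $e_0,\dots,e_d$. Multi-indices $I=(i_1,\ldots,i_k)$ have entries in $\{0,\ldots,d\}$, $|I|=k$, $e_I=e_{i_1}\otimes\cdots\otimes e_{i_k}$. $\widehat{\mathbb W}^{\pi_n}_t\in T((\mathbb{R}^{d+1}))=\prod_{k\ge0}(\mathbb{R}^{d+1})^{\otimes k}$ is the signature of $\widehat W^{\pi_n}$ on $[0,t]$: $\langle e_I,\widehat{\mathbb W}^{\pi_n}_t\rangle=\int_{0<u_1<\cdots<u_k<t}d\widehat W^{\pi_n,i_1}_{u_1}\cdots d\widehat W^{\pi_n,i_k}_{u_k}$ (pathwise Riemann–Stieltjes integrals), $\langle e_\emptyset,\cdot\rangle=1$. *)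

(* Defs.v *)
From mathcomp Require Export all_boot all_order all_algebra.
From mathcomp Require Export all_classical all_reals all_analysis.
Export Order.TTheory GRing.Theory Num.Theory.
Export numFieldNormedType.Exports.

Set Implicit Arguments.
Unset Strict Implicit.
Unset Printing Implicit Defensive.

Local Open Scope classical_set_scope.
Local Open Scope ring_scope.

(* Euclidean norm on column vectors, Frobenius norm on matrices; the library's
   norm on matrices is the sup norm. *)
Definition enorm (R : realType) (m n : nat) (A : 'M[R]_(m, n)) : R :=
  Num.sqrt (\sum_i \sum_j A i j ^+ 2).

(* As in [itv_partition a b s], the points of a partition of [a, b] are
   a :: s, i.e. the left endpoint is not part of s. *)
Definition mesh (R : realType) (a : R) (s : seq R) : R :=
  \big[Num.max/0]_(i < size s) ((a :: s)`_i.+1 - (a :: s)`_i).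

Section RiemannStieltjes.
Context {R : realType}.
Implicit Types (f g : R -> R) (a b : R).

Definition RS_tags a (s : seq R) (xi : nat -> R) : Prop :=
  forall i, (i < size s)%N -> (a :: s)`_i <= xi i <= (a :: s)`_i.+1.

Definition RS_sum f g a (s : seq R) (xi : nat -> R) : R :=
  \sum_(i < size s) f (xi i) * (g ((a :: s)`_i.+1) - g ((a :: s)`_i)).

Definition is_RS_integral f g a b (I : R) : Prop :=
  forall e : R, 0 < e -> exists2 delta : R, 0 < delta &
    forall (s : seq R) (xi : nat -> R),
      itv_partition a b s -> mesh a s < delta -> RS_tags a s xi ->
      `|RS_sum f g a s xi - I| < e.

(* The integral of f against dg over [a, b], and 0 if it does not exist. *)
Definition RS_integral f g a b : R := xget 0 (is_RS_integral f g a b).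

End RiemannStieltjes.

Section BrownianMotion.
Context {R : realType} {disp : measure_display} {Omega : measurableType disp}.
Variable P : probability Omega R.

(* The events B i may be the whole line, so the product rule for the full
   family contains the product rule for every subfamily. *)
Definition mutually_independent (I : finType) (X : I -> Omega -> R) : Prop :=
  forall B : I -> set R, (forall i, measurable (B i)) ->
    P (\bigcap_(i in [set: I]) (X i @^-1` B i))
    = (\prod_(i : I) P (X i @^-1` B i))%E.

Section Process.
Variables (d : nat) (T : R) (W : R -> Omega -> 'cV[R]_d).

Definition increment (s t : R) (j : 'I_d) (w : Omega) : R :=
  W t w j 0 - W s w j 0.

(* [normal_prob] takes the standard deviation. The independence clause is over
   the pairs (time step, coordinate); together with [bm_gaussian] it says that
   the increments over disjoint time intervals are independent and that
   W t - W s has law N(0, (t - s) I_d). *)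
Record brownian_motion : Prop := BrownianMotion {
  bm_measurable : forall (t : R) (j : 'I_d), 0 <= t <= T ->
    measurable_fun [set: Omega] (fun w => W t w j 0);
  bm_start : {ae P, forall w, W 0 w = 0};
  bm_gaussian : forall (s t : R) (j : 'I_d), 0 <= s -> s < t -> t <= T ->
    forall B : set R, measurable B ->
      pushforward P (increment s t j) B = normal_prob 0 (Num.sqrt (t - s)) B;
  bm_independent : forall (t0 : R) (s : seq R),
    0 <= t0 -> path <%R t0 s -> last t0 s <= T ->
    mutually_independent (fun k : 'I_(size s) * 'I_d =>
      increment (t0 :: s)`_(k.1) (t0 :: s)`_(k.1).+1 k.2);
  bm_continuous : {ae P, forall w, {within `[0, T], continuous (W ^~ w)}}
}.

End Process.
End BrownianMotion.

Fixpoint linear_interpolation (R : realType) (V : lmodType R)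
    (a : R) (s : seq R) (f : R -> V) (t : R) {struct s} : V :=
  if s is b :: s' then
    if t <= b then f a + ((t - a) / (b - a)) *: (f b - f a)
    else linear_interpolation b s' f t
  else f a.

Section Signature.
Context {R : realType}.

(* A series in T((R^n)) is given by its coordinates in the basis
   (e_I), indexed by the words I over 'I_n; [a I] is <e_I, a>. *)
Definition tensor_series (n : nat) := seq 'I_n -> R^o.

(* Iterated integrals; the head of [J] is the letter integrated last. *)
Fixpoint iterated_integral (n : nat) (X : R -> 'cV[R]_n) (J : seq 'I_n)
    (t : R) {struct J} : R :=
  if J is i :: J' then
    RS_integral (iterated_integral X J') (fun u => X u i 0) 0 t
  else 1.

Definition signature (n : nat) (X : R -> 'cV[R]_n) (t : R) :
  tensor_series n := fun I => iterated_integral X (rev I) t.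

(* Coordinate 0 is time, coordinate j + 1 is coordinate j of X. *)
Definition time_extended (d : nat) (X : R -> 'cV[R]_d) (t : R) :
  'cV[R]_(d.+1) := col_mx t%:M (X t).

End Signature.

Definition ode_solution (R : realType) (m d : nat) (T : R) (y0 : 'cV[R]_m)
    (mu : R -> 'cV[R]_m -> 'cV[R]_m) (sigma : R -> 'cV[R]_m -> 'M[R]_(m, d))
    (X : R -> 'cV[R]_d) (Y : R -> 'cV[R]_m) : Prop :=
  {within `[0, T], continuous Y} /\
  forall t : R, 0 <= t <= T -> forall i : 'I_m,
    Y t i 0 = y0 i 0
      + \int[lebesgue_measure]_(s in `[0, t]) mu s (Y s) i 0
      + \sum_(j < d)
          RS_integral (fun s => sigma s (Y s) i j) (fun s => X s j 0) 0 t.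

(* Main.v *)
From HB Require Import structures.
From mathcomp Require Import measurable_realfun ring lra.
Require Import Defs.

(** The interpolation of [W] along a fixed partition depends on finitely many
    Gaussian increments, so the time-extended path [X] is Lipschitz on [0, T]
    with a random constant [K >= 1] all of whose exponential moments are finite
    ([brownian_driver]).

    A process on [Omega * [0, T]] is called approximable ([sig_approx]) if it
    is measurable, bounded by [C * exp (C * K)], and a limit of linear
    functionals of the signature in L^r(P x dt) for every integer r >= 1.  The
    coordinates of [Y] are shown to be approximable by building [Y] from
    operations that preserve this property.

    Algebra.  Products of linear functionals of the signature are again such
    functionals by the shuffle identity ([word_comb_mulE]), and integrating one
    against [X^J] appends the letter [J] to its words.  Young's inequality and
    Jensen's inequality in time turn these identities into closure of the
    approximable processes under products ([sig_approxM]) and under integration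
    against a coordinate of [X] ([sig_approx_integral_along]); closure under
    dominated pointwise limits is [sig_approx_lim].

    Nonlinear functions.  Iterated integrals of order three and more are
    polynomials in Gaussian variables without exponential moments, so power series
    in an arbitrary approximable process need not converge in mean.  Processes
    [f] with |f| <= C * K behave better: for these the Taylor series of sin (l f)
    is dominated by exp (l |f|), hence sin (l f) is approximable; |f| is the limit
    of |sin (l f)| / l as l decreases to 0, which gives minima and maxima; and a
    bounded continuous function of the time and of finitely many such processes
    is a limit of finite minima of functions of the form
    c + k * distance ([sig_approx_comp]).

    Equation.  In the Picard iteration for [Y] the coefficients of step k are
    clipped at level k.  Each iterate then integrates bounded coefficients against
    a path of speed [K], so it is bounded by C * K, and induction shows that all
    iterates are approximable.  For a fixed outcome the coefficients along [Y]
    are bounded, so clipping is eventually inactive along [Y] and the iterates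
    converge to [Y] ([picard_cvg]); linear growth of the coefficients bounds all
    of them by a common M * exp (lam * K * T) ([picard_bound]).  Hence [Y] is
    approximable ([solution_sig_approx]), and an integer r >= p turns this into
    the L^p statement ([sig_approx_Lp]).

    All Riemann-Stieltjes integrals are handled through [primitive]: [F] is the
    integral of [a] against [g] if its increments agree with those of the left
    point rule up to o(t - s).  Uniqueness, linearity, the product rule and
    Gronwall-type bounds follow directly from this description. *)

Set Implicit Arguments.
Unset Strict Implicit.
Unset Printing Implicit Defensive.

Local Open Scope classical_set_scope.
Local Open Scope ring_scope.

(** * Primitives along Lipschitz paths *)

Section PathCalculus.
Context {R : realType} (T : R).
Hypothesis T0 : 0 <= T.
Implicit Types (a b f g h F G : R -> R) (s t : R).

Definition unif_cont_on a : Prop := forall e : R, 0 < e -> exists2 delta : R, 0 < delta &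
  forall s t, 0 <= s <= T -> 0 <= t <= T -> `|t - s| < delta -> `|a t - a s| <= e.

Definition lipschitz_on (K : R) g : Prop := forall s t,
  0 <= s -> s <= t -> t <= T -> `|g t - g s| <= K * (t - s).

(** A quantity attached to short intervals that is at most o(t - s), uniformly
    on [0, T].  Only an upper bound is asked for, so that the notion can also
    express one-sided differential inequalities. *)
Definition locally_small (D : R -> R -> R) : Prop :=
  forall e : R, 0 < e -> exists2 delta : R, 0 < delta &
  forall s t, 0 <= s -> s <= t -> t <= T -> t - s < delta -> D s t <= e * (t - s).

(** The sewing description of [F] as the integral of [a] against [g].  It is
    equivalent to the Riemann-Stieltjes description when [a] is continuous and
    [g] is Lipschitz ([RS_integralE]), but it is local and stable under sums,
    products and clamping. *)
Definition primitive a g F : Prop :=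
  F 0 = 0 /\ locally_small (fun s t => `|F t - F s - a s * (g t - g s)|).

Lemma locally_small_le (D1 D2 : R -> R -> R) :
  locally_small D2 ->
  (forall s t, 0 <= s -> s <= t -> t <= T -> D1 s t <= D2 s t) ->
  locally_small D1.
Proof.
move=> D2s D12 e /D2s[delta d0 H]; exists delta => // s t s0 st tT ts.
exact: le_trans (D12 _ _ s0 st tT) (H _ _ s0 st tT ts).
Qed.

Lemma locally_smallD (D1 D2 : R -> R -> R) :
  locally_small D1 -> locally_small D2 ->
  locally_small (fun s t => D1 s t + D2 s t).
Proof.
move=> S1 S2 e e0; have e20 : 0 < e / 2 by lra.
have [d1 d10 H1] := S1 _ e20; have [d2 d20 H2] := S2 _ e20.
exists (Num.min d1 d2); first by rewrite lt_min d10.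
move=> s t s0 st tT; rewrite lt_min => /andP[ts1 ts2].
have := H1 _ _ s0 st tT ts1; have := H2 _ _ s0 st tT ts2; nra.
Qed.

Lemma locally_smallZ (c : R) (D : R -> R -> R) : 0 <= c ->
  locally_small D -> locally_small (fun s t => c * D s t).
Proof.
move=> c0 DS e e0; have e' : 0 < e / (c + 1) by rewrite divr_gt0 ?ltr_wpDl.
have [d d0 H] := DS _ e'; exists d => // s t s0 st tT ts.
have /(ler_wpM2l c0)/le_trans := H _ _ s0 st tT ts; apply.
rewrite mulrA; apply: ler_wpM2r; first lra.
by rewrite mulrCA ger_pMr// ler_pdivrMr; lra.
Qed.

(** Cutting [s, t] into n equal pieces bounds the total increase by e * (t - s)
    for every e > 0.  This replaces the mean value theorem throughout. *)
Lemma locally_small_nonincreasing (D : R -> R) :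
  locally_small (fun s t => D t - D s) ->
  forall s t, 0 <= s -> s <= t -> t <= T -> D t <= D s.
Proof.
move=> DS s t s0 st tT; apply/ler_addgt0Pl => e e0.
have e' : 0 < e / (t - s + 1) by rewrite divr_gt0//; lra.
have [d d0 H] := DS _ e'.
pose n := (Num.truncn ((t - s) / d)).+1.
have n0 : 0 < n%:R :> R by rewrite ltr0n.
have tsn : (t - s) / n%:R < d.
  by rewrite ltr_pdivrMr// mulrC -ltr_pdivrMr//; exact: truncnS_gt.
pose x k := s + (t - s) * (k%:R / n%:R).
have xS k : x k.+1 - x k = (t - s) / n%:R.
  by rewrite /x -addn1 natrD; field; rewrite lt0r_neq0.
have step k : (k <= n)%N -> D (x k) - D s <= e / (t - s + 1) * (x k - s).
  elim: k => [_|k IH kn]; first by rewrite /x mul0r mulr0 addr0 !subrr mulr0.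
  have xk0 : s <= x k by rewrite /x lerDl mulr_ge0 ?subr_ge0// divr_ge0.
  have xSt : x k.+1 <= t.
    rewrite /x addrC -lerBrDr ler_piMr ?subr_ge0//.
    by rewrite ler_pdivrMr// mul1r ler_nat.
  have xkS : x k <= x k.+1 by rewrite -subr_ge0 xS divr_ge0 ?subr_ge0.
  have := IH (ltnW kn).
  have := H _ _ (le_trans s0 xk0) xkS (le_trans xSt tT).
  rewrite xS => /(_ tsn).
  have := xS k; nra.
have := step n (leqnn _).
have -> : x n = t by rewrite /x divff ?lt0r_neq0// mulr1; ring.
move=> H1; suff : e / (t - s + 1) * (t - s) <= e by lra.
by rewrite mulrAC ler_pdivrMr; nra.
Qed.

Lemma locally_small_cst (D : R -> R) : locally_small (fun s t => `|D t - D s|) ->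
  forall t, 0 <= t <= T -> D t = D 0.
Proof.
move=> DS t /andP[t0 tT]; apply/eqP; rewrite eq_le; apply/andP; split.
  apply: locally_small_nonincreasing => //.
  by apply: (locally_small_le DS) => u v _ _ _; exact: ler_norm.
rewrite -lerN2; apply: (@locally_small_nonincreasing (fun u => - D u)) => //.
apply: (locally_small_le DS) => u v _ _ _.
by rewrite opprK addrC -normrN opprB ler_norm.
Qed.

Lemma primitive_unique a g F1 F2 : primitive a g F1 -> primitive a g F2 ->
  forall t, 0 <= t <= T -> F1 t = F2 t.
Proof.
move=> [F10 P1] [F20 P2] t tT; apply/eqP; rewrite -subr_eq0.
have -> : F1 t - F2 t = F1 0 - F2 0.
  apply: (@locally_small_cst (fun u => F1 u - F2 u)) => //.
  apply: (locally_small_le (locally_smallD P1 P2)) => s u _ _ _.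
  apply: le_trans (ler_normB _ _).
  by rewrite le_eqVlt; apply/orP; left; apply/eqP; congr (`| _ |); ring.
by rewrite F10 F20 subrr.
Qed.

Lemma lipschitz_on_le K K' g : K <= K' -> lipschitz_on K g -> lipschitz_on K' g.
Proof.
move=> KK gl s t s0 st tT; apply: le_trans (gl s t s0 st tT) _.
by apply: ler_wpM2r => //; rewrite subr_ge0.
Qed.

Lemma lipschitz_on_unif_cont K g : lipschitz_on K g -> unif_cont_on g.
Proof.
move=> gl e e0; have K1 : 0 < `|K| + 1 by rewrite ltr_wpDl.
have gl' := lipschitz_on_le (ler_norm K) gl.
exists (e / (`|K| + 1)); first exact: divr_gt0.
move=> s t /andP[s0 sT] /andP[t0 tT]; rewrite ltr_pdivlMr// => ts.
have [st|ts'] := leP s t.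
  apply: le_trans (gl' s t s0 st tT) _; apply: le_trans (ltW ts).
  by rewrite [`|t - s|]ger0_norm ?subr_ge0// mulrC ler_wpM2l ?subr_ge0// lerDl.
rewrite distrC; apply: le_trans (gl' t s t0 (ltW ts') sT) _; apply: le_trans (ltW ts).
have st0 : 0 <= s - t by rewrite subr_ge0 ltW.
by rewrite distrC [`|s - t|]ger0_norm// mulrC ler_wpM2l// lerDl.
Qed.

(** |F - F s0| - B is nonincreasing: over a short interval |F| grows by at most
    |a s| * K * (t - s) up to o(t - s). *)
Lemma primitive_le a g F (K : R) (B : R -> R) (s0 t0 : R) : 0 <= K ->
  lipschitz_on K g -> primitive a g F ->
  (forall s t, 0 <= s -> s <= t -> t <= T -> `|a s| * K * (t - s) <= B t - B s) ->
  0 <= s0 -> s0 <= t0 -> t0 <= T -> `|F t0 - F s0| <= B t0 - B s0.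
Proof.
move=> K0 gl [_ FS] aB s00 st tT.
suff /(_ s0 t0 s00 st tT) : forall s t, 0 <= s -> s <= t -> t <= T ->
  (fun u => `|F u - F s0| - B u) t <= (fun u => `|F u - F s0| - B u) s.
  by rewrite subrr normr0; lra.
apply: locally_small_nonincreasing.
apply: (locally_small_le FS) => s t s00' st' tT'.
have := aB s t s00' st' tT'; have := gl s t s00' st' tT'.
have : `|F t - F s0| - `|F s - F s0| <= `|F t - F s|.
  by apply: le_trans (lerB_dist _ _) _; rewrite opprB addrA subrK.
have : `|F t - F s| <= `|F t - F s - a s * (g t - g s)| + `|a s| * `|g t - g s|.
  by rewrite -normrM -[X in `|X| <= _](subrK (a s * (g t - g s))) ler_normD.
have := normr_ge0 (a s); nra.
Qed.

(** The inequality behind both the growth bound and the contraction of the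
    Picard iteration: an exponential weight of rate [l] reproduces itself under
    integration with a factor [K / l]. *)
Lemma primitive_exp a g F (K A l : R) : 0 <= K -> 0 < l -> 0 <= A ->
  lipschitz_on K g -> primitive a g F ->
  (forall s, 0 <= s <= T -> `|a s| <= A * expR (l * s)) ->
  forall t, 0 <= t <= T -> `|F t| <= A * K / l * (expR (l * t) - 1).
Proof.
move=> K0 l0 A0 gl PF aA t /andP[t0 tT].
pose B u := A * K / l * expR (l * u).
have : `|F t - F 0| <= B t - B 0.
  apply: (@primitive_le a g F K B 0 t K0 gl PF) => // s u s0 su uT.
  have sT : 0 <= s <= T by rewrite s0 (le_trans su uT).
  apply: (@le_trans _ _ (A * expR (l * s) * K * (u - s))).
    by rewrite !ler_wpM2r ?subr_ge0// aA.
  rewrite /B -mulrBr.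
  have -> : l * u = l * s + l * (u - s) by ring.
  rewrite expRD.
  have -> : A * expR (l * s) * K * (u - s)
    = A * K / l * (expR (l * s) * (1 + l * (u - s) - 1)).
    by field; rewrite lt0r_neq0.
  apply: ler_wpM2l; first by rewrite divr_ge0 ?mulr_ge0// ltW.
  rewrite -[X in _ <= _ - X]mulr1 -mulrBr ler_wpM2l ?expR_ge0//.
  by rewrite lerB// expR_ge1Dx.
by rewrite PF.1 subr0 /B mulr0 expR0 -mulrBr.
Qed.

Lemma primitive_lipschitz a g F (K A : R) : 0 <= K ->
  lipschitz_on K g -> primitive a g F ->
  (forall s, 0 <= s <= T -> `|a s| <= A) -> lipschitz_on (A * K) F.
Proof.
move=> K0 gl PF aA s t s0 st tT.
have := @primitive_le a g F K (fun u => A * K * u) s t K0 gl PF.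
rewrite -mulrBr; apply => // u v u0 uv vT; rewrite -mulrBr.
by rewrite !ler_wpM2r ?subr_ge0// aA// u0 (le_trans uv vT).
Qed.

Lemma unif_cont_bounded a : unif_cont_on a ->
  exists2 A : R, 0 <= A & forall s, 0 <= s <= T -> `|a s| <= A.
Proof.
move=> /(_ 1 ltr01)[d d0 H].
(* the path to s is covered by n steps shorter than d, each changing a by at
   most 1 *)
pose n := (Num.truncn (T / d)).+1.
have n0 : 0 < n%:R :> R by rewrite ltr0n.
exists (`|a 0| + n%:R) => [|s /andP[s0 sT]]; first by rewrite addr_ge0.
have sn : s / n%:R < d.
  rewrite ltr_pdivrMr// mulrC -ltr_pdivrMr//.
  by apply: le_lt_trans (truncnS_gt _); rewrite ler_pM2r ?invr_gt0.
have step k : (k <= n)%N -> `|a (s * (k%:R / n%:R))| <= `|a 0| + k%:R.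
  have bd j : (j <= n)%N -> 0 <= s * (j%:R / n%:R) <= T.
    move=> jn; rewrite mulr_ge0 ?divr_ge0//=; apply: le_trans sT.
    by rewrite ler_piMr// ler_pdivrMr// mul1r ler_nat.
  elim: k => [_|k IH kn]; first by rewrite mul0r mulr0 addr0.
  have /H := bd _ (ltnW kn) => /(_ _ (bd _ kn)).
  have -> : s * (k.+1%:R / n%:R) - s * (k%:R / n%:R) = s / n%:R.
    by rewrite -addn1 natrD; field; rewrite lt0r_neq0.
  rewrite ger0_norm ?divr_ge0// => /(_ sn) H1.
  have := IH (ltnW kn); rewrite -[k.+1]addn1 natrD.
  have := ler_normD (a (s * (k.+1%:R / n%:R)) - a (s * (k%:R / n%:R))) (a (s * (k%:R /
    n%:R))).
  rewrite subrK -[k.+1]addn1 natrD; move: H1; rewrite -[k.+1]addn1 natrD; lra.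
by have := step n (leqnn _); rewrite divff ?lt0r_neq0// mulr1.
Qed.

Lemma primitiveD a g F h G : primitive a g F -> primitive a h G ->
  primitive a (fun u => g u + h u) (fun u => F u + G u).
Proof.
move=> [F0 FS] [G0 GS]; split; first by rewrite F0 G0 addr0.
apply: (locally_small_le (locally_smallD FS GS)) => s t _ _ _.
by apply: le_trans (ler_normD _ _); rewrite le_eqVlt; apply/orP; left;
  apply/eqP; congr (`| _ |); ring.
Qed.

Lemma primitiveZ a g F (c : R) : primitive a g F ->
  primitive a (fun u => c * g u) (fun u => c * F u).
Proof.
move=> [F0 FS]; split; first by rewrite F0 mulr0.
apply: (locally_small_le (locally_smallZ (normr_ge0 c) FS)) => s t _ _ _.
by rewrite -normrM le_eqVlt; apply/orP; left;
  apply/eqP; congr (`| _ |); ring.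
Qed.

Lemma primitive_cst a (c : R) : primitive a (fun=> c) (fun=> 0).
Proof.
split=> // e e0; exists 1 => // s t s0 st tT _.
by rewrite !subrr mulr0 subrr normr0 mulr_ge0 ?subr_ge0// ltW.
Qed.

Lemma primitive_sum a (n : nat) (g F : 'I_n -> R -> R) :
  (forall i, primitive a (g i) (F i)) ->
  primitive a (fun u => \sum_(i < n) g i u) (fun u => \sum_(i < n) F i u).
Proof.
elim: n g F => [|n IH] g F H.
  under [X in primitive _ X]eq_fun do rewrite big_ord0.
  under [X in primitive _ _ X]eq_fun do rewrite big_ord0.
  exact: primitive_cst.
under [X in primitive _ X]eq_fun do rewrite big_ord_recr/=.
under [X in primitive _ _ X]eq_fun do rewrite big_ord_recr/=.
by apply: primitiveD => //; exact: IH.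
Qed.

Lemma primitiveDl a b g F G : primitive a g F -> primitive b g G ->
  primitive (fun u => a u + b u) g (fun u => F u + G u).
Proof.
move=> [F0 FS] [G0 GS]; split; first by rewrite F0 G0 addr0.
apply: (locally_small_le (locally_smallD FS GS)) => s t _ _ _.
by apply: le_trans (ler_normD _ _); rewrite le_eqVlt; apply/orP; left;
  apply/eqP; congr (`| _ |); ring.
Qed.

Lemma primitiveZl a g F (c : R) : primitive a g F ->
  primitive (fun u => c * a u) g (fun u => c * F u).
Proof.
move=> [F0 FS]; split; first by rewrite F0 mulr0.
apply: (locally_small_le (locally_smallZ (normr_ge0 c) FS)) => s t _ _ _.
by rewrite -normrM le_eqVlt; apply/orP; left;
  apply/eqP; congr (`| _ |); ring.
Qed.

(** Freezing the integrator after time [c] freezes the integral.  Piecewise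
    linear paths are combinations of clamped times, so this reduces all
    integrals to integrals against time. *)
Lemma primitive_clamp a F (c : R) : 0 <= c <= T -> primitive a id F ->
  primitive a (fun u => Num.min u c) (fun u => F (Num.min u c)).
Proof.
move=> /andP[c0 cT] [F0 FS]; split; first by rewrite min_l.
move=> e e0; have [d d0 H] := FS e e0; exists d => // s t s0 st tT ts.
have [sc|cs] := leP s c; last first.
  rewrite min_r ?(le_trans (ltW cs) st)//.
  by rewrite !subrr mulr0 subrr normr0 mulr_ge0 ?subr_ge0// ltW.
have [tc|ct] := leP t c; first exact: H.
have := H s c s0 sc cT.
move=> /(_ _)/le_trans; apply; first lra.
by apply: ler_wpM2l; lra.
Qed.

(** Heine's theorem, from the near-covering form of compactness. *)
Lemma continuous_unif_cont a : {within `[0, T], continuous a} -> unif_cont_on a.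
Proof.
move=> /subspace_continuousP ca e e0.
have /compact_near_coveringP nc := @segment_compact R 0 T.
have ca' x : 0 <= x <= T -> exists2 d, 0 < d &
    forall y, 0 <= y <= T -> `|y - x| < d -> `|a y - a x| <= e / 2.
  move=> xT; have xI : [set` `[0, T]] x by rewrite /= in_itv.
  have := ca x xI.
  move=> /cvgrPdist_le /(_ (e / 2)); rewrite divr_gt0// => /(_ isT).
  rewrite near_withinE => /nbhs_ballP[d/= d0 H]; exists d => // y yT yx.
  rewrite distrC; apply: H; last by rewrite /= in_itv.
  by rewrite /ball/= distrC.
pose P (d x : R) := 0 <= x <= T -> forall y, 0 <= y <= T -> `|y - x| < d -> `|a y - a
  x| <= e.
have H : \forall d \near 0^'+, [set` `[0, T]] `<=` P d.
  apply: nc => x; rewrite /= in_itv/= => xT; have [d d0 H] := ca' x xT.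
  near=> x' d' => x'T y yT yx'.
  have x'x : `|x' - x| < d / 2.
    by rewrite distrC; near: x'; apply: nbhsx_ballx; rewrite divr_gt0.
  have d'd : d' < d / 2 by near: d'; apply: nbhs_right_lt; rewrite divr_gt0.
  have H1 := H x' x'T.
  have H2 := H y yT.
  have := ler_distD x y x'.
  have := ler_distD (a x) (a y) (a x').
  rewrite [`|a x - a x'|]distrC [`|x - x'|]distrC.
  have : `|x' - x| < d by lra.
  move=> /H1 h1.
  have : `|y - x| < d.
    have -> : y - x = (y - x') + (x' - x) by ring.
    apply: le_lt_trans (ler_normD _ _) _.
    by apply: (lt_le_trans (ltrD (lt_trans yx' d'd) x'x)); rewrite -splitr.
  move=> /H2 h2; lra.
have [d [d0 Hd]] : exists d, 0 < d /\ [set` `[0, T]] `<=` P d.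
  near (0 : R)^'+ => d; exists d; split; near: d => //.
  exact: nbhs_right_gt.
by exists d => // s t sT tT ts; apply: Hd => //; rewrite /= in_itv.
Unshelve. all: by end_near. Qed.

Lemma unif_cont_continuous a : unif_cont_on a -> {within `[0, T], continuous a}.
Proof.
move=> ua; apply/subspace_continuousP => x; rewrite /= in_itv/= => xT.
apply/cvgrPdist_le => e e0; have [d d0 H] := ua e e0.
rewrite near_withinE; apply/nbhs_ballP; exists d => //= y.
rewrite /ball/= distrC => yx; rewrite in_itv/= => yT.
by rewrite distrC; apply: H.
Qed.

Lemma primitive_time a : {within `[0, T], continuous a} ->
  primitive a id (fun t => \int[lebesgue_measure]_(s in `[0, t]) a s).
Proof.
move=> ca; split; first by rewrite set_itv1 Rintegral_set1.
move=> e e0; have [d d0 H] := continuous_unif_cont ca e0.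
exists d => // s t s0 st tT ts.
have ia : lebesgue_measure.-integrable `[0, T] (EFin \o a).
  by apply: continuous_compact_integrable => //; exact: segment_compact.
have iat u : u <= T -> lebesgue_measure.-integrable `[0, u] (EFin \o a).
  by move=> uT; apply: integrableS ia => //; apply: subset_itvl; rewrite bnd_simp.
have ist : lebesgue_measure.-integrable `]s, t] (EFin \o a).
  apply: integrableS ia => //; apply: subset_itv; rewrite bnd_simp//.
rewrite Rintegral_itvB ?bnd_simp//; last exact: iat.
have -> : a s * (t - s) = \int[lebesgue_measure]_(u in `]s, t]) a s.
  rewrite Rintegral_cst//= lebesgue_measure_itv/= lte_fin; congr (_ * _).
  by case: ltP => [_|ts'] //=; apply/eqP; rewrite subr_eq0 eq_le st ts'.
have ic0 c : lebesgue_measure.-integrable `[0, T] (EFin \o (fun _ : R => c)).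
  apply: continuous_compact_integrable; first exact: segment_compact.
  by apply: continuous_subspaceT => x; exact: cst_continuous.
have ic c : lebesgue_measure.-integrable `]s, t] (EFin \o (fun _ : R => c)).
  by apply: integrableS (ic0 c) => //; apply: subset_itv; rewrite bnd_simp.
have ib : lebesgue_measure.-integrable `]s, t] (EFin \o (fun u => a u - a s)).
  exact: (@integrableB _ _ _ lebesgue_measure _ (measurable_itv `]s, t]) _ _ ist (ic (a
    s))).
rewrite -(RintegralB _ ist (ic (a s)))//.
apply: le_trans (le_normr_Rintegral _ _) _ => //.
apply: (@le_trans _ _ (\int[lebesgue_measure]_(u in `]s, t]) e)).
  apply: le_Rintegral => //.
  - exact: integrable_norm ib.
  - move=> u; rewrite /= in_itv/= => /andP[su ut]; apply: H.
    + by rewrite s0 (le_trans st).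
    + by rewrite (le_trans s0 (ltW su)) (le_trans ut).
    + by rewrite ger0_norm ?subr_ge0; lra.
rewrite Rintegral_cst//= lebesgue_measure_itv/= lte_fin; apply: ler_wpM2l; first exact:
  ltW.
by case: ltP => [_|ts'] //=; rewrite subr_ge0.
Qed.

(** Integration by parts: the product of increments of [F] and [G] is
    O((t - s)^2), hence negligible. *)
Lemma primitive_mul a b g h F G (K L : R) : unif_cont_on a -> unif_cont_on b ->
  lipschitz_on K g -> lipschitz_on L h -> 0 <= K -> 0 <= L ->
  primitive a g F -> primitive b h G -> forall F' G',
  primitive (fun u => a u * G u) g F' -> primitive (fun u => F u * b u) h G' ->
  forall t, 0 <= t <= T -> F t * G t = F' t + G' t.
Proof.
move=> ua ub gl hl K0 L0 PF PG F' G' PF' PG' t tT.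
have [A A0 aA] := unif_cont_bounded ua.
have [B B0 bB] := unif_cont_bounded ub.
have FL := primitive_lipschitz K0 gl PF aA.
have GL := primitive_lipschitz L0 hl PG bB.
have [C C0 FC] := unif_cont_bounded (lipschitz_on_unif_cont FL).
have [D D0 GD] := unif_cont_bounded (lipschitz_on_unif_cont GL).
have sq : locally_small (fun s t => `|F t - F s| * `|G t - G s|).
  move=> e e0; have M0 : 0 < A * K * (B * L) + 1 by rewrite ltr_wpDl// !mulr_ge0.
  (* the increments of F and G are at most A * K and B * L times u - v *)
  exists (e / (A * K * (B * L) + 1)); first exact: divr_gt0.
  move=> u v u0 uv vT; rewrite ltr_pdivlMr// => uvd.
  have := FL u v u0 uv vT; have := GL u v u0 uv vT => H1 H2.
  apply: le_trans (ler_pM _ _ H2 H1) _ => //.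
  have -> : A * K * (v - u) * (B * L * (v - u)) = (v - u) * (A * K * (B * L)) * (v - u)
    by ring.
  apply: ler_wpM2r; first lra.
  apply: le_trans (ltW uvd); rewrite mulrDr mulr1 lerDl; lra.
have E : F t * G t - F' t - G' t = F 0 * G 0 - F' 0 - G' 0.
  apply: (@locally_small_cst (fun u => F u * G u - F' u - G' u)) => //.
  apply: locally_small_le; first exact: (locally_smallD
    (locally_smallD PF'.2 PG'.2) (locally_smallD (locally_smallD (locally_smallZ C0 PG.2)
     (locally_smallZ D0 PF.2)) sq)).
  move=> u v u0 uv vT /=.
  have uT : 0 <= u <= T by rewrite u0 (le_trans uv).
  have := FC u uT; have := GD u uT => GDu FCu.
  apply: (@le_trans _ _ (`|F' v - F' u - a u * G u * (g v - g u)| +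
    `|G' v - G' u - F u * b u * (h v - h u)| +
    (`|F u| * `|G v - G u - b u * (h v - h u)| +
      `|G u| * `|F v - F u - a u * (g v - g u)| + `|F v - F u| * `|G v - G u|))).
    rewrite -!normrM.
    have -> : F v * G v - F' v - G' v - (F u * G u - F' u - G' u) =
     - (F' v - F' u - a u * G u * (g v - g u)) - (G' v - G' u - F u * b u * (h v - h u))
     + (F u * (G v - G u - b u * (h v - h u)) + G u * (F v - F u - a u * (g v - g u))
      + (F v - F u) * (G v - G u)) by ring.
    apply: le_trans (ler_normD _ _) _; apply: lerD.
      by apply: le_trans (ler_normB _ _) _; rewrite normrN.
    by apply: le_trans (ler_normD _ _) _; rewrite lerD2r ler_normD.
  by rewrite !lerD// ler_wpM2r.
move: E; rewrite PF.1 PF'.1 PG'.1 mul0r !subr0; lra.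
Qed.

(** Over each interval of a fine tagged partition, the increment of [F] is the
    left point rule up to o(t - s), and moving the tag costs the oscillation of
    [a] times the increment of [g]. *)
Lemma primitive_RS a g F (K : R) : unif_cont_on a -> lipschitz_on K g -> 0 <= K ->
  primitive a g F -> forall t, 0 <= t <= T -> is_RS_integral a g 0 t (F t).
Proof.
move=> ua gl K0 [F0 FS] t /andP[t0 tT] e e0.
have e' : 0 < e / 2 / (t + 1) by rewrite !divr_gt0//; lra.
have e2 : 0 < e / 2 / (t + 1) / (K + 1) by rewrite !divr_gt0//; lra.
have [d1 d10 H1] := FS _ e'; have [d2 d20 H2] := ua _ e2.
exists (Num.min d1 d2); first by rewrite lt_min d10.
move=> s xi st; rewrite lt_min => /andP[ms1 ms2] tag.
pose x k := (0 :: s)`_k.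
have xE k : (k <= size s)%N -> x k = nth t (0 :: s) k.
  by move=> ks; apply: set_nth_default; rewrite /= ltnS.
have x_ge k : (k <= size s)%N -> 0 <= x k.
  by move=> ks; rewrite xE//; apply: itv_partition_nth_ge.
have x_le k : (k <= size s)%N -> x k <= t.
  by move=> ks; rewrite xE//; apply: itv_partition_nth_le st.
have x_lt k : (k < size s)%N -> x k <= x k.+1.
  move=> ks; case: st => /(pathP 0)/(_ _ ks) + _; exact: ltW.
have x_mesh k : (k < size s)%N -> x k.+1 - x k <= mesh 0 s.
  by move=> ks; rewrite /mesh (bigmaxD1 (Ordinal ks))//= le_max lexx.
have E : \sum_(i < size s) (F (x i.+1) - F (x i)) = F t.
  rewrite -(big_mkord xpredT (fun i => F (x i.+1) - F (x i))) telescope_sumr// /x /= F0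
    subr0.
  by have := itv_partition_nth_size 0 st => /= ->.
have E2 : \sum_(i < size s) (x i.+1 - x i) = t.
  rewrite -(big_mkord xpredT (fun i => x i.+1 - x i)) telescope_sumr// /x subr0.
  by have := itv_partition_nth_size 0 st => /= ->.
rewrite /RS_sum -E -sumrB.
apply: (@le_lt_trans _ _ (\sum_(i < size s) e / (t + 1) * (x i.+1 - x i))).
  apply: le_trans (ler_norm_sum _ _ _) _; apply: ler_sum => i _.
  have is_ := ltn_ord i; have isW := ltnW is_.
  have /andP[ti1 ti2] := tag i is_.
  have hF := H1 _ _ (x_ge _ isW) (x_lt _ is_) (le_trans (x_le _ is_) tT)
     (le_lt_trans (x_mesh _ is_) ms1).
  have ha : `|a (xi i) - a (x i)| <= e / 2 / (t + 1) / (K + 1).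
    apply: H2.
    - by rewrite x_ge// (le_trans (x_le _ isW) tT).
    - by rewrite (le_trans (x_ge _ isW))//= (le_trans ti2)// (le_trans (x_le _ is_) tT).
    - rewrite ger0_norm ?subr_ge0//; apply: le_lt_trans ms2; apply: le_trans (x_mesh _
      is_).
      by rewrite lerB.
  have hg := gl _ _ (x_ge _ isW) (x_lt _ is_) (le_trans (x_le _ is_) tT).
  have -> : a (xi i) * (g (x i.+1) - g (x i)) - (F (x i.+1) - F (x i)) =
     (a (xi i) - a (x i)) * (g (x i.+1) - g (x i)) -
     (F (x i.+1) - F (x i) - a (x i) * (g (x i.+1) - g (x i))) by ring.
  apply: le_trans (ler_normB _ _) _; rewrite normrM.
  have -> : e / (t + 1) * (x i.+1 - x i) = e / 2 / (t + 1) * (x i.+1 - x i) +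
     e / 2 / (t + 1) * (x i.+1 - x i) by field; lra.
  apply: lerD => //.
  apply: le_trans (ler_pM _ _ ha hg) _ => //.
  rewrite mulrA; apply: ler_wpM2r; first by rewrite subr_ge0 x_lt.
  by rewrite mulrAC ler_pdivrMr ?ltr_wpDl//; apply: ler_wpM2l; [exact: ltW|rewrite lerDl].
rewrite -mulr_sumr E2 mulrAC ltr_pdivrMr; nra.
Qed.

Lemma exists_fine_partition t (e : R) : 0 <= t -> 0 < e ->
  exists s : seq R, itv_partition 0 t s /\ mesh 0 s < e.
Proof.
rewrite le_eqVlt => /predU1P[<-|t0] e0.
  by exists [::]; split; [split => //=|rewrite /mesh big_ord0].
pose n := (Num.truncn (t / e)).+1.
have n0 : 0 < n%:R :> R by rewrite ltr0n.
have tn : t / n%:R < e.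
  by rewrite ltr_pdivrMr// mulrC -ltr_pdivrMr//; exact: truncnS_gt.
pose s := mkseq (fun k => t * (k.+1%:R / n%:R)) n.
have sE k : (k <= n)%N -> (0 :: s)`_k = t * (k%:R / n%:R).
  by case: k => [_|k kn]; rewrite /= ?mul0r ?mulr0// nth_mkseq.
have ss : size s = n by rewrite size_mkseq.
have sS k : (k < n)%N -> (0 :: s)`_k.+1 - (0 :: s)`_k = t / n%:R.
  by move=> kn; rewrite !sE// 1?ltnW// -[k.+1]addn1 natrD; field; rewrite lt0r_neq0.
exists s; split; first split.
- apply/(pathP 0) => i; rewrite ss => si; rewrite -subr_gt0 (sS _ si).
  exact: divr_gt0.
- rewrite (last_nth 0) ss sE// divff ?lt0r_neq0// mulr1 //.
- apply/bigmax_ltP; split => // i _; rewrite sS// -ss//.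
Qed.

Lemma is_RS_integral_unique a g t (I1 I2 : R) : 0 <= t ->
  is_RS_integral a g 0 t I1 -> is_RS_integral a g 0 t I2 -> I1 = I2.
Proof.
move=> t0 H1 H2; apply/eqP; rewrite -subr_eq0 -normr_eq0 eq_le normr_ge0 andbT.
apply/ler_addgt0Pl => e e0; rewrite addr0; have e2 : 0 < e / 2 by lra.
have [d1 d10 {}H1] := H1 _ e2; have [d2 d20 {}H2] := H2 _ e2.
have [s [sp sm]] : exists s : seq R, itv_partition 0 t s /\ mesh 0 s < Num.min d1 d2.
  by apply: exists_fine_partition; rewrite ?lt_min ?d10.
move: sm; rewrite lt_min => /andP[sm1 sm2].
have tag : RS_tags 0 s (fun i => (0 :: s)`_i).
  by move=> i si; rewrite lexx/=; case: sp => /(pathP 0)/(_ _ si)/ltW.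
have := H1 _ _ sp sm1 tag; have := H2 _ _ sp sm2 tag.
set S := RS_sum _ _ _ _ _ => h2 h1.
have : `|I1 - I2| <= `|S - I2| + `|S - I1|.
  by apply: le_trans (ler_normB _ _); rewrite le_eqVlt; apply/orP; left; apply/eqP;
    congr (`|_|); ring.
lra.
Qed.

Lemma RS_integralE a g F (K : R) : unif_cont_on a -> lipschitz_on K g -> 0 <= K ->
  primitive a g F -> forall t, 0 <= t <= T -> RS_integral a g 0 t = F t.
Proof.
move=> ua gl K0 PF t tT; have PRS := primitive_RS ua gl K0 PF tT.
rewrite /RS_integral; apply: is_RS_integral_unique PRS; first by case/andP: tT.
exact: (xgetPex 0 (ex_intro _ _ (primitive_RS ua gl K0 PF tT))).
Qed.

Lemma eq_primitive a b g h F G : primitive a g F ->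
  (forall t, 0 <= t <= T -> a t = b t) -> (forall t, 0 <= t <= T -> g t = h t) ->
  (forall t, 0 <= t <= T -> F t = G t) ->
  primitive b h G.
Proof.
move=> [F0 FS] ab gh FG; split; first by rewrite -FG ?lexx.
move=> e e0; have [d d0 H] := FS e e0; exists d => // s t s0 st tT ts.
have sT : 0 <= s <= T by rewrite s0 (le_trans st).
have tT' : 0 <= t <= T by rewrite tT (le_trans s0).
by rewrite -!FG// -!gh// -ab//; exact: H.
Qed.

End PathCalculus.

(** * Iterated integrals and the shuffle product *)

Section Words.
Context {R : realType} (T : R) (n : nat) (X : R -> 'cV[R]_n) (K : R).
Hypothesis T0 : 0 <= T.
Hypothesis K0 : 0 <= K.
Hypothesis X_lip : forall i, lipschitz_on T K (fun t => X t i 0).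
Hypothesis X_prim : forall i a, unif_cont_on T a ->
  exists F, primitive T a (fun t => X t i 0) F.

Lemma primitive_RS_integral i a : unif_cont_on T a ->
  primitive T a (fun t => X t i 0) (RS_integral a (fun t => X t i 0) 0).
Proof.
move=> ua; have [F PF] := X_prim i ua.
apply: (eq_primitive T0 PF) => // t tT.
by rewrite (RS_integralE ua (X_lip i) K0 PF tT).
Qed.

Lemma RS_integral_lipschitz i a : unif_cont_on T a -> exists L : R,
  lipschitz_on T L (RS_integral a (fun t => X t i 0) 0).
Proof.
move=> ua; have [A A0 aA] := unif_cont_bounded ua; exists (A * K).
exact: primitive_lipschitz K0 (X_lip i) (primitive_RS_integral i ua) aA.
Qed.

Lemma iterated_integral_unif_cont (J : seq 'I_n) :
  unif_cont_on T (iterated_integral X J).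
Proof.
elim: J => [|j J IH] /=.
  by move=> e e0; exists 1 => // s t _ _ _; rewrite subrr normr0 ltW.
have [L] := RS_integral_lipschitz j IH; exact: lipschitz_on_unif_cont.
Qed.

Lemma primitive_iterated_integral j (J : seq 'I_n) :
  primitive T (iterated_integral X J) (fun t => X t j 0)
    (iterated_integral X (j :: J)).
Proof. exact: primitive_RS_integral (iterated_integral_unif_cont J). Qed.

(** A linear functional of the signature, as a list of weighted words.  Words
    are reversed with respect to [signature]: the head letter is integrated
    last, as in [iterated_integral]. *)
Definition word_comb (c : seq (R * seq 'I_n)) (t : R) : R :=
  \sum_(p <- c) p.1 * iterated_integral X p.2 t.

Definition prepend (j : 'I_n) (c : seq (R * seq 'I_n)) :=
  [seq (p.1, j :: p.2) | p <- c].

Lemma primitive_word_comb j c : primitive T (word_comb c) (fun t => X t j 0) (word_comb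
  (prepend j c)).
Proof.
rewrite /word_comb /prepend; elim: c => [|p c IH].
  have -> : (fun t : R => \sum_(p <- [::]) p.1 * iterated_integral X p.2 t) = (fun=> 0).
    by apply/funext => t; rewrite big_nil.
  split=> [|e e0]; first by [].
  exists 1 => // s t s0 st tT _; rewrite /= ?big_nil subrr mul0r subrr normr0.
  by rewrite mulr_ge0 ?subr_ge0// ltW.
apply: eq_primitive (primitiveDl (primitiveZl p.1 (primitive_iterated_integral j p.2))
  IH) _ _ _ => // t _;
 by rewrite /= ?big_cons.
Qed.

Lemma word_comb_unif_cont c : unif_cont_on T (word_comb c).
Proof.
rewrite /word_comb; elim: c => [|p c IH] e e0.
  by exists 1 => // s t _ _ _; rewrite !big_nil subrr normr0 ltW.
have P1 : 0 < `|p.1| + 1 by rewrite ltr_wpDl.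
have [|d1 d10 H1] := @iterated_integral_unif_cont p.2 (e / 2 / (`|p.1| + 1)).
  by rewrite !divr_gt0.
have [|d2 d20 H2] := IH (e / 2); first by rewrite divr_gt0.
exists (Num.min d1 d2) => [|s t sT tT]; first by rewrite lt_min d10.
rewrite lt_min => /andP[/H1 h1 /H2 h2]; rewrite !big_cons.
rewrite opprD addrACA -mulrBr; apply: le_trans (ler_normD _ _) _.
rewrite (splitr e) lerD ?h2// normrM.
apply: (@le_trans _ _ (`|p.1| * (e / 2 / (`|p.1| + 1)))); first by rewrite ler_wpM2l ?h1.
have e20 : 0 <= e / 2 by rewrite divr_ge0// ltW.
by rewrite mulrCA ler_piMr// ler_pdivrMr// mul1r lerDl.
Qed.
End Words.

Section Shuffle.
Context {R : realType} (n : nat).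

(** The shuffle product of two words.  The recursion decreases the first or the
    second word, so it runs on fuel; any [k] larger than the sum of the lengths
    is enough. *)
Fixpoint shuffle_fuel (k : nat) (I J : seq 'I_n) : seq (R * seq 'I_n) :=
  if k is k'.+1 then
    match I, J with
    | [::], _ => [:: (1, J)]
    | _, [::] => [:: (1, I)]
    | i :: I', j :: J' => prepend i (shuffle_fuel k' I' J) ++ prepend j (shuffle_fuel
      k' I J')
    end
  else [::].

(** Induction on the total length by integration by parts: differentiating the
    product removes the letter integrated last from one of the two words. *)
Lemma word_comb_shuffle (T : R) (X : R -> 'cV[R]_n) (K : R) : 0 <= T -> 0 <= K ->
  (forall i, lipschitz_on T K (fun t => X t i 0)) ->
  (forall i a, unif_cont_on T a -> exists F, primitive T a (fun t => X t i 0) F) ->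
  forall k I J, (size I + size J < k)%N -> forall t, 0 <= t <= T ->
  iterated_integral X I t * iterated_integral X J t = word_comb X (shuffle_fuel k I J) t.
Proof.
move=> T0 K0 Xl Xp; elim=> // k IH [|i I] J; first by move=> _ t _; rewrite
  /word_comb/= big_seq1/= !mul1r.
case: J => [|j J] kIJ t tT; first by rewrite /word_comb/= big_seq1/= mulr1 mul1r.
have -> : word_comb X (shuffle_fuel k.+1 (i :: I) (j :: J)) t =
  word_comb X (prepend i (shuffle_fuel k I (j :: J))) t +
  word_comb X (prepend j (shuffle_fuel k (i :: I) J)) t by rewrite /word_comb -big_cat.
have uI := iterated_integral_unif_cont T0 K0 Xl Xp I.
have uJ := iterated_integral_unif_cont T0 K0 Xl Xp J.
apply: (primitive_mul uI uJ (Xl i) (Xl j) K0 K0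
  (primitive_iterated_integral T0 K0 Xl Xp i I)
  (primitive_iterated_integral T0 K0 Xl Xp j J)) => //.
- apply: eq_primitive (primitive_word_comb T0 K0 Xl Xp i (shuffle_fuel k I (j :: J))) _
  _ _ => // u uT.
  by rewrite -IH//; move: kIJ; rewrite /= addnS ltnS => /ltnW.
- apply: eq_primitive (primitive_word_comb T0 K0 Xl Xp j (shuffle_fuel k (i :: I) J)) _
  _ _ => // u uT.
  by rewrite -IH//; move: kIJ; rewrite /= addnS ltnS.
Qed.

Definition word_comb_mul (c1 c2 : seq (R * seq 'I_n)) : seq (R * seq 'I_n) :=
  flatten [seq [seq (p.1 * q.1 * r.1, r.2) | r <- shuffle_fuel (size p.2 + size q.2).+1
    p.2 q.2]
    | p <- c1, q <- c2].

Lemma word_comb_mulE (T : R) (X : R -> 'cV[R]_n) (K : R) : 0 <= T -> 0 <= K ->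
  (forall i, lipschitz_on T K (fun t => X t i 0)) ->
  (forall i a, unif_cont_on T a -> exists F, primitive T a (fun t => X t i 0) F) ->
  forall c1 c2 t, 0 <= t <= T -> word_comb X (word_comb_mul c1 c2) t = word_comb X c1 t
    * word_comb X c2 t.
Proof.
move=> T0 K0 Xl Xp c1 c2 t tT; rewrite /word_comb /word_comb_mul big_flatten/=
  big_allpairs_dep/=.
rewrite mulr_suml; apply: eq_bigr => p _; rewrite mulr_sumr; apply: eq_bigr => q _.
rewrite mulrACA (word_comb_shuffle T0 K0 Xl Xp (ltnSn _) tT) /word_comb mulr_sumr big_map.
by apply: eq_bigr => r _; rewrite mulrA.
Qed.
End Shuffle.

(** * Elementary inequalities and real sequences *)

Section Elementary.
Context {R : realType}.

(** A convex function lies above its tangents; integrated over time this is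
    Jensen's inequality for the power functions. *)
Lemma expr_tangent (y c : R) r : 0 <= y -> 0 <= c ->
  c ^+ r.+1 + r.+1%:R * c ^+ r * (y - c) <= y ^+ r.+1.
Proof.
move=> y0 c0; elim: r => [|r IH]; first by rewrite !expr1 expr0 !mul1r addrC subrK.
rewrite [leRHS]exprS; apply: le_trans (ler_wpM2l y0 IH).
rewrite -subr_ge0.
have -> : y * (c ^+ r.+1 + r.+1%:R * c ^+ r * (y - c)) -
   (c ^+ r.+2 + r.+2%:R * c ^+ r.+1 * (y - c)) = r.+1%:R * c ^+ r * (y - c) ^+ 2.
  by rewrite -[r.+2%:R]natr1 !exprS; ring.
by apply: mulr_ge0; [apply: mulr_ge0 => //; exact: exprn_ge0|exact: sqr_ge0].
Qed.

Lemma min_clamp (t a b : R) : a <= b ->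
  Num.min t a <= Num.min t b /\ Num.min t b - Num.min t a <= b - a.
Proof.
by move=> ab; case: (leP t a) => ta; case: (leP t b) => tb; split; lra.
Qed.

Lemma normD_expr (x y : R) r : `|x + y| ^+ r <= 2 ^+ r * (`|x| ^+ r + `|y| ^+ r).
Proof.
have key (a b : R) : 0 <= a -> a <= b -> (a + b) ^+ r <= 2 ^+ r * (a ^+ r + b ^+ r).
  move=> a0 ab; apply: (@le_trans _ _ ((2 * b) ^+ r)).
    by rewrite lerXn2r ?nnegrE ?addr_ge0 ?mulr_ge0// ?(le_trans a0)//; lra.
  by rewrite exprMn ler_wpM2l ?exprn_ge0// lerDr exprn_ge0.
apply: (@le_trans _ _ ((`|x| + `|y|) ^+ r)).
  by rewrite lerXn2r ?nnegrE ?addr_ge0// ler_normD.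
have [xy|/ltW yx] := leP `|x| `|y|; first exact: key.
by rewrite addrC [X in _ * X]addrC; exact: key.
Qed.

(** This form of the arithmetic-geometric inequality makes products small in
    mean without Hölder's inequality: the free weight [d] absorbs the size of
    [u]. *)
Lemma young_expr (u h d : R) r : 0 < d ->
  `|u * h| ^+ r <= d * `|u| ^+ r.*2 + d^-1 * `|h| ^+ r.*2.
Proof.
move=> d0; rewrite normrM exprMn -!mul2n mulnC !exprM.
set a := `|u| ^+ r; set b := `|h| ^+ r.
have b0 : 0 <= b by exact: exprn_ge0.
have a0 : 0 <= a by exact: exprn_ge0.
have : 0 <= d^-1 * (d * a - b) ^+ 2 by rewrite mulr_ge0 ?sqr_ge0 ?invr_ge0 ?ltW.
have -> : d^-1 * (d * a - b) ^+ 2 = d * a ^+ 2 - 2 * (a * b) + d^-1 * b ^+ 2.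
  by field; rewrite lt0r_neq0.
have : 0 <= a * b by exact: mulr_ge0.
lra.
Qed.
End Elementary.

Section RealSequences.
Context {R : realType}.

(** The Taylor polynomials of the sine. *)
Definition sin_poly (x : R) (k : nat) : R :=
  \sum_(0 <= i < k) ((odd i)%:R * (-1) ^+ i.-1./2 / i`!%:R) * x ^+ i.

Lemma sin_poly_cvg (x : R) : sin_poly x k @[k --> \oo] --> sin x.
Proof.
have -> : sin_poly x = series (sin_coeff x).
  by apply/funext => k; apply: eq_bigr => i _; rewrite /sin_coeff /= mulrAC.
by rewrite unlock; exact: is_cvg_series_sin_coeff.
Qed.

Lemma sin_poly_le (x : R) k : `|sin_poly x k| <= expR `|x|.
Proof.
apply: (@le_trans _ _ (series (exp_coeff `|x|) k)).
  apply: le_trans (ler_norm_sum _ _ _) _; apply: ler_sum => i _.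
  rewrite /exp_coeff /= !normrM normrX normfV !normr_nat normrX normrN1 expr1n mulr1
    [leRHS]mulrC.
  rewrite ler_wpM2r ?exprn_ge0// ler_piMl ?invr_ge0//.
  by case: odd => /=.
apply: nondecreasing_cvgn_le; last exact: is_cvg_series_exp_coeff.
by apply: nondecreasing_series => i _ _; exact: exp_coeff_ge0.
Qed.

Lemma sin_scaled_cvg (x : R) : k.+1%:R * sin (x / k.+1%:R) @[k --> \oo] --> x.
Proof.
have [->|x0] := eqVneq x 0.
  under eq_fun do rewrite mul0r sin0 mulr0; exact: cvg_cst.
have ds := @is_derive_sin R 0.
have : (fun h => h^-1 *: ((sin \o shift 0) (h *: (1:R)) - sin 0)) @ (0 : R)^' --> (1 : R).
  have v : 'D_1 (@sin R) 0 = 1 by rewrite derive_val cos0.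
  by rewrite -[X in _ --> X]v; exact: (@ex_derive _ _ _ _ _ _ _ ds).
move=> /cvgrPdist_le H; apply/cvgrPdist_le => e e0.
have e' : 0 < e / `|x| by rewrite divr_gt0 ?normr_gt0.
have := H _ e'; rewrite near_withinE => /nbhs_ballP[d/= d0 Hd].
near=> k.
have kn : k.+1%:R != 0 :> R by rewrite pnatr_eq0.
have xk0 : x / k.+1%:R != 0 by rewrite mulf_neq0 ?invr_neq0.
have xkd : `|x / k.+1%:R| < d.
  rewrite normrM normfV normr_nat ltr_pdivrMr// mulrC -ltr_pdivrMr//.
  near: k; exists (Num.truncn (`|x| / d)) => // j /= jk.
  by apply: lt_le_trans (truncnS_gt _) _; rewrite ler_nat ltnS.
have := Hd (x / k.+1%:R); rewrite /ball/= sub0r normrN => /(_ xkd xk0).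
rewrite sin0 subr0 /shift/= addr0 /GRing.scale/= mulr1 => Hk.
have -> : x - k.+1%:R * sin (x / k.+1%:R) = x * (1 - (x / k.+1%:R)^-1 * sin (x /
  k.+1%:R)).
  by rewrite mulrBr mulr1 invf_div mulrA mulrCA divff// mulr1.
by rewrite normrM -ler_pdivlMl ?normr_gt0// [_^-1 * e]mulrC.
Unshelve. all: by end_near. Qed.

Lemma norm_sin_le (x : R) : `|sin x| <= `|x|.
Proof.
have key (y : R) : 0 <= y -> `|sin y| <= y.
  move=> y0; have [|c _] := @MVT_segment R sin cos 0 y y0 (fun z _ => is_derive_sin z).
    by apply: continuous_subspaceT; exact: continuous_sin.
  by rewrite sin0 !subr0 => ->; rewrite normrM [`|y|]ger0_norm// ler_piMl// ler_norml
    cos_geN1 cos_le1.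
have [x0|/ltW x0] := leP 0 x; first by rewrite [`|x|]ger0_norm// key.
by rewrite [`|x|]ler0_norm// -normrN -sinN key// oppr_ge0.
Qed.

(** The iteration p := p + (u^2 - p^2) / 2, which generates polynomials in [u]
    that increase to |u| on [-1, 1]. *)
Fixpoint norm_iter (u : R) (k : nat) : R :=
  if k is k'.+1 then norm_iter u k' + (u ^+ 2 - norm_iter u k' ^+ 2) / 2 else 0.

(** One step multiplies the error |u| - p by 1 - (|u| + p) / 2. *)
Lemma norm_iter_bounds (u : R) k : `|u| <= 1 ->
  0 <= norm_iter u k <= `|u| /\ `|u| - norm_iter u k <= (1 - `|u| / 2) ^+ k.
Proof.
move=> u1; elim: k => [|k [/andP[p0 pu] pk]] /=.
  by rewrite lexx normr_ge0 subr0 expr0.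
rewrite -[u ^+ 2]real_normK ?num_real//.
have u0 := normr_ge0 u; set v := `|u| in u0 u1 pu pk *; set p := norm_iter u k in p0 pu
  pk *.
have E : v - (p + (v ^+ 2 - p ^+ 2) / 2) = (v - p) * (1 - (v + p) / 2) by field.
have vp : 0 <= v - p by lra.
split; last first.
  rewrite E exprS mulrC; apply: ler_pM => //; lra.
apply/andP; split.
  by rewrite addr_ge0// divr_ge0// subr_ge0 ler_sqr ?nnegrE//; lra.
by rewrite -subr_ge0 E mulr_ge0//; lra.
Qed.

Lemma norm_iter_cvg (u : R) : `|u| <= 1 -> norm_iter u k @[k --> \oo] --> `|u|.
Proof.
move=> u1; have [->|u0] := eqVneq u 0.
  have -> : norm_iter 0 = fun=> 0.
    by apply/funext; elim => //= k ->; rewrite expr0n/= !subrr mul0r addr0.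
  by rewrite normr0; exact: cvg_cst.
have un : 0 < `|u| by rewrite normr_gt0.
have g : (1 - `|u| / 2) ^+ k @[k --> \oo] --> 0.
  apply: cvg_expr; rewrite ger0_norm; lra.
apply/cvgrPdist_le => e e0.
move/cvgrPdist_le : g => /(_ e e0); apply: filterS => k.
have [/andP[_ pu] pk] := norm_iter_bounds k u1.
rewrite sub0r normrN ger0_norm; last by rewrite exprn_ge0//; lra.
move=> ke; rewrite ger0_norm ?subr_ge0//; exact: le_trans pk ke.
Qed.
End RealSequences.

(** * Power bounds and Riemann sums for primitives *)

Section PrimitivePower.
Context {R : realType} (T : R).
Hypothesis T0 : 0 < T.
Let T0' := ltW T0.

Lemma unif_cont_comp (h : R -> R) (phi : R -> R) : continuous phi ->
  unif_cont_on T h -> {within `[0, T], continuous (fun u => phi (h u))}.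
Proof.
move=> cphi uh x; apply: continuous_comp; last exact: cphi.
exact: unif_cont_continuous uh x.
Qed.

Lemma continuous_integrable_itv (h : R -> R) t : 0 <= t <= T ->
  {within `[0, T], continuous h} ->
  lebesgue_measure.-integrable `[0, t] (EFin \o h).
Proof.
move=> /andP[_ tT] ch.
have ih : lebesgue_measure.-integrable `[0, T] (EFin \o h).
  by apply: continuous_compact_integrable => //; exact: segment_compact.
by apply: integrableS ih => //; apply: subset_itvl; rewrite bnd_simp.
Qed.

(** |F| - K * H is nonincreasing, where [H] is the running time integral of
    |h|. *)
Lemma primitive_L1 h g F (K : R) : 0 <= K -> unif_cont_on T h ->
  lipschitz_on T K g -> primitive T h g F -> forall t, 0 <= t <= T ->
  `|F t| <= K * \int[lebesgue_measure]_(u in `[0, T]) `|h u|.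
Proof.
move=> K0 uh gl [F0 FS] t /andP[t0 tT].
have cn : {within `[0, T], continuous (fun u => `|h u|)}.
  by apply: (@unif_cont_comp h (fun y => `|y|)) => // x; exact: norm_continuous.
have [H0 HS] := primitive_time cn.
set H := (fun t => \int[lebesgue_measure]_(s in `[0, t]) `|h s|) in H0 HS.
have HT : H t <= H T.
  rewrite -subr_ge0 /H Rintegral_itvB ?bnd_simp//.
    by apply: Rintegral_ge0 => u _; exact: normr_ge0.
  by apply: continuous_integrable_itv => //; rewrite T0' lexx.
apply: le_trans (ler_wpM2l K0 HT).
have : (fun u => `|F u| - K * H u) t <= (fun u => `|F u| - K * H u) 0.
  apply: (@locally_small_nonincreasing _ T (fun u => `|F u| - K * H u)) => //.
  have HS' := locally_smallZ K0 HS.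
  apply: locally_small_le (locally_smallD FS HS') _ => s u s0 su uT.
  have : `|F u| - `|F s| <= `|F u - F s| by exact: lerB_dist.
  have : `|F u - F s| <= `|F u - F s - h s * (g u - g s)| + `|h s| * `|g u - g s|.
    by rewrite -normrM -[X in `|X| <= _](subrK (h s * (g u - g s))) ler_normD.
  have := ler_wpM2l (normr_ge0 (h s)) (gl s u s0 su uT).
  have : - (H u - H s - `|h s| * (u - s)) <= `|H u - H s - `|h s| * (u - s)|.
    by rewrite -[X in _ <= X]normrN ler_norm.
  move=> /(ler_wpM2l K0).
  lra.
have H00 : H 0 = 0 by exact: H0.
by rewrite F0 H00 normr0 mulr0 subrr subr_le0.
Qed.

(** Jensen's inequality: the tangent of the power function at the time average
    [c] of |h| has mean c ^ (r + 1). *)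
Lemma primitive_power h g F (K : R) r : 0 <= K -> unif_cont_on T h ->
  lipschitz_on T K g -> primitive T h g F -> forall t, 0 <= t <= T ->
  `|F t| ^+ r.+1 * T <= (T * K) ^+ r.+1 * \int[lebesgue_measure]_(u in `[0, T]) (`|h u|
    ^+ r.+1).
Proof.
move=> K0 uh gl PF t tT.
have FK := primitive_L1 K0 uh gl PF tT.
set H := \int[lebesgue_measure]_(u in `[0, T]) `|h u| in FK.
have H0 : 0 <= H by apply: Rintegral_ge0 => u _; exact: normr_ge0.
pose c := H / T.
have c0 : 0 <= c by rewrite divr_ge0.
have HE : H = c * T by rewrite /c divfK// lt0r_neq0.
have T0T : 0 <= T <= T by rewrite T0' lexx.
have intc (phi : R -> R) : continuous phi ->
    lebesgue_measure.-integrable `[0, T] (EFin \o (fun u => phi (h u))).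
  by move=> cphi; apply: continuous_integrable_itv => //; exact: unif_cont_comp.
have cn : continuous (fun y : R => `|y|) by move=> y; exact: norm_continuous.
have J : c ^+ r.+1 * T <= \int[lebesgue_measure]_(u in `[0, T]) (`|h u| ^+ r.+1).
  apply: (@le_trans _ _ (\int[lebesgue_measure]_(u in `[0, T])
     (r.+1%:R * c ^+ r * `|h u| + (c ^+ r.+1 - r.+1%:R * c ^+ r * c)))).
    rewrite RintegralD//=; last 2 first.
    - by apply: (intc (fun y => r.+1%:R * c ^+ r * `|y|)) => y; apply: cvgMr; exact: cn.
    - by apply: (intc (fun=> _)) => y; exact: cst_continuous.
    rewrite RintegralZl//=; last exact: (intc (fun y => `|y|)).
    rewrite Rintegral_cst//= lebesgue_measure_itv/= lte_fin T0 /= -/H HE oppr0 addr0.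
    by rewrite le_eqVlt; apply/orP; left; apply/eqP; ring.
  apply: le_Rintegral => //=.
  - apply: (intc (fun y => r.+1%:R * c ^+ r * `|y| + (c ^+ r.+1 - r.+1%:R * c ^+ r *
    c))) => y.
    by apply: cvgD; [apply: cvgMr; exact: cn|exact: cvg_cst].
  - apply: (intc (fun y => `|y| ^+ r.+1)) => y.
    by apply: (@continuous_comp _ _ _ (fun y : R => `|y|) (fun y => y ^+ r.+1));
      [exact: cn|exact: exprn_continuous].
  - move=> u _; apply: le_trans (expr_tangent r (normr_ge0 (h u)) c0).
    by rewrite le_eqVlt; apply/orP; left; apply/eqP; ring.
apply: le_trans (ler_wpM2l _ J); last by rewrite exprn_ge0 ?mulr_ge0.
have FK' : `|F t| <= T * K * c.
  by apply: le_trans FK _; rewrite HE le_eqVlt; apply/orP; left; apply/eqP; ring.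
by rewrite mulrA -exprMn ler_wpM2r// lerXn2r ?nnegrE// ?(le_trans _ FK').
Qed.

(** Left point sums over grids of [0, T] that are stopped at [t].  Each sum is
    jointly measurable in the outcome and in [t] when the paths are, which is
    why the approximation uses a fixed grid instead of partitions of [0, t]. *)
Lemma primitive_left_sums a g F : primitive T a g F -> forall t, 0 <= t <= T ->
  \sum_(i < k.+1) a (Num.min t (T * (i%:R / k.+1%:R))) *
    (g (Num.min t (T * (i.+1%:R / k.+1%:R))) - g (Num.min t (T * (i%:R / k.+1%:R))))
  @[k --> \oo] --> F t.
Proof.
move=> [F0 FS] t /andP[t0 tT].
apply/cvgrPdist_le => e e0.
have e' : 0 < e / (T + 1) by rewrite divr_gt0// addr_gt0.
have [d d0 H] := FS _ e'.
near=> k.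
have kd : T / k.+1%:R < d.
  rewrite ltr_pdivrMr// mulrC -ltr_pdivrMr//.
  near: k; exists (Num.truncn (T / d)) => // j /= jk.
  by apply: lt_le_trans (truncnS_gt _) _; rewrite ler_nat ltnS.
pose y i := Num.min t (T * (i%:R / k.+1%:R)).
have y0 : y 0%N = 0 by rewrite /y mul0r mulr0 min_r.
have yk : y k.+1 = t by rewrite /y divff// mulr1 min_l.
have yge i : 0 <= y i by rewrite /y le_min t0 mulr_ge0 ?divr_ge0.
have yle i : y i <= T by rewrite /y ge_min tT.
have xS i : T * (i.+1%:R / k.+1%:R) - T * (i%:R / k.+1%:R) = T / k.+1%:R.
  by rewrite -mulrBr -mulrBl -[i.+1]addn1 natrD addrAC subrr add0r mul1r.
have yS i : y i <= y i.+1.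
  have := xS i; have : 0 <= T / k.+1%:R by rewrite divr_ge0.
  by rewrite /y => h1 h2; apply: (min_clamp t _).1; rewrite -subr_ge0 h2.
have yd i : y i.+1 - y i < d.
  apply: le_lt_trans kd; rewrite -(xS i); apply: (min_clamp t _).2.
  by rewrite -subr_ge0 xS divr_ge0.
have -> : F t = \sum_(i < k.+1) (F (y i.+1) - F (y i)).
  by rewrite -(big_mkord xpredT (fun i => F (y i.+1) - F (y i))) telescope_sumr// yk y0
    F0 subr0.
rewrite -sumrB; apply: le_trans (ler_norm_sum _ _ _) _.
apply: (@le_trans _ _ (\sum_(i < k.+1) e / (T + 1) * (y i.+1 - y i))).
  by apply: ler_sum => i _; exact: H.
rewrite -mulr_sumr -(big_mkord xpredT (fun i => y i.+1 - y i)) telescope_sumr// yk y0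
  subr0.
by rewrite mulrAC ler_pdivrMr ?addr_gt0// ler_wpM2l ?ltW//; lra.
Unshelve. all: by end_near. Qed.
End PrimitivePower.

(** * Means over the product of a probability space and a time interval *)

(** [K] plays the role of the random speed of the driving path. *)
Record exp_moments (R : realType) (disp : measure_display)
  (Omega : measurableType disp) (P : probability Omega R) (K : Omega -> R) : Prop := {
  exp_moments_measurable : measurable_fun [set: Omega] K;
  exp_moments_ge1 : forall w, 1 <= K w;
  exp_moments_finite : forall c : R, (\int[P]_w (expR (c * K w))%:E < +oo)%E }.

Section TimeProduct.
Context {R : realType} {disp : measure_display} {Omega : measurableType disp}.
Variables (P : probability Omega R) (T : R).
Hypothesis T0 : 0 < T.

Definition strip : set (Omega * R) := [set: Omega] `*` `[0, T].

Local Notation nu := (P \x @lebesgue_measure R)%E.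

Lemma stripP w t : strip (w, t) <-> 0 <= t <= T.
Proof. by rewrite /strip/= in_itv/=; split => [[]|]. Qed.

Lemma measurable_strip : measurable strip.
Proof. by apply: measurableX. Qed.

(** Tonelli's theorem on the strip. *)
Lemma integral_strip (f : Omega * R -> \bar R) :
  measurable_fun strip f -> (forall z, strip z -> (0 <= f z)%E) ->
  (\int[nu]_(z in strip) f z =
   \int[P]_w \int[lebesgue_measure]_(t in `[0%R, T]) f (w, t))%E.
Proof.
move=> mf f0; rewrite integral_mkcond fubini_tonelli1/=; last 2 first.
- by apply/(measurable_restrictT _ measurable_strip).
- by move=> z; rewrite patchE; case: ifPn => //; rewrite inE; exact: f0.
apply: eq_integral => w _; rewrite /fubini_F [RHS]integral_mkcond.
apply: eq_integral => t _; rewrite !patchE; congr (if _ then _ else _).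
by apply/idP/idP; rewrite !inE /strip/=; tauto.
Qed.

Lemma measurable_inner_integral (f : Omega * R -> \bar R) :
  measurable_fun strip f -> (forall z, strip z -> (0 <= f z)%E) ->
  measurable_fun [set: Omega]
   (fun w => \int[lebesgue_measure]_(t in `[0%R, T]) f (w, t))%E.
Proof.
move=> mf f0.
have -> : (fun w => \int[lebesgue_measure]_(t in `[0%R, T]) f (w, t))%E =
  fubini_F lebesgue_measure (f \_ strip).
  apply/funext => w; rewrite /fubini_F [LHS]integral_mkcond.
  apply: eq_integral => t _; rewrite !patchE; congr (if _ then _ else _).
  by apply/idP/idP; rewrite !inE /strip/=; tauto.
apply: measurable_fun_fubini_tonelli_F.
- by apply/(measurable_restrictT _ measurable_strip).
- by move=> z; rewrite patchE; case: ifPn => //; rewrite inE; exact: f0.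
Qed.

Lemma measurable_fst_strip (g : Omega -> R) : measurable_fun [set: Omega] g ->
  measurable_fun strip (fun z => g z.1).
Proof.
move=> mg; apply: measurable_funTS; exact: measurableT_comp mg measurable_fst.
Qed.

Lemma integral_strip_fst (g : Omega -> R) : measurable_fun [set: Omega] g ->
  (forall w, 0 <= g w) ->
  (\int[nu]_(z in strip) (g z.1)%:E = T%:E * \int[P]_w (g w)%:E)%E.
Proof.
move=> mg g0; rewrite integral_strip//=; last 2 first.
- by apply/measurable_EFinP; exact: measurable_fst_strip.
- by move=> z _; rewrite lee_fin.
rewrite -ge0_integralZl//=; last 3 first.
- exact/measurable_EFinP.
- by move=> w _; rewrite lee_fin.
- by rewrite lee_fin ltW.
apply: eq_integral => w _; rewrite integral_cst//= lebesgue_measure_itv/= lte_fin T0.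
by rewrite oppr0 addr0 muleC.
Qed.

Variable K : Omega -> R.
Hypothesis HK : exp_moments P K.
Local Notation mK := (exp_moments_measurable HK).
Local Notation K1 := (exp_moments_ge1 HK).
Local Notation expK := (exp_moments_finite HK).

(** One constant serves as factor and as exponential rate, so that the bounds
    are ordered by [C] and stable under sums and products. *)
Definition dominated (C : R) (f : Omega * R -> R) :=
  forall w t, 0 <= t <= T -> `|f (w, t)| <= C * expR (C * K w).

(** The means of all powers of such a process are finite, thanks to the
    exponential moments of [K]. *)
Definition tame (f : Omega * R -> R) : Prop :=
  measurable_fun strip f /\ exists C, dominated C f.

Lemma dominated_le C C' f : C <= C' -> dominated C f -> dominated C' f.
Proof.
move=> CC df w t tT; have Cf := df w t tT; apply: (le_trans Cf).
have C0 : 0 <= C by rewrite -(pmulr_lge0 C (expR_gt0 (C * K w))) (le_trans _ Cf).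
apply: ler_pM => //.
by rewrite ler_expR ler_wpM2r// (le_trans _ (K1 w)).
Qed.

Lemma dominatedM C C' f g : 0 <= C -> 0 <= C' -> dominated C f -> dominated C' g ->
  dominated (C + C' + C * C') (fun z => f z * g z).
Proof.
move=> C0 C'0 df dg w t tT.
rewrite normrM; apply: le_trans (ler_pM _ _ (df w t tT) (dg w t tT)) _ => //.
rewrite mulrACA -expRD -mulrDl; apply: ler_pM; rewrite ?mulr_ge0 ?expR_ge0//.
  by rewrite lerDr addr_ge0.
rewrite ler_expR ler_wpM2r// ?(le_trans _ (K1 w))// lerDl mulr_ge0//.
Qed.

Lemma dominatedD C C' f g : 0 <= C -> 0 <= C' -> dominated C f -> dominated C' g ->
  dominated (C + C') (fun z => f z + g z).
Proof.
move=> C0 C'0 df dg w t tT.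
rewrite mulrDl; apply: le_trans (ler_normD _ _) _; apply: lerD.
  apply: le_trans (df w t tT) _; rewrite ler_wpM2l// ler_expR ler_wpM2r ?(le_trans _
    (K1 w))//.
  by rewrite lerDl.
apply: le_trans (dg w t tT) _; rewrite ler_wpM2l// ler_expR ler_wpM2r ?(le_trans _ (K1
  w))//.
by rewrite lerDr.
Qed.

Lemma dominated_ex C f : dominated C f -> exists2 C', 0 <= C' & dominated C' f.
Proof. by move=> df; exists `|C| => //; apply: dominated_le df; exact: ler_norm. Qed.

Lemma tameM f g : tame f -> tame g -> tame (fun z => f z * g z).
Proof.
move=> [mf [C /dominated_ex[{}C C0 df]]] [mg [C' /dominated_ex[{}C' C'0 dg]]].
split; first exact: measurable_funM.
by exists (C + C' + C * C'); exact: dominatedM.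
Qed.

Lemma tameD f g : tame f -> tame g -> tame (fun z => f z + g z).
Proof.
move=> [mf [C /dominated_ex[{}C C0 df]]] [mg [C' /dominated_ex[{}C' C'0 dg]]].
split; first exact: measurable_funD.
by exists (C + C'); exact: dominatedD.
Qed.

Lemma tame_cst (c : R) : tame (fun=> c).
Proof.
split; first exact: measurable_cst.
exists `|c| => w t tT; rewrite ler_peMr// -expR0 ler_expR mulr_ge0//.
exact: le_trans (K1 w).
Qed.

Lemma tameZ c f : tame f -> tame (fun z => c * f z).
Proof. by move=> ?; apply: tameM => //; exact: tame_cst. Qed.

Lemma tameB f g : tame f -> tame g -> tame (fun z => f z - g z).
Proof.
move=> tf /(tameZ (-1)) tg; have := tameD tf tg; congr tame.
by apply/funext => z; rewrite mulN1r.
Qed.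

Lemma tame_norm f : tame f -> tame (fun z => `|f z|).
Proof.
move=> [mf [C df]]; split; first exact: measurableT_comp.
by exists C => w t tT; rewrite normr_id; exact: df.
Qed.

Lemma tameX f r : tame f -> tame (fun z => f z ^+ r).
Proof.
move=> tf; elim: r => [|r IH]; first exact: tame_cst.
by under eq_fun do rewrite exprS; exact: tameM.
Qed.

Lemma tame_fst : tame (fun z => K z.1).
Proof.
split; first exact: (measurable_fst_strip mK).
exists 1 => w t _; rewrite /= !mul1r ger0_norm ?(le_trans _ (K1 w))//.
by apply: le_trans (expR_ge1Dx _); rewrite lerDr.
Qed.

Lemma measurable_expR_bound C :
  measurable_fun [set: Omega] (fun w => expR (C * K w)).
Proof.
by apply: measurableT_comp => //; apply: measurable_funM => //; exact: mK.
Qed.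

Lemma integrable_dominating C : 0 <= C ->
  nu.-integrable strip (fun z => (C * expR (C * K z.1))%:E).
Proof.
move=> C0; apply/integrableP; split.
  apply/measurable_EFinP; apply: (@measurable_fst_strip (fun w => C * expR (C * K w))).
  by apply: measurable_funM => //; exact: measurable_expR_bound.
under eq_integral => z _ do rewrite gee0_abs ?lee_fin ?mulr_ge0 ?expR_ge0//.
rewrite (@integral_strip_fst (fun w => C * expR (C * K w))); last 2 first.
- by apply: measurable_funM => //; exact: measurable_expR_bound.
- by move=> w; rewrite mulr_ge0 ?expR_ge0.
under eq_integral do rewrite EFinM.
rewrite ge0_integralZl//; last first.
  by apply/measurable_EFinP; exact: measurable_expR_bound.
apply: lte_mul_pinfty => //; first by rewrite lee_fin ltW.
by apply: lte_mul_pinfty => //; exact: expK.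
Qed.

Lemma tame_integrable f : tame f -> nu.-integrable strip (EFin \o f).
Proof.
move=> [mf [C /dominated_ex[{}C C0 df]]].
apply: le_integrable (integrable_dominating C0) => //.
- exact: measurable_strip.
- exact/measurable_EFinP.
- move=> [w t] /stripP tT /=; rewrite lee_fin [leRHS]ger0_norm ?mulr_ge0 ?expR_ge0//.
  exact: df.
Qed.

Definition mean (f : Omega * R -> R) : R := \int[nu]_(z in strip) f z.

Lemma meanE f : tame f -> (mean f)%:E = (\int[nu]_(z in strip) (f z)%:E)%E.
Proof.
move=> tf; rewrite /mean /Rintegral fineK//.
by apply: integrable_fin_num (tame_integrable tf); exact: measurable_strip.
Qed.

Lemma meanD f g : tame f -> tame g -> mean (fun z => f z + g z) = mean f + mean g.
Proof. by move=> tf tg; rewrite /mean RintegralD//; [exact: measurable_strip|exact: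
  tame_integrable..]. Qed.

Lemma meanZ c f : tame f -> mean (fun z => c * f z) = c * mean f.
Proof. by move=> tf; rewrite /mean RintegralZl//; [exact: measurable_strip|exact:
  tame_integrable..]. Qed.

Lemma mean0 : mean (fun=> 0) = 0.
Proof. by rewrite /mean /Rintegral integral0_eq. Qed.

Lemma le_mean f g : tame f -> tame g ->
  (forall w t, 0 <= t <= T -> f (w, t) <= g (w, t)) -> mean f <= mean g.
Proof.
move=> tf tg fg; apply: le_Rintegral; rewrite ?tame_integrable//; [exact:
  measurable_strip|exact: tame_integrable..|].
by move=> [w t] /stripP; exact: fg.
Qed.

Lemma dominated_lim (f_ : nat -> Omega * R -> R) f C :
  (forall k, dominated C (f_ k)) ->
  (forall w t, 0 <= t <= T -> f_ k (w, t) @[k --> \oo] --> f (w, t)) ->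
  dominated C f.
Proof.
move=> df_ cf w t tT.
have /cvg_norm cn := cf w t tT.
rewrite -(cvg_lim _ cn)//; apply: limr_le; first exact: cvgP cn.
by apply: nearW => k; exact: df_.
Qed.

Lemma tame_lim (f_ : nat -> Omega * R -> R) f C : (forall k, tame (f_ k)) ->
  (forall k, dominated C (f_ k)) ->
  (forall w t, 0 <= t <= T -> f_ k (w, t) @[k --> \oo] --> f (w, t)) ->
  tame f.
Proof.
move=> tf_ df_ cf; split; last by exists C; exact: dominated_lim cf.
apply: (@measurable_fun_cvg _ _ _ strip f_) => [k|[w t] /stripP]; last exact: cf.
by case: (tf_ k).
Qed.

(** Dominated convergence; exponential moments of [K] make the common bound
    integrable. *)
Lemma mean_cvg (f_ : nat -> Omega * R -> R) f C : (forall k, tame (f_ k)) ->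
  (forall k, dominated C (f_ k)) ->
  (forall w t, 0 <= t <= T -> f_ k (w, t) @[k --> \oo] --> f (w, t)) ->
  mean (f_ k) @[k --> \oo] --> mean f.
Proof.
move=> tf_ df_ cf; have tf := tame_lim tf_ df_ cf.
have {}df_ k : dominated `|C| (f_ k) by apply: dominated_le (df_ k); exact: ler_norm.
apply: fine_cvg; rewrite -[X in _ --> X]/((mean f)%:E) meanE//.
apply: (@dominated_cvg _ _ _ nu strip measurable_strip (fun k z => (f_ k z)%:E)
  (fun z => (f z)%:E) (fun z => (`|C| * expR (`|C| * K z.1))%:E)) => //.
- by move=> k; apply/measurable_EFinP; case: (tf_ k).
- by move=> [w t] /stripP tT; apply: cvg_EFin; [exact: nearW|exact: cf].
- exact: integrable_dominating.
- by move=> k [w t] /stripP tT; rewrite lee_fin; exact: df_.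
Qed.

End TimeProduct.

(** * Processes approximable by the signature *)

(** What the approximation argument uses of the time-extended path; the
    coordinate [i0] is time. *)
Record lipschitz_driver (R : realType) (disp : measure_display)
  (Omega : measurableType disp) (P : probability Omega R) (T : R) (n : nat)
  (X : Omega -> R -> 'cV[R]_n) (K : Omega -> R) (i0 : 'I_n) : Prop := {
  driver_moments : exp_moments P K;
  driver_lipschitz : forall w i, lipschitz_on T (K w) (fun t => X w t i 0);
  driver_primitive : forall w i a, unif_cont_on T a ->
    exists F, primitive T a (fun t => X w t i 0) F;
  driver_measurable : forall i,
    measurable_fun (@strip R _ Omega T) (fun z : Omega * R => X z.1 z.2 i 0);
  driver_time : forall w t, 0 <= t <= T -> X w t i0 0 = t }.

Section SignatureClosure.
Context {R : realType} {disp : measure_display} {Omega : measurableType disp}.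
Variables (P : probability Omega R) (T : R).
Hypothesis T0 : 0 < T.
Variables (n : nat) (X : Omega -> R -> 'cV[R]_n) (K : Omega -> R) (i0 : 'I_n).
Hypothesis HX : lipschitz_driver P T X K i0.
Let T0' := ltW T0.
Local Notation HK := (driver_moments HX).
Local Notation strip := (@strip R _ Omega T).
Local Notation tame := (tame T K).
Local Notation dominated := (dominated T K).
Local Notation mean := (mean P T).
Local Notation K1 := (exp_moments_ge1 HK).
Implicit Types (f g h : Omega * R -> R).

Lemma driver_bound_ge0 w : 0 <= K w. Proof. exact: le_trans (K1 w). Qed.

(** The process of running integrals of [f] against coordinate [j] of the
    driving path. *)
Definition integral_along j f (z : Omega * R) : R :=
  RS_integral (fun u => f (z.1, u)) (fun u => X z.1 u j 0) 0 z.2.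

Definition sig_comb (c : seq (R * seq 'I_n)) (z : Omega * R) : R :=
  word_comb (X z.1) c z.2.

Lemma tame_le f g : measurable_fun strip f -> tame g ->
  (forall w t, 0 <= t <= T -> `|f (w, t)| <= g (w, t)) -> tame f.
Proof.
move=> mf [_ [C dg]] fg; split => //; exists C => w t tT.
by apply: le_trans (fg w t tT) _; apply: le_trans (dg w t tT); exact: ler_norm.
Qed.

Lemma eq_tame f g : tame f -> (forall w t, 0 <= t <= T -> f (w, t) = g (w, t)) ->
  tame g.
Proof.
move=> [mf [C df]] fg; split; last by exists C => w t tT; rewrite -fg//; exact: df.
apply: eq_measurable_fun mf => -[w t]; rewrite inE => /stripP; exact: fg.
Qed.

Lemma eq_mean f g : (forall w t, 0 <= t <= T -> f (w, t) = g (w, t)) ->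
  mean f = mean g.
Proof.
by move=> fg; apply: eq_Rintegral => -[w t]; rewrite inE => /stripP; exact: fg.
Qed.

Lemma mean_ge0 f : (forall w t, 0 <= t <= T -> 0 <= f (w, t)) -> 0 <= mean f.
Proof. by move=> f0; apply: Rintegral_ge0 => -[w t] /stripP; exact: f0. Qed.

Lemma integral_along_primitive w j f : unif_cont_on T (fun t => f (w, t)) ->
  primitive T (fun t => f (w, t)) (fun t => X w t j 0) (fun t => integral_along j f (w,
    t)).
Proof.
move=> uf; exact: (primitive_RS_integral T0' (driver_bound_ge0 w) (driver_lipschitz HX w)
  (driver_primitive HX w) j uf).
Qed.

Lemma measurable_slice f c : 0 <= c <= T -> measurable_fun strip f ->
  measurable_fun strip (fun z : Omega * R => f (z.1, Num.min z.2 c)).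
Proof.
move=> /andP[c0 cT] mf.
apply: (@measurable_comp _ _ _ _ _ _ strip f strip (fun z : Omega * R => (z.1, Num.min
  z.2 c))) => //.
- exact: measurable_strip.
- move=> _ [[w t] /stripP/andP[t0 tT] <-]; apply/stripP.
  by rewrite /= le_min t0 c0 ge_min tT.
- apply: measurable_funTS; apply: measurable_fun_pair => //=.
  by apply: measurable_minr => //; exact: measurable_snd.
Qed.

(** The integral is a pointwise limit of left point sums, which are jointly
    measurable. *)
Lemma measurable_integral_along j f : measurable_fun strip f ->
  (forall w, unif_cont_on T (fun t => f (w, t))) -> measurable_fun strip
    (integral_along j f).
Proof.
move=> mf uf.
pose x k i : R := T * (i%:R / k.+1%:R).
have xT k i : (i <= k.+1)%N -> 0 <= x k i <= T.
  move=> ik; rewrite mulr_ge0 ?divr_ge0//= ler_piMr//.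
  by rewrite ler_pdivrMr// mul1r ler_nat.
apply: (@measurable_fun_cvg _ _ _ strip (fun k z =>
  \sum_(i < k.+1) f (z.1, Num.min z.2 (x k i)) *
    (X z.1 (Num.min z.2 (x k i.+1)) j 0 - X z.1 (Num.min z.2 (x k i)) j 0))).
- move=> k; apply: measurable_sum => i; apply: measurable_funM.
    by apply: measurable_slice => //; apply: xT; exact: ltnW.
  apply: measurable_funB.
    by apply: (@measurable_slice (fun z => X z.1 z.2 j 0)); [exact: xT|exact:
      driver_measurable HX j].
  by apply: (@measurable_slice (fun z => X z.1 z.2 j 0)); [exact/xT/ltnW|exact:
    driver_measurable HX j].
- move=> [w t] /stripP tT /=.
  exact: (primitive_left_sums T0 (integral_along_primitive j (uf w)) tT).
Qed.

Lemma tame_dominating C : 0 <= C -> tame (fun z => C * expR (C * K z.1)).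
Proof.
move=> C0; split; last first.
  by exists C => w t _; rewrite ger0_norm// mulr_ge0 ?expR_ge0.
apply: (@measurable_fst_strip _ _ _ T (fun w => C * expR (C * K w))).
by apply: measurable_funM => //; exact: measurable_expR_bound HK _.
Qed.

Lemma tame_integral_along j f : tame f -> (forall w, unif_cont_on T (fun t => f (w,
  t))) ->
  tame (integral_along j f).
Proof.
move=> [mf [C0' dC0]] uf; have [C C0 df] := dominated_ex HK dC0.
apply: (@tame_le _ (fun z => (C * expR (C * K z.1)) * (T * K z.1))).
- exact: measurable_integral_along.
- apply: (tameM HK); first exact: tame_dominating.
  by apply: (tameZ HK); exact: tame_fst HK.
- move=> w t /andP[t0 tT] /=.
  have := primitive_lipschitz (driver_bound_ge0 w) (driver_lipschitz HX w j)
    (integral_along_primitive j (uf w)) (df w).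
  move=> /(_ 0 t (lexx _) t0 tT).
  have [-> _] := integral_along_primitive j (uf w); rewrite !subr0 => /le_trans; apply.
  rewrite -mulrA; apply: ler_wpM2l; first by rewrite mulr_ge0 ?expR_ge0.
  by rewrite mulrC ler_wpM2r ?driver_bound_ge0.
Qed.

Lemma driver_iterated_integral_unif_cont w J : unif_cont_on T (iterated_integral (X w) J).
Proof.
exact: (iterated_integral_unif_cont T0' (driver_bound_ge0 w) (driver_lipschitz HX w)
  (driver_primitive HX w)).
Qed.

Lemma sig_comb_unif_cont c w : unif_cont_on T (fun t => sig_comb c (w, t)).
Proof.
exact: (word_comb_unif_cont T0' (driver_bound_ge0 w) (driver_lipschitz HX w)
  (driver_primitive HX w)).
Qed.

Lemma tame_iterated_integral J : tame (fun z => iterated_integral (X z.1) J z.2).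
Proof.
elim: J => [|j J IH]; first exact: (tame_cst T HK 1).
apply: (@tame_integral_along j (fun z => iterated_integral (X z.1) J z.2)) => // w.
exact: driver_iterated_integral_unif_cont.
Qed.

Lemma tame_sig_comb c : tame (sig_comb c).
Proof.
elim: c => [|p c IH].
  by apply: eq_tame (tame_cst T HK 0) _ => w t _; rewrite /sig_comb /word_comb big_nil.
apply: eq_tame (tameD HK (tameZ HK p.1 (tame_iterated_integral p.2)) IH) _ => w t _.
by rewrite /sig_comb /word_comb big_cons.
Qed.

(** Approximation is required for all exponents at once, because products and
    Young's inequality double the exponent. *)
Definition sig_approx f : Prop := tame f /\ forall r (e : R), 0 < e ->
  exists c, mean (fun z => `|f z - sig_comb c z| ^+ r.+1) < e.

Lemma tame_normX f r : tame f -> tame (fun z => `|f z| ^+ r).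
Proof. by move=> tf; exact/(tameX HK)/(tame_norm tf). Qed.

Lemma mean_normD f g r : tame f -> tame g ->
  mean (fun z => `|f z + g z| ^+ r) <=
  2 ^+ r * (mean (fun z => `|f z| ^+ r) + mean (fun z => `|g z| ^+ r)).
Proof.
move=> tf tg; have tfr := tame_normX r tf; have tgr := tame_normX r tg.
rewrite -(meanD T0 HK)// -(meanZ T0 HK); last exact: (tameD HK).
apply: (le_mean T0 HK).
- by apply: tame_normX; exact: (tameD HK).
- by apply: (tameZ HK); exact: (tameD HK).
- by move=> w t _; exact: normD_expr.
Qed.

(** Multiplication by a fixed tame process is continuous: smallness of the
    moment of order 2 r of [h] gives smallness of the moment of order r of
    [u * h]. *)
Lemma mean_norm_mul u r (e : R) : tame u -> 0 < e ->
  exists2 d : R, 0 < d & forall h, tame h ->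
    mean (fun z => `|h z| ^+ r.*2) < d -> mean (fun z => `|u z * h z| ^+ r) < e.
Proof.
move=> tu e0; have tu2 := tame_normX r.*2 tu.
set M := mean (fun z => `|u z| ^+ r.*2).
have M0 : 0 <= M by apply: mean_ge0 => w t _; rewrite exprn_ge0.
pose d := e / 2 / (M + 1).
have d0 : 0 < d by rewrite !divr_gt0// ltr_wpDl.
exists (d * (e / 2)); first by rewrite mulr_gt0// divr_gt0.
move=> h th hd; have th2 := tame_normX r.*2 th.
apply: (@le_lt_trans _ _ (d * M + d^-1 * mean (fun z => `|h z| ^+ r.*2))).
  rewrite -!(meanZ T0 HK)// -(meanD T0 HK); [|exact: (tameZ HK)..].
  apply: (le_mean T0 HK).
  - by apply: tame_normX; exact: (tameM HK).
  - by apply: (tameD HK); exact: (tameZ HK).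
  - by move=> w t _; exact: young_expr.
rewrite (splitr e); apply: ler_ltD.
  by rewrite /d mulrAC ler_pdivrMr ?ltr_wpDl// ler_wpM2l ?lerDl// divr_ge0// ltW.
by rewrite mulrC ltr_pdivrMr// mulrC.
Qed.

Lemma sig_approx_closed f : tame f ->
  (forall r (e : R), 0 < e -> exists2 g, sig_approx g &
     mean (fun z => `|f z - g z| ^+ r.+1) < e) -> sig_approx f.
Proof.
move=> tf H; split => // r e e0.
have e2 : 0 < e / (2 ^+ r.+1 * 2) by rewrite divr_gt0// mulr_gt0// exprn_gt0.
have [g [tg Lg] gf] := H r _ e2; have [c cg] := Lg r _ e2; exists c.
have tc := tame_sig_comb c.
have := mean_normD r.+1 (tameB HK tf tg) (tameB HK tg tc).
have E : mean (fun z => `|f z - g z + (g z - sig_comb c z)| ^+ r.+1) =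
  mean (fun z => `|f z - sig_comb c z| ^+ r.+1).
  by apply: eq_mean => w t _; rewrite addrA subrK.
rewrite E => /le_lt_trans; apply.
rewrite -ltr_pdivlMl ?exprn_gt0//.
apply: lt_le_trans (ltrD gf cg) _.
by rewrite le_eqVlt; apply/orP; left; apply/eqP; field; rewrite expf_neq0.
Qed.

Lemma sig_approx_sig_comb c : sig_approx (sig_comb c).
Proof.
split; first exact: tame_sig_comb.
move=> r e e0; exists c; rewrite (@eq_mean _ (fun=> 0)) => [|w t _].
  by rewrite mean0.
by rewrite subrr normr0 expr0n.
Qed.

Lemma eq_sig_approx f g : sig_approx f ->
  (forall w t, 0 <= t <= T -> f (w, t) = g (w, t)) -> sig_approx g.
Proof.
move=> [tf Lf] fg; split; first exact: eq_tame tf fg.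
move=> r e e0; have [c cf] := Lf r e e0; exists c.
by rewrite -(@eq_mean (fun z => `|f z - sig_comb c z| ^+ r.+1))// => w t tT; rewrite fg.
Qed.

Lemma sig_approx_cst a : sig_approx (fun=> a).
Proof.
apply: eq_sig_approx (sig_approx_sig_comb [:: (a, [::])]) _ => w t _.
by rewrite /sig_comb /word_comb big_seq1 mulr1.
Qed.

Lemma sig_approxZ a f : sig_approx f -> sig_approx (fun z => a * f z).
Proof.
move=> [tf Lf]; apply: sig_approx_closed; first exact: (tameZ HK).
move=> r e e0.
have [d d0 H] := mean_norm_mul r.+1 (tame_cst T HK a) e0.
have [c cf] := Lf r.*2.+1 d d0.
exists (sig_comb [seq (a * p.1, p.2) | p <- c]); first exact: sig_approx_sig_comb.
have tc := tame_sig_comb c.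
have := H _ (tameB HK tf tc); rewrite -doubleS in cf.
move=> /(_ cf) /le_lt_trans; apply.
rewrite le_eqVlt; apply/orP; left; apply/eqP; apply: eq_mean => w t _.
by rewrite mulrBr /sig_comb /word_comb big_map mulr_sumr; congr (`|_ - _| ^+ _); apply:
  eq_bigr => p _; rewrite mulrA.
Qed.

Lemma sig_approxD f g : sig_approx f -> sig_approx g ->
  sig_approx (fun z => f z + g z).
Proof.
move=> [tf Lf] [tg Lg]; split; first exact: (tameD HK).
move=> r e e0.
have e2 : 0 < e / (2 ^+ r.+1 * 2) by rewrite divr_gt0// mulr_gt0// exprn_gt0.
have [c cf] := Lf r _ e2; have [c' cg] := Lg r _ e2; exists (c ++ c').
have tc := tame_sig_comb c; have tc' := tame_sig_comb c'.
have := mean_normD r.+1 (tameB HK tf tc) (tameB HK tg tc').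
have E : mean (fun z => `|f z - sig_comb c z + (g z - sig_comb c' z)| ^+ r.+1) =
  mean (fun z => `|f z + g z - sig_comb (c ++ c') z| ^+ r.+1).
  apply: eq_mean => w t _; rewrite addrACA -opprD /sig_comb /word_comb big_cat //.
rewrite E => /le_lt_trans; apply.
rewrite -ltr_pdivlMl ?exprn_gt0//.
apply: lt_le_trans (ltrD cf cg) _.
by rewrite le_eqVlt; apply/orP; left; apply/eqP; field; rewrite expf_neq0.
Qed.

(** Multiplying by a functional of the signature maps functionals to
    functionals by the shuffle identity, and it is continuous. *)
Lemma sig_approx_sig_combM c f : sig_approx f -> sig_approx (fun z => sig_comb c z * f z).
Proof.
move=> [tf Lf]; have tc := tame_sig_comb c.
apply: sig_approx_closed; first exact: (tameM HK).
move=> r e e0.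
have [d d0 H] := mean_norm_mul r.+1 tc e0.
have [c' cf] := Lf r.*2.+1 d d0.
exists (sig_comb (word_comb_mul c c')); first exact: sig_approx_sig_comb.
have tc' := tame_sig_comb c'.
have := H _ (tameB HK tf tc'); rewrite -doubleS in cf.
move=> /(_ cf) /le_lt_trans; apply.
rewrite le_eqVlt; apply/orP; left; apply/eqP; apply: eq_mean => w t tT.
by rewrite mulrBr /sig_comb (word_comb_mulE T0' (driver_bound_ge0 w) (driver_lipschitz
  HX w) (driver_primitive HX w)).
Qed.

(** The first factor is replaced by a functional of the signature; the product
    of that functional with [g] is already known to be approximable. *)
Lemma sig_approxM f g : sig_approx f -> sig_approx g ->
  sig_approx (fun z => f z * g z).
Proof.
move=> [tf Lf] Lg; have [tg _] := Lg.
apply: sig_approx_closed; first exact: (tameM HK).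
move=> r e e0.
have [d d0 H] := mean_norm_mul r.+1 tg e0.
have [c cf] := Lf r.*2.+1 d d0.
exists (fun z => sig_comb c z * g z); first exact: sig_approx_sig_combM.
have tc := tame_sig_comb c.
have := H _ (tameB HK tf tc); rewrite -doubleS in cf.
move=> /(_ cf) /le_lt_trans; apply.
rewrite le_eqVlt; apply/orP; left; apply/eqP; apply: eq_mean => w t tT.
by rewrite mulrBr [g _ * f _]mulrC [g _ * sig_comb _ _]mulrC.
Qed.

(** The powers of [f - f_ k] tend to 0 pointwise under a common integrable
    bound. *)
Lemma sig_approx_lim (f_ : nat -> Omega * R -> R) f C :
  (forall k, sig_approx (f_ k)) -> (forall k, dominated C (f_ k)) ->
  (forall w t, 0 <= t <= T -> f_ k (w, t) @[k --> \oo] --> f (w, t)) ->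
  sig_approx f.
Proof.
move=> Lf_ df_ cf.
have tf_ k : tame (f_ k) by case: (Lf_ k).
have tf := tame_lim tf_ df_ cf.
apply: sig_approx_closed => // r e e0.
pose g k (z : Omega * R) := `|f z - f_ k z| ^+ r.+1.
have tg k : tame (g k) by apply: tame_normX; exact: (tameB HK).
pose D (z : Omega * R) := 2 ^+ r.+1 * ((`|C| * expR (`|C| * K z.1)) ^+ r.+1 +
   (`|C| * expR (`|C| * K z.1)) ^+ r.+1).
have tD : tame D.
  have tC := tame_dominating (normr_ge0 C).
  by apply: (tameZ HK); apply: (tameD HK); exact: (tameX HK).
have df_' k : dominated `|C| (f_ k) by apply: (dominated_le HK) (df_ k); exact: ler_norm.
have df' := dominated_lim df_' cf.
have gD k w t : 0 <= t <= T -> `|g k (w, t)| <= D (w, t).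
  move=> tT; rewrite ger0_norm ?exprn_ge0//; apply: le_trans (normD_expr _ _ _) _.
  rewrite normrN; apply: ler_wpM2l; first exact: exprn_ge0.
  have C0 : 0 <= `|C| * expR (`|C| * K w) by rewrite mulr_ge0 ?expR_ge0.
  by apply: lerD; rewrite lerXn2r ?nnegrE//; [exact: df'|exact: df_'].
(* the random bound D is itself tame, so it can serve as a deterministic one *)
have [CD dD] := tD.2.
have dg k : dominated CD (g k).
  move=> w t tT; apply: le_trans (gD k w t tT) _; apply: le_trans (dD w t tT).
  exact: ler_norm.
have : mean (g k) @[k --> \oo] --> mean (fun=> 0).
  apply: (mean_cvg T0 HK tg dg) => w t tT; rewrite /g.
  have -> : (0 : R) = `|f (w, t) - f (w, t)| ^+ r.+1 by rewrite subrr normr0 expr0n.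
  apply: (@continuous_cvg _ _ _ _ _ _ (fun y : R => y ^+ r.+1)); first exact:
    exprn_continuous.
  by apply: cvg_norm; apply: cvgB; [exact: cvg_cst|exact: cf].
rewrite mean0.
move=> /cvgrPdist_lt /(_ _ e0)[k _ /(_ k (leqnn k))].
rewrite sub0r normrN => /(le_lt_trans (ler_norm _)) gk.
by exists (f_ k).
Qed.

(** If a functional [sig_comb c] is close to [f], then prepending the letter [j]
    to its words gives a functional close to the integral of [f]: the error is
    the integral of [h := f - sig_comb c], and Jensen's inequality bounds its
    moment of order r + 1 by that of [T * K * h]. *)
Lemma sig_approx_integral_along j f : sig_approx f ->
  (forall w, unif_cont_on T (fun t => f (w, t))) -> sig_approx (integral_along j f).
Proof.
move=> [tf Lf] uf; have tR := tame_integral_along j tf uf.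
apply: sig_approx_closed => // r e e0.
have [d d0 H] := mean_norm_mul r.+1 (tameZ HK T (tame_fst T HK)) e0.
have [c cf] := Lf r.*2.+1 d d0.
exists (sig_comb (prepend j c)); first exact: sig_approx_sig_comb.
have tc := tame_sig_comb c; have tc' := tame_sig_comb (prepend j c).
pose h z := f z - sig_comb c z.
have th : tame h by exact: (tameB HK).
have uh w : unif_cont_on T (fun t => h (w, t)).
  have uc := sig_comb_unif_cont c w.
  move=> e' e'0; have e'2 : 0 < e' / 2 by rewrite divr_gt0.
  have [d1 d10 H1] := uf w _ e'2; have [d2 d20 H2] := uc _ e'2.
  exists (Num.min d1 d2); first by rewrite lt_min d10.
  move=> s t sT tT; rewrite lt_min => /andP[/(H1 _ _ sT tT) h1 /(H2 _ _ sT tT) h2].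
  have -> : h (w, t) - h (w, s) =
    (f (w, t) - f (w, s)) - (sig_comb c (w, t) - sig_comb c (w, s)) by rewrite /h; ring.
  by apply: le_trans (ler_normB _ _) _; rewrite (splitr e') lerD.
have := H _ th; rewrite -doubleS in cf.
move=> /(_ cf) hlt; apply: (le_lt_trans _ hlt).
have RE w t : 0 <= t <= T ->
    integral_along j f (w, t) - sig_comb (prepend j c) (w, t) = integral_along j h (w, t).
  move=> tT.
  have P1 := integral_along_primitive j (uf w); have P2 := integral_along_primitive j
    (uh w).
  have P3 := primitive_word_comb T0' (driver_bound_ge0 w) (driver_lipschitz HX w)
    (driver_primitive HX w) j c.
  have P4 := primitiveDl P1 (primitiveZl (-1) P3).
  have P5 : primitive T (fun t => h (w, t)) (fun t => X w t j 0)
      (fun u => integral_along j f (w, u) + -1 * word_comb (X w) (prepend j c) u).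
    by apply: (eq_primitive T0' P4) => // u _; rewrite mulN1r.
  by rewrite -(primitive_unique P5 P2 tT) mulN1r.
rewrite (@eq_mean _ (fun z => `|integral_along j h z| ^+ r.+1)); last by move=> w t tT;
  rewrite RE.
have tRh := tame_integral_along j th uh.
have tL := tame_normX r.+1 tRh.
have tKh : tame (fun z => `|T * K z.1 * h z| ^+ r.+1).
  by apply: tame_normX; apply: (tameM HK) => //; apply: (tameZ HK); exact: tame_fst HK.
rewrite -lee_fin (meanE T0 HK tL) (meanE T0 HK tKh).
have mL : measurable_fun strip (fun z => (`|integral_along j h z| ^+ r.+1)%:E).
  by apply/measurable_EFinP; case: tL.
have mKh : measurable_fun strip (fun z => (`|T * K z.1 * h z| ^+ r.+1)%:E).
  by apply/measurable_EFinP; case: tKh.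
have L0 z : (0 <= (`|integral_along j h z| ^+ r.+1)%:E)%E by rewrite lee_fin exprn_ge0.
have Kh0 z : (0 <= (`|T * K z.1 * h z| ^+ r.+1)%:E)%E by rewrite lee_fin exprn_ge0.
rewrite !(integral_strip P)//.
apply: ge0_le_integral.
- by [].
- by move=> w Hw; apply: integral_ge0 => u _; rewrite lee_fin exprn_ge0.
- exact: (measurable_inner_integral mL).
- exact: (measurable_inner_integral mKh).
move=> w _.
have Pw := integral_along_primitive j (uh w).
have /= PP := primitive_power T0 r (driver_bound_ge0 w) (uh w) (driver_lipschitz HX w
  j) Pw.
set J := Rintegral _ _ _ in PP.
have ih : lebesgue_measure.-integrable `[0, T] (EFin \o (fun u => `|h (w, u)| ^+ r.+1)).
  apply: (continuous_integrable_itv (T := T)); first by rewrite T0' lexx.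
  apply: (@unif_cont_comp _ _ (fun t => h (w, t)) (fun y => `|y| ^+ r.+1)) => //.
  by move=> y; apply: (@continuous_comp _ _ _ (fun y : R => `|y|) (fun y => y ^+
    r.+1)); [exact: norm_continuous|exact: exprn_continuous].
apply: (@le_trans _ _ ((T * K w) ^+ r.+1 * J)%:E).
  apply: (@le_trans _ _ (\int[lebesgue_measure]_(t in `[0%R, T]) ((T * K w) ^+ r.+1 * J
    / T)%:E)%E).
    apply: ge0_le_integral => //.
    - have [A A0 hA] := unif_cont_bounded (uh w).
      have uR := lipschitz_on_unif_cont (primitive_lipschitz (driver_bound_ge0 w)
        (driver_lipschitz HX w j) Pw hA).
      have : lebesgue_measure.-integrable `[0, T] (EFin \o (fun u => `|integral_along j
        h (w, u)| ^+ r.+1)).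
        apply: (continuous_integrable_itv (T := T)); first by rewrite T0' lexx.
        apply: (@unif_cont_comp _ _ (fun t => integral_along j h (w, t)) (fun y => `|y|
          ^+ r.+1)) => //.
        by move=> y; apply: (@continuous_comp _ _ _ (fun y : R => `|y|) (fun y => y ^+
          r.+1)); [exact: norm_continuous|exact: exprn_continuous].
      by case/integrableP.
    - move=> t; rewrite /= in_itv/= => tT; rewrite lee_fin ler_pdivlMr//; exact: PP.
  by rewrite integral_cst//= lebesgue_measure_itv/= lte_fin T0 oppr0 addr0 -EFinM
    divfK// lt0r_neq0.
rewrite le_eqVlt; apply/orP; left; apply/eqP.
rewrite EFinM /J /Rintegral fineK; last first.
  exact: integrable_fin_num ih.
rewrite -ge0_integralZl//=.
all: try by rewrite lee_fin exprn_ge0// mulr_ge0// driver_bound_ge0.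
all: try by case/integrableP : ih.
all: try by move=> u _; rewrite lee_fin exprn_ge0.
apply: eq_integral => u _.
by rewrite -EFinM normrM (ger0_norm (mulr_ge0 T0' (driver_bound_ge0 w))) -exprMn.
Qed.

End SignatureClosure.

(** * Lattice operations on approximable processes of linear growth *)

Section LinearGrowth.
Context {R : realType} {disp : measure_display} {Omega : measurableType disp}.
Variables (P : probability Omega R) (T : R).
Hypothesis T0 : 0 < T.
Variables (n : nat) (X : Omega -> R -> 'cV[R]_n) (K : Omega -> R) (i0 : 'I_n).
Hypothesis HX : lipschitz_driver P T X K i0.
Local Notation HK := (driver_moments HX).
Local Notation dominated := (dominated T K).
Local Notation sig_approx := (sig_approx P T X K).
Local Notation K1 := (exp_moments_ge1 HK).
Implicit Types (f g h : Omega * R -> R).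

(** The bound that makes all exponential moments of [f] finite. *)
Definition linear_growth f : Prop := exists C : R,
  forall w t, 0 <= t <= T -> `|f (w, t)| <= C * K w.

Definition sig_approx_lin f : Prop := sig_approx f /\ linear_growth f.

Lemma linear_growth_ex f : linear_growth f -> exists2 C : R, 0 <= C &
  forall w t, 0 <= t <= T -> `|f (w, t)| <= C * K w.
Proof.
move=> [C fC]; exists `|C| => // w t tT; apply: le_trans (fC w t tT) _.
by rewrite ler_wpM2r ?ler_norm// (driver_bound_ge0 HX).
Qed.

Lemma linear_growth_dominated f (C : R) : 0 <= C ->
  (forall w t, 0 <= t <= T -> `|f (w, t)| <= C * K w) -> dominated (C + 1) f.
Proof.
move=> C0 fC w t tT; apply: le_trans (fC w t tT) _.
apply: ler_pM => //; [exact: driver_bound_ge0 HX w|by rewrite lerDl|].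
apply: (@le_trans _ _ ((C + 1) * K w)).
  by rewrite ler_peMl ?(driver_bound_ge0 HX)// lerDr.
by apply: le_trans (expR_ge1Dx _); rewrite lerDr.
Qed.

Lemma linear_growth_dominated_exp f (C l : R) : 0 <= C -> 0 <= l ->
  (forall w t, 0 <= t <= T -> `|f (w, t)| <= C * K w) ->
  forall h, (forall w t, 0 <= t <= T -> `|h (w, t)| <= expR (l * `|f (w, t)|)) ->
  dominated (l * C + 1) h.
Proof.
move=> C0 l0 fC h hf w t tT; apply: le_trans (hf w t tT) _.
apply: (@le_trans _ _ (expR ((l * C + 1) * K w))).
  rewrite ler_expR mulrDl -mulrA.
  apply: (@le_trans _ _ (l * (C * K w))); first by rewrite ler_wpM2l ?fC.
  by rewrite lerDl mul1r (driver_bound_ge0 HX).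
by rewrite ler_peMl ?expR_ge0// lerDr mulr_ge0.
Qed.

Lemma sig_approxX f r : sig_approx f -> sig_approx (fun z => f z ^+ r).
Proof.
move=> Lf; elim: r => [|r IH].
  by apply: (eq_sig_approx (sig_approx_cst T0 HX 1)) => w t _; rewrite expr0.
by apply: (eq_sig_approx (sig_approxM T0 HX Lf IH)) => w t _; rewrite exprS.
Qed.

Lemma sig_approxB f g : sig_approx f -> sig_approx g ->
  sig_approx (fun z => f z - g z).
Proof.
move=> Lf Lg.
by apply: (eq_sig_approx (sig_approxD T0 HX Lf (sig_approxZ T0 HX (-1) Lg))) => w t _;
  rewrite mulN1r.
Qed.

(** The Taylor polynomials of the sine at [l * f] are dominated by
    exp (l |f|) <= exp (l * C * K); this is where linear growth is
    indispensable. *)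
Lemma sig_approx_sin f l : sig_approx_lin f -> 0 <= l ->
  sig_approx (fun z => sin (l * f z)).
Proof.
move=> [Lf /linear_growth_ex[C C0 fC]] l0.
apply: (@sig_approx_lim _ _ _ P T T0 _ X K i0 HX (fun k z => sin_poly (l * f z) k) _ (l
  * C + 1)).
- elim=> [|k IH].
    by apply: (eq_sig_approx (sig_approx_cst T0 HX 0)) => w t _; rewrite /sin_poly
      big_geq.
  apply: (eq_sig_approx (sig_approxD T0 HX IH (sig_approxZ T0 HX
    ((odd k)%:R * (-1) ^+ k.-1./2 / k`!%:R) (sig_approxX k (sig_approxZ T0 HX l Lf)))))
      => w t _.
  by rewrite /sin_poly big_nat_recr.
- move=> k; apply: (linear_growth_dominated_exp C0 l0 fC) => w t tT.
  by apply: le_trans (sin_poly_le _ _) _; rewrite normrM ger0_norm.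
- by move=> w t _; exact: sin_poly_cvg.
Qed.

Lemma sig_approx_norm1 g : sig_approx g ->
  (forall w t, 0 <= t <= T -> `|g (w, t)| <= 1) -> sig_approx (fun z => `|g z|).
Proof.
move=> Lg g1.
apply: (@sig_approx_lim _ _ _ P T T0 _ X K i0 HX (fun k z => norm_iter (g z) k) _ 1).
- elim=> [|k IH] /=; first exact: sig_approx_cst HX 0.
  apply: (eq_sig_approx (sig_approxD T0 HX IH (sig_approxZ T0 HX 2^-1
    (sig_approxB (sig_approxX 2 Lg) (sig_approxX 2 IH))))) => w t _.
  by rewrite mulrC.
- move=> k w t tT; have [/andP[p0 pu] _] := norm_iter_bounds k (g1 w t tT).
  rewrite mul1r ger0_norm//; apply: le_trans pu _; apply: le_trans (g1 w t tT) _.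
  by rewrite mul1r -[X in X <= _]expR0 ler_expR (driver_bound_ge0 HX).
- by move=> w t tT; apply: norm_iter_cvg; exact: g1.
Qed.

(** |f| is the limit of k |sin (f / k)|, which is dominated by |f|, and
    sin (f / k) takes values in [-1, 1]. *)
Lemma sig_approx_lin_norm f : sig_approx_lin f -> sig_approx_lin (fun z => `|f z|).
Proof.
move=> [Lf lf]; have [C C0 fC] := linear_growth_ex lf.
have fC' w t : 0 <= t <= T -> Num.norm (Num.norm (f (w, t))) <= C * K w by rewrite
  normr_id; exact: fC.
split; last by exists C.
apply: (@sig_approx_lim _ _ _ P T T0 _ X K i0 HX
  (fun k z => k.+1%:R * `|sin (k.+1%:R^-1 * f z)|) _ (C + 1)).
- move=> k; apply: (sig_approxZ T0 HX); apply: sig_approx_norm1.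
    by apply: sig_approx_sin => //; rewrite invr_ge0.
  by move=> w t _; rewrite ler_norml sin_geN1 sin_le1.
- move=> k; apply: linear_growth_dominated => // w t tT; apply: le_trans (fC w t tT).
  rewrite normrM normr_id normr_nat -ler_pdivlMl//.
  by apply: le_trans (norm_sin_le _) _; rewrite normrM normfV normr_nat.
- move=> w t _.
  have -> : (fun k => k.+1%:R * `|sin (k.+1%:R^-1 * f (w, t))|) =
     (fun k => `|k.+1%:R * sin (f (w, t) / k.+1%:R)|).
    by apply/funext => k; rewrite normrM normr_nat mulrC [_^-1 * _]mulrC mulrC.
  by apply: cvg_norm; exact: sin_scaled_cvg.
Qed.

Lemma sig_approx_lin_cst a : sig_approx_lin (fun=> a).
Proof.
split; first exact: sig_approx_cst HX a.
by exists `|a| => w t _; rewrite ler_peMr// K1.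
Qed.

Lemma sig_approx_linD f g : sig_approx_lin f -> sig_approx_lin g ->
  sig_approx_lin (fun z => f z + g z).
Proof.
move=> [Lf [C fC]] [Lg [C' gC]]; split; first exact: (sig_approxD T0 HX).
exists (C + C') => w t tT; rewrite mulrDl; apply: le_trans (ler_normD _ _) _.
by rewrite lerD ?fC ?gC.
Qed.

Lemma sig_approx_linZ a f : sig_approx_lin f -> sig_approx_lin (fun z => a * f z).
Proof.
move=> [Lf [C fC]]; split; first exact: (sig_approxZ T0 HX).
by exists (`|a| * C) => w t tT; rewrite normrM -mulrA ler_wpM2l ?fC.
Qed.

Lemma eq_sig_approx_lin f g : sig_approx_lin f ->
  (forall w t, 0 <= t <= T -> f (w, t) = g (w, t)) -> sig_approx_lin g.
Proof.
move=> [Lf [C fC]] fg; split; first exact: eq_sig_approx fg.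
by exists C => w t tT; rewrite -fg// fC.
Qed.

Lemma sig_approx_linB f g : sig_approx_lin f -> sig_approx_lin g ->
  sig_approx_lin (fun z => f z - g z).
Proof.
move=> Lf Lg; apply: (eq_sig_approx_lin (sig_approx_linD Lf (sig_approx_linZ (-1) Lg)))
  => w t _.
by rewrite mulN1r.
Qed.

Lemma sig_approx_lin_min f g : sig_approx_lin f -> sig_approx_lin g ->
  sig_approx_lin (fun z => Num.min (f z) (g z)).
Proof.
move=> Lf Lg; have := sig_approx_linZ 2^-1
  (sig_approx_linB (sig_approx_linD Lf Lg) (sig_approx_lin_norm (sig_approx_linB Lf Lg))).
by move=> H; apply: (eq_sig_approx_lin H) => w t _; rewrite minr_absE mulrC.
Qed.

Lemma sig_approx_lin_sum (m : nat) (F : 'I_m -> Omega * R -> R) :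
  (forall i, sig_approx_lin (F i)) -> sig_approx_lin (fun z => \sum_(i < m) F i z).
Proof.
elim: m F => [|m IH] F HF.
  by apply: (eq_sig_approx_lin (sig_approx_lin_cst 0)) => w t _; rewrite big_ord0.
apply: (eq_sig_approx_lin (sig_approx_linD (IH (fun i => F (widen_ord (leqnSn m) i))
  (fun i => HF _)) (HF ord_max))) => w t _.
by rewrite big_ord_recr.
Qed.

(** Time is the iterated integral of the one-letter word [i0]. *)
Lemma sig_approx_lin_time : sig_approx_lin (fun z => z.2).
Proof.
split; last first.
  exists T => w t /andP[t0 tT]; rewrite ger0_norm//; apply: le_trans tT _.
  by rewrite ler_peMr ?K1// ltW.
apply: (eq_sig_approx (sig_approx_sig_comb T0 HX [:: (1, [:: i0])])) => w t tT.
rewrite /sig_comb /word_comb big_seq1 mul1r.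
have T0' := ltW T0.
have P1 := primitive_iterated_integral T0' (driver_bound_ge0 HX w) (driver_lipschitz HX w)
  (driver_primitive HX w) i0 [::].
apply: (primitive_unique P1 _ tT); split=> // e e0; exists 1 => // s u s0 su uT _.
have uT' : 0 <= u <= T by rewrite uT (le_trans s0).
have sT' : 0 <= s <= T by rewrite s0 (le_trans su).
by rewrite !(driver_time HX)// mul1r subrr normr0 mulr_ge0 ?subr_ge0// ltW.
Qed.

End LinearGrowth.

(** * Continuous functions of approximable processes *)

Section InfConvolution.
Context {R : realType} (T : R) (m : nat).
Hypothesis T0 : 0 < T.

(** An enumeration of the rational points, by countability of the type. *)
Definition dense_point (k : nat) : rat * 'cV[rat]_m := odflt (0, 0) (unpickle k).
Definition dense_time (k : nat) : R := Num.min (Num.max 0 (ratr (dense_point k).1)) T.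
Definition dense_state (k : nat) : 'cV[R]_m := map_mx ratr (dense_point k).2.

Lemma dense_time_itv k : 0 <= dense_time k <= T.
Proof.
rewrite /dense_time le_min le_max lexx /= ge_min lexx orbT andbT.
exact: ltW.
Qed.

Lemma dense_approx t (y : 'cV[R]_m) (d : R) : 0 <= t <= T -> 0 < d ->
  exists k, `|t - dense_time k| < d /\ forall i, `|y i 0 - dense_state k i 0| < d.
Proof.
move=> /andP[t0 tT] d0.
have ex (x : R) : exists q : rat, `|x - ratr q| < d.
  have [q] := @rat_in_itvoo R (x - d) (x + d) ltac:(lra).
  by rewrite in_itv/= => /andP[q1 q2]; exists q; rewrite ltr_norml; apply/andP; split;
    lra.
have [q qt] := ex t; have [v vy] := choice (fun i : 'I_m => ex (y i 0)).
exists (pickle (q, \col_i v i)).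
rewrite /dense_time /dense_state /dense_point pickleK/=; split; last by move=> i;
  rewrite !mxE.
move: qt; rewrite !ltr_norml => /andP[q1 q2].
case: (leP 0 (ratr q : R)) => q0; [case: (leP (ratr q : R) T) => q3|case: (leP 0 T) =>
  q3]; apply/andP; split; lra.
Qed.

Definition distance k (t : R) (y : 'cV[R]_m) : R :=
  `|t - dense_time k| + \sum_i `|y i 0 - dense_state k i 0|.

Variables (g : R -> 'cV[R]_m -> R) (B : R).
Hypothesis gB : forall t y, 0 <= t <= T -> `|g t y| <= B.
Hypothesis gc : {within `[0, T] `*` [set: 'cV[R]_m], continuous (fun z : R * 'cV[R]_m
  => g z.1 z.2)}.

(** For [l] large, the minimum over [k] of these functions is close to
    [g t y] (inf-convolution); each of them is built from absolute values and
    sums only. *)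
Definition penalized (l : R) k t y : R :=
  g (dense_time k) (dense_state k) + l * distance k t y.

(** Minima over finitely many points.  The infimum over all points is the limit
    in [k], and [g] is the limit of these infima as [l] grows; the two limits
    are taken one after the other because the number of points needed depends
    on [l] and on the argument. *)
Fixpoint inf_conv (l : R) (k : nat) t y : R :=
  if k is k'.+1 then Num.min (inf_conv l k' t y) (penalized l k'.+1 t y)
  else penalized l 0 t y.

Lemma distance_ge0 k t y : 0 <= distance k t y.
Proof. by rewrite addr_ge0// sumr_ge0. Qed.

Lemma inf_conv_ge (c : R) l k t y : (forall j, c <= penalized l j t y) -> c <= inf_conv
  l k t y.
Proof. by move=> H; elim: k => [|k IH] //=; rewrite le_min IH H. Qed.

Lemma inf_conv_le l j k t y : (j <= k)%N -> inf_conv l k t y <= penalized l j t y.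
Proof.
elim: k => [|k IH]; first by rewrite leqn0 => /eqP ->.
rewrite leq_eqVlt => /predU1P[->|]; first by rewrite /= ge_min lexx orbT.
by rewrite ltnS => /IH H; rewrite /= ge_min H.
Qed.

Lemma inf_conv_lower l k t y : 0 <= l -> - B <= inf_conv l k t y.
Proof.
move=> l0; apply: inf_conv_ge => j; rewrite /penalized.
have := gB (dense_state j) (dense_time_itv j); rewrite ler_norml => /andP[+ _].
have : 0 <= l * distance j t y by rewrite mulr_ge0 ?distance_ge0.
lra.
Qed.

Lemma inf_conv_nonincreasing l t y : nonincreasing_seq (fun k => inf_conv l k t y).
Proof. by apply/nonincreasing_seqP => k /=; rewrite ge_min lexx. Qed.

Lemma inf_conv_cvg l t y : 0 <= l -> cvg (inf_conv l k t y @[k --> \oo]).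
Proof.
move=> l0; apply: nonincreasing_is_cvgn; first exact: inf_conv_nonincreasing.
by exists (- B) => _ [k _ <-]; exact: inf_conv_lower.
Qed.

Definition inf_conv_lim l t y : R := lim (inf_conv l k t y @[k --> \oo]).

Lemma inf_conv_lim_le l k t y : 0 <= l -> inf_conv_lim l t y <= inf_conv l k t y.
Proof.
move=> l0; apply: nonincreasing_cvgn_ge; first exact: inf_conv_nonincreasing.
exact: inf_conv_cvg.
Qed.

Lemma inf_conv_lim_ge c l t y : 0 <= l -> (forall k, c <= inf_conv l k t y) ->
  c <= inf_conv_lim l t y.
Proof.
by move=> l0 H; apply: limr_ge; [exact: inf_conv_cvg|exact: nearW].
Qed.

Lemma continuity_modulus t (y : 'cV[R]_m) (e : R) : 0 <= t <= T -> 0 < e -> exists2 d :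
  R, 0 < d &
  forall t' (y' : 'cV[R]_m), 0 <= t' <= T -> `|t - t'| < d ->
   (forall i, `|y i 0 - y' i 0| < d) -> `|g t y - g t' y'| <= e.
Proof.
move=> tT e0; have : ([set` `[0, T]] `*` [set: 'cV[R]_m]) (t, y).
  by split => //=; rewrite in_itv.
move: gc => /subspace_continuousP gc' /gc' /cvgrPdist_le /(_ _ e0).
rewrite near_withinE => /nbhs_ballP[d/= d0 H]; exists d => // t' y' t'T tt' yy'.
apply: (H (t', y')); last by split => //=; rewrite in_itv.
split => //=; split => // i j; rewrite ord1; exact: yy'.
Qed.

(** Some point of the dense sequence is so close to [(t, y)] that both the
    oscillation of [g] and the penalty are small. *)
Lemma inf_conv_lim_le_g l t y : 0 <= l -> 0 <= t <= T -> inf_conv_lim l t y <= g t y.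
Proof.
move=> l0 tT; apply/ler_addgt0Pl => e e0.
have e2 : 0 < e / 2 by rewrite divr_gt0.
have [d d0 H] := continuity_modulus y tT e2.
pose c := l * (m.+1)%:R + 1.
have c0 : 0 < c by rewrite ltr_wpDl// mulr_ge0.
have dd : 0 < Num.min d (e / 2 / c) by rewrite lt_min d0 divr_gt0.
have [k [kt ky]] := dense_approx y tT dd.
apply: le_trans (inf_conv_lim_le k t y l0) _.
apply: le_trans (inf_conv_le l t y (leqnn k)) _.
rewrite /penalized.
have : `|g t y - g (dense_time k) (dense_state k)| <= e / 2.
  apply: H; first exact: dense_time_itv.
    by move: kt; rewrite lt_min => /andP[].
  by move=> i; have := ky i; rewrite lt_min => /andP[].
rewrite ler_norml => /andP[+ _].
have : l * distance k t y <= e / 2.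
  have : distance k t y <= m.+1%:R * (e / 2 / c).
    rewrite -[m.+1]add1n natrD mulrDl mul1r; apply: lerD.
      by move: kt; rewrite lt_min => /andP[_ /ltW].
    apply: (@le_trans _ _ (\sum_(i < m) e / 2 / c)).
      by apply: ler_sum => i _; have := ky i; rewrite lt_min => /andP[_ /ltW].
    by rewrite sumr_const card_ord mulr_natl.
  move=> /(ler_wpM2l l0)/le_trans; apply.
  have -> : l * (m.+1%:R * (e / 2 / c)) = l * m.+1%:R / c * (e / 2).
    by field; rewrite lt0r_neq0.
  by rewrite ler_piMl ?(ltW e2)// ler_pdivrMr// mul1r lerDl.
lra.
Qed.

Lemma inf_conv_lim_bound l t y : 0 <= l -> 0 <= t <= T -> `|inf_conv_lim l t y| <= B.
Proof.
move=> l0 tT; rewrite ler_norml; apply/andP; split.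
  by apply: inf_conv_lim_ge => // k; exact: inf_conv_lower.
apply: le_trans (inf_conv_lim_le_g y l0 tT) _.
by apply: le_trans (gB y tT); exact: ler_norm.
Qed.

(** Points within the continuity modulus [d] cannot lower the infimum below
    [g t y - e]; at the other points the penalty [l * d] exceeds the total
    oscillation [2 * B] as soon as [l] is large. *)
Lemma inf_conv_lim_cvg t y : 0 <= t <= T -> inf_conv_lim l%:R t y @[l --> \oo] --> g t y.
Proof.
move=> tT; apply/cvgrPdist_le => e e0.
have [d d0 H] := continuity_modulus y tT e0.
near=> l.
have lB : 2 * B <= l%:R * d.
  rewrite -ler_pdivrMr//; near: l; exact: nbhs_infty_ger.
rewrite ger0_norm; last by rewrite subr_ge0 inf_conv_lim_le_g.
rewrite lerBlDl -lerBlDr; apply: inf_conv_lim_ge => // k; apply: inf_conv_ge => j.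
rewrite /penalized.
have := gB y tT; rewrite ler_norml => /andP[_ gyB].
have := gB (dense_state j) (dense_time_itv j); rewrite ler_norml => /andP[gjB _].
have [dj|dj] := leP d (distance j t y).
  have : l%:R * d <= l%:R * distance j t y by rewrite ler_wpM2l.
  lra.
have : `|g t y - g (dense_time j) (dense_state j)| <= e.
  apply: H; first exact: dense_time_itv.
    by apply: le_lt_trans dj; rewrite lerDl sumr_ge0.
  move=> i; apply: le_lt_trans dj.
  rewrite /distance (bigD1 i)//= addrCA lerDl addr_ge0// sumr_ge0//.
rewrite ler_norml => /andP[_].
have : 0 <= l%:R * distance j t y by rewrite mulr_ge0 ?distance_ge0.
lra.
Unshelve. all: by end_near. Qed.
End InfConvolution.

Section Composition.
Context {R : realType} {disp : measure_display} {Omega : measurableType disp}.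
Variables (P : probability Omega R) (T : R).
Hypothesis T0 : 0 < T.
Variables (n : nat) (X : Omega -> R -> 'cV[R]_n) (K : Omega -> R) (i0 : 'I_n).
Hypothesis HX : lipschitz_driver P T X K i0.

(** Finite minima of penalized functions are approximable by the lattice
    operations; the limits in the number of points and in the penalty are
    dominated. *)
Lemma sig_approx_comp (m : nat) (Y : Omega -> R -> 'cV[R]_m) (g : R -> 'cV[R]_m -> R)
  (B : R) :
  (forall i, sig_approx_lin P T X K (fun z => Y z.1 z.2 i 0)) ->
  {within `[0, T] `*` [set: 'cV[R]_m], continuous (fun z : R * 'cV[R]_m => g z.1 z.2)} ->
  (forall t y, 0 <= t <= T -> `|g t y| <= B) ->
  sig_approx P T X K (fun z => g z.2 (Y z.1 z.2)).
Proof.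
move=> LY gc gB.
have B0 : 0 <= B.
  have := gB 0 0; rewrite lexx ltW// => /(_ isT); exact: le_trans.
have pen l k : sig_approx_lin P T X K (fun z => penalized T g l k z.2 (Y z.1 z.2)).
  rewrite /penalized /distance.
  have cst := sig_approx_lin_cst T0 HX.
  apply: (sig_approx_linD T0 HX) => //.
  apply: (sig_approx_linZ T0 HX); apply: (sig_approx_linD T0 HX).
    apply: (sig_approx_lin_norm T0 HX); apply: (sig_approx_linB T0 HX) => //.
    exact: (sig_approx_lin_time T0 HX).
  apply: (sig_approx_lin_sum T0 HX) => i.
  by apply: (sig_approx_lin_norm T0 HX); apply: (sig_approx_linB T0 HX).
have inf l k : sig_approx_lin P T X K (fun z => inf_conv T g l k z.2 (Y z.1 z.2)).
  by elim: k => [|k IH] /=; [exact: pen|exact: (sig_approx_lin_min T0 HX)].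
have infl l : 0 <= l -> sig_approx P T X K (fun z => inf_conv_lim T g l z.2 (Y z.1 z.2)).
  move=> l0; have [C C0 HC] := linear_growth_ex HX (inf l 0).2.
  apply: (@sig_approx_lim _ _ _ P T T0 _ X K i0 HX
    (fun k z => inf_conv T g l k z.2 (Y z.1 z.2)) _ (B + C + 1)).
  - by move=> k; case: (inf l k).
  - move=> k; apply: (linear_growth_dominated HX); first exact: addr_ge0.
    move=> w t tT /=; have := HC w t tT; rewrite !ler_norml /= => /andP[_ h1].
    have h2 := inf_conv_lower T0 gB k t (Y w t) l0.
    have h3 : inf_conv T g l k t (Y w t) <= penalized T g l 0 t (Y w t) by exact:
      inf_conv_le.
    have K1 := exp_moments_ge1 (driver_moments HX) w.
    have BK : B <= B * K w by rewrite ler_peMr.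
    have CK : 0 <= C * K w by rewrite mulr_ge0// (driver_bound_ge0 HX).
    by rewrite mulrDl; apply/andP; split; lra.
  - by move=> w t tT; exact: (inf_conv_cvg T0 gB).
apply: (@sig_approx_lim _ _ _ P T T0 _ X K i0 HX
  (fun k z => inf_conv_lim T g k%:R z.2 (Y z.1 z.2)) _ B).
- by move=> k; exact: infl.
- move=> k w t tT; apply: (le_trans (inf_conv_lim_bound T0 gB gc _ _ tT)) => //.
  rewrite ler_peMr// -[X in X <= _]expR0 ler_expR mulr_ge0// (driver_bound_ge0 HX)//.
- by move=> w t tT; exact: (inf_conv_lim_cvg T0 gB gc).
Qed.
End Composition.

(** * Picard iteration with clipped coefficients *)

Section Clip.
Context {R : realType}.

Definition clip (c x : R) : R := Num.max (- c) (Num.min x c).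

Lemma clip_norm_le c x : 0 <= c -> `|clip c x| <= c.
Proof.
move=> c0; rewrite /clip ler_norml le_max lexx/= ge_max ge_min lexx orbT andbT.
lra.
Qed.

Lemma clip_id c x : `|x| <= c -> clip c x = x.
Proof. by rewrite ler_norml => /andP[h1 h2]; rewrite /clip min_l// max_r. Qed.

Lemma clip_le_norm c x : 0 <= c -> `|clip c x| <= `|x|.
Proof.
move=> c0; have [xc|cx] := leP `|x| c; first by rewrite clip_id.
by apply: le_trans (clip_norm_le x c0) _; exact: ltW.
Qed.

Lemma clip_lipschitz c x y : 0 <= c -> `|clip c x - clip c y| <= `|x - y|.
Proof.
move=> c0; rewrite /clip; case: (leP x c) => xc; case: (leP y c) => yc.
- case: (leP (- c) x) => h1; case: (leP (- c) y) => h2;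
  rewrite ler_norml; apply/andP; split; have := ler_norm (x - y); have := ler_norm (y -
    x); rewrite [`|y - x|]distrC; lra.
- case: (leP (- c) x) => h1; case: (leP (- c) c) => h2;
  rewrite ler_norml; apply/andP; split; have := ler_norm (x - y); have := ler_norm (y -
    x); rewrite [`|y - x|]distrC; lra.
- case: (leP (- c) c) => h1; case: (leP (- c) y) => h2;
  rewrite ler_norml; apply/andP; split; have := ler_norm (x - y); have := ler_norm (y -
    x); rewrite [`|y - x|]distrC; lra.
- by rewrite subrr normr0.
Qed.

Lemma clip_continuous c : 0 <= c -> continuous (clip c).
Proof.
move=> c0 x; apply/cvgrPdist_le => e e0; near=> y.
apply: le_trans (clip_lipschitz x y c0) _; apply: ltW; near: y.
by apply/nbhs_ballP; exists e.
Unshelve. all: by end_near. Qed.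
End Clip.

Section Picard.
Context {R : realType} {disp : measure_display} {Omega : measurableType disp}.
Variables (P : probability Omega R) (T : R).
Hypothesis T0 : 0 < T.
Variables (n : nat) (X : Omega -> R -> 'cV[R]_n) (K : Omega -> R) (i0 : 'I_n).
Hypothesis HX : lipschitz_driver P T X K i0.
Variables (m : nat) (f : 'I_m -> 'I_n -> R -> 'cV[R]_m -> R) (y0 : 'cV[R]_m).
Variables (L C : R).
Hypothesis L0 : 0 <= L.
Hypothesis C0 : 0 <= C.
Hypothesis f_cont : forall i J, {within `[0, T] `*` [set: 'cV[R]_m],
  continuous (fun z : R * 'cV[R]_m => f i J z.1 z.2)}.
Hypothesis f_lip : forall i J t (x y : 'cV[R]_m), 0 <= t <= T ->
  `|f i J t x - f i J t y| <= L * \sum_j `|x j 0 - y j 0|.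
Hypothesis f_growth : forall i J t (x : 'cV[R]_m), 0 <= t <= T ->
  `|f i J t x| <= C * (1 + \sum_j `|x j 0|).
Let T0' := ltW T0.

Definition cont_strip (g : R -> 'cV[R]_m -> R) : Prop :=
  {within `[0, T] `*` [set: 'cV[R]_m], continuous (fun z : R * 'cV[R]_m => g z.1 z.2)}.

Definition unif_cont_path (y : R -> 'cV[R]_m) := forall i, unif_cont_on T (fun t => y t
  i 0).

(** Continuity of the coefficient along a continuous path, followed by Heine's
    theorem. *)
Lemma unif_cont_along (g : R -> 'cV[R]_m -> R) (y : R -> 'cV[R]_m) :
  cont_strip g -> unif_cont_path y -> unif_cont_on T (fun t => g t (y t)).
Proof.
move=> gc uy; apply: continuous_unif_cont => //.
apply/subspace_continuousP => t; rewrite /= in_itv/= => tT.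
apply/cvgrPdist_le => e e0.
have [d d0 H] := continuity_modulus gc (y t) tT e0.
have ex i : exists di : R, 0 < di /\ forall s, 0 <= s <= T -> `|s - t| < di ->
    `|y s i 0 - y t i 0| < d.
  have d2 : 0 < d / 2 by rewrite divr_gt0.
  have [di di0 Hi] := uy i _ d2; exists di; split => // s sT st.
  by apply: (le_lt_trans (Hi t s tT sT st)); lra.
have [di Hdi] := choice ex.
rewrite near_withinE; near=> s; rewrite /= in_itv/= => sT.
apply: H => //.
move=> i; rewrite distrC; apply: (Hdi i).2 => //; rewrite distrC; move: i.
near: s; apply: filter_forall => i; apply/nbhs_ballP; exists (di i) => //=; exact: (Hdi
  i).1.
Unshelve. all: by end_near. Qed.

Lemma continuous_unif_cont_path (y : R -> 'cV[R]_m) :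
  {within `[0, T], continuous y} -> unif_cont_path y.
Proof.
move=> cy i; apply: continuous_unif_cont => // t.
apply: (@continuous_comp (subspace [set` `[0, T]]) 'cV[R]_m R y (fun v => v i 0)).
  exact: (cy t).
exact: coord_continuous.
Qed.

(** The Picard iteration in which the coefficients of step k + 1 are clipped at
    level k.  Clipping keeps each iterate within linear growth in [K]; letting
    the level grow with the step makes one sequence of iterates converge for
    every outcome. *)
Fixpoint picard (k : nat) (w : Omega) (t : R) : 'cV[R]_m :=
  if k is k'.+1 then \col_i (y0 i 0 + \sum_(J < n)
    RS_integral (fun u => clip k'%:R (f i J u (picard k' w u))) (fun u => X w u J 0) 0 t)
  else y0.

Lemma clip_f_cont k i J : cont_strip (fun t y => clip k%:R (f i J t y)).
Proof.
move=> z; apply: (@continuous_comp (subspace ([set` `[0, T]] `*` [set: 'cV[R]_m]))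
  R R (fun z : R * 'cV[R]_m => f i J z.1 z.2) (clip k%:R)).
  exact: (@f_cont i J z).
exact: clip_continuous.
Qed.

Lemma RS_integral_primitive w J a : unif_cont_on T a ->
  primitive T a (fun t => X w t J 0) (RS_integral a (fun t => X w t J 0) 0).
Proof.
exact: (primitive_RS_integral T0' (driver_bound_ge0 HX w) (driver_lipschitz HX w)
  (driver_primitive HX w)).
Qed.

Lemma picardS_E k w t i : picard k.+1 w t i 0 = y0 i 0 + \sum_(J < n)
  RS_integral (fun u => clip k%:R (f i J u (picard k w u))) (fun u => X w u J 0) 0 t.
Proof. by rewrite /= mxE. Qed.

Lemma picard_unif_cont k w : unif_cont_path (picard k w).
Proof.
elim: k => [|k IH] i.
  by move=> e e0; exists 1 => // s t _ _ _; rewrite subrr normr0 ltW.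
have uc J := @unif_cont_along (fun t y => clip k%:R (f i J t y)) _ (@clip_f_cont k i J)
  IH.
have lS : forall s, lipschitz_on T (\sum_(J <- s) k%:R * K w) (fun t => \sum_(J <- s)
   RS_integral (fun u => clip k%:R (f i J u (picard k w u))) (fun u => X w u J 0) 0 t).
  elim=> [|J s IHs] u v u0 uv vT; first by rewrite !big_nil subrr normr0 mul0r.
  rewrite !big_cons opprD addrACA mulrDl; apply: le_trans (ler_normD _ _) _.
  apply: lerD; last exact: IHs.
  apply: (primitive_lipschitz (driver_bound_ge0 HX w) (driver_lipschitz HX w J)
    (RS_integral_primitive w J (uc J))) => //.
  by move=> x _; exact: clip_norm_le.
apply: (lipschitz_on_unif_cont (K := \sum_(J <- index_enum 'I_n) k%:R * K w)) => u v u0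
  uv vT.
by rewrite !picardS_E opprD addrACA subrr add0r; exact: lS.
Qed.

(** The integrands are bounded continuous functions of the time and the previous
    iterate, hence approximable; their integrals are bounded by k * T * K. *)
Lemma picard_sig_approx k i : sig_approx_lin P T X K (fun z => picard k z.1 z.2 i 0).
Proof.
elim: k i => [|k IH] i; first exact: (sig_approx_lin_cst T0 HX).
suff : sig_approx_lin P T X K (fun z => y0 i 0 + \sum_(J < n)
    integral_along X J (fun z => clip k%:R (f i J z.2 (picard k z.1 z.2))) z).
  by move=> H; apply: (eq_sig_approx_lin H) => w t _; rewrite picardS_E.
apply: (sig_approx_linD T0 HX); first exact: (sig_approx_lin_cst T0 HX).
apply: (sig_approx_lin_sum T0 HX) => J.
have uc w : unif_cont_on T (fun t => clip k%:R (f i J t (picard k w t))).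
  by apply: (@unif_cont_along (fun t y => clip k%:R (f i J t y)) _ (@clip_f_cont k i
    J)); exact: picard_unif_cont.
split.
  apply: (sig_approx_integral_along T0 HX) => //.
  apply: (@sig_approx_comp _ _ _ P T T0 _ X K i0 HX _ (picard k)
    (fun t y => clip k%:R (f i J t y)) k%:R) => //.
    exact: (@clip_f_cont k i J).
  by move=> t y _; exact: clip_norm_le.
exists (T * k%:R) => w t /andP[t0 tT].
have PR := RS_integral_primitive w J (uc w).
have := primitive_lipschitz (driver_bound_ge0 HX w) (driver_lipschitz HX w J) PR
  (fun s _ => clip_norm_le _ (ler0n _ k)) (lexx 0) t0 tT.
rewrite PR.1 !subr0 => /le_trans; apply.
by rewrite mulrC mulrA ler_wpM2r// ?(driver_bound_ge0 HX)// ler_wpM2r.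
Qed.

Let growth_const := 1 + \sum_(j < m) `|y0 j 0|.
Let growth_rate := m%:R * n%:R * C + 1.

Lemma growth_const_ge1 : 1 <= growth_const. Proof. by rewrite lerDl sumr_ge0. Qed.
Lemma growth_rate_gt0 : 0 < growth_rate. Proof. by rewrite ltr_wpDl// !mulr_ge0. Qed.

(** Clipping does not increase absolute values, so linear growth of the
    coefficients gives a bound that is uniform in [k].  The rate
    [growth_rate * K w] is chosen to beat the [m * n] integrals of a step. *)
Lemma picard_bound k w t : 0 <= t <= T ->
  1 + \sum_(j < m) `|picard k w t j 0| <= growth_const * expR (growth_rate * K w * t).
Proof.
have K1 := exp_moments_ge1 (driver_moments HX) w.
have K0 : 0 < K w by exact: lt_le_trans K1.
elim: k t => [|k IH] t tT.
  rewrite -/growth_const ler_peMr//; first exact: le_trans growth_const_ge1.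
  rewrite -[X in X <= _]expR0 ler_expR; case/andP: tT => t0 _.
  by rewrite !mulr_ge0// ltW// growth_rate_gt0.
have uc i J := @unif_cont_along (fun t y => clip k%:R (f i J t y)) _ (@clip_f_cont k i
  J) (@picard_unif_cont k w).
pose E := expR (growth_rate * K w * t) - 1.
have E0 : 0 <= E.
  rewrite subr_ge0 -[X in X <= _]expR0 ler_expR; case/andP: tT => t0 _.
  by rewrite !mulr_ge0// ltW// growth_rate_gt0.
have term i J : `|RS_integral (fun u => clip k%:R (f i J u (picard k w u))) (fun u => X
  w u J 0) 0 t|
    <= C * growth_const / growth_rate * E.
  have := @primitive_exp _ T _ _ _ (K w) (C * growth_const) (growth_rate * K w) (ltW
    K0) _ _
    (driver_lipschitz HX w J) (RS_integral_primitive w J (uc i J)) _ t tT.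
  rewrite -/E; have -> : C * growth_const * K w / (growth_rate * K w) = C *
    growth_const / growth_rate.
    by field; rewrite !lt0r_neq0// growth_rate_gt0.
  apply.
  - by rewrite mulr_gt0// growth_rate_gt0.
  - by rewrite mulr_ge0// (le_trans _ growth_const_ge1).
  - move=> s sT; apply: le_trans (clip_le_norm _ _) _ => //.
    apply: le_trans (f_growth _ _ _ sT) _.
    by rewrite -mulrA ler_wpM2l// IH.
apply: (@le_trans _ _ (growth_const + \sum_(j < m) \sum_(J < n) C * growth_const /
  growth_rate * E)).
  rewrite /growth_const -addrA lerD2l -big_split/=; apply: ler_sum => j _.
  rewrite picardS_E; apply: le_trans (ler_normD _ _) _; rewrite lerD2l.
  by apply: le_trans (ler_norm_sum _ _ _) _; apply: ler_sum => J _; exact: term.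
have -> : growth_const * expR (growth_rate * K w * t) = growth_const + growth_const * E
  by rewrite /E; ring.
rewrite lerD2l !sumr_const !card_ord -mulrnA -mulr_natl natrM.
have -> : n%:R * m%:R * (C * growth_const / growth_rate * E) = (m%:R * n%:R * C /
  growth_rate) * (growth_const * E).
  by field; rewrite lt0r_neq0// growth_rate_gt0.
rewrite ler_piMl//; first by rewrite mulr_ge0// (le_trans _ growth_const_ge1).
by rewrite ler_pdivrMr ?growth_rate_gt0// mul1r lerDl.
Qed.

Variable Y : Omega -> R -> 'cV[R]_m.
Hypothesis Y_cont : forall w, {within `[0, T], continuous (Y w)}.
Hypothesis Y_eq : forall w t i, 0 <= t <= T -> Y w t i 0 = y0 i 0 + \sum_(J < n)
  RS_integral (fun u => f i J u (Y w u)) (fun u => X w u J 0) 0 t.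

Lemma Y_unif_cont w : unif_cont_path (Y w).
Proof. exact: continuous_unif_cont_path (@Y_cont w). Qed.

Lemma unif_cont_uniform_bound (I : finType) (F : I -> R -> R) :
  (forall i, unif_cont_on T (F i)) ->
  exists2 A : R, 0 <= A & forall i t, 0 <= t <= T -> `|F i t| <= A.
Proof.
move=> uF.
have ex i : exists A : R, 0 <= A /\ forall t, 0 <= t <= T -> `|F i t| <= A.
  by have [A A0 HA] := unif_cont_bounded (uF i); exists A.
have [A HA] := choice ex; exists (\sum_i A i) => [|i t tT].
  by apply: sumr_ge0 => i _; exact: (HA i).1.
apply: le_trans ((HA i).2 t tT) _; rewrite (bigD1 i)//= lerDl.
by apply: sumr_ge0 => j _; exact: (HA j).1.
Qed.

Let contraction_rate := 2 * (m%:R * n%:R * L) + 1.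

(** Along the path [Y w] the coefficients are bounded by some [B]; from step
    [N > B] on they are not affected by clipping, and the iteration halves the
    distance to [Y w] in the norm weighted by
    [exp (contraction_rate * K w * s)]. *)
Lemma picard_cvg w t i : 0 <= t <= T -> picard k w t i 0 @[k --> \oo] --> Y w t i 0.
Proof.
move=> tT.
have K1 := exp_moments_ge1 (driver_moments HX) w.
have K0 : 0 < K w by exact: lt_le_trans K1.
have l0 : 0 < contraction_rate by rewrite ltr_wpDl// !mulr_ge0.
have ucY i' J := @unif_cont_along (f i' J) _ (@f_cont i' J) (@Y_unif_cont w).
have [B B0 HB] := unif_cont_uniform_bound
  (fun p : 'I_m * 'I_n => ucY p.1 p.2).
(* from step N on, clipping leaves the coefficients along Y w unchanged *)
pose N := (Num.truncn B).+1.
have NB k : B <= (N + k)%:R.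
  apply: ltW; apply: lt_le_trans (truncnS_gt B) _; rewrite ler_nat leq_addr //.
pose D k s := \sum_(j < m) `|picard k w s j 0 - Y w s j 0|.
have [A A0 HA] : exists2 A : R, 0 <= A & forall s, 0 <= s <= T -> D N s <= A.
  have [A1 A10 HA1] := unif_cont_uniform_bound (@picard_unif_cont N w).
  have [A2 A20 HA2] := unif_cont_uniform_bound (@Y_unif_cont w).
  exists (\sum_(j < m) (A1 + A2)) => [|s sT]; first by apply: sumr_ge0 => j _; rewrite
    addr_ge0.
  apply: ler_sum => j _; apply: le_trans (ler_normB _ _) _.
  by rewrite lerD ?HA1 ?HA2.
have step k s : 0 <= s <= T -> D (N + k)%N s <= A / 2 ^+ k * expR (contraction_rate * K
  w * s).
  elim: k s => [|k IH] s sT.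
    rewrite addn0 expr0 divr1; apply: le_trans (HA s sT) _.
    rewrite ler_peMr// -[X in X <= _]expR0 ler_expR; case/andP: sT => s0 _.
    by rewrite !mulr_ge0// ltW.
  have ucP i' J := @unif_cont_along (fun t y => clip (N + k)%:R (f i' J t y)) _
    (@clip_f_cont (N + k) i' J) (@picard_unif_cont (N + k) w).
  pose E := expR (contraction_rate * K w * s) - 1.
  have E0 : 0 <= E.
    rewrite subr_ge0 -[X in X <= _]expR0 ler_expR; case/andP: sT => s0 _.
    by rewrite !mulr_ge0// ltW.
  have Ak0 : 0 <= A / 2 ^+ k by rewrite divr_ge0// exprn_ge0.
  have term j J : `|RS_integral (fun u => clip (N + k)%:R (f j J u (picard (N + k) w
    u))) (fun u => X w u J 0) 0 s
     - RS_integral (fun u => f j J u (Y w u)) (fun u => X w u J 0) 0 s|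
    <= L * (A / 2 ^+ k) / contraction_rate * E.
    have PD := primitiveDl (RS_integral_primitive w J (ucP j J)) (primitiveZl (-1)
      (RS_integral_primitive w J (ucY j J))).
    have := @primitive_exp _ T _ _ _ (K w) (L * (A / 2 ^+ k)) (contraction_rate * K w)
      (ltW K0) _ _
      (driver_lipschitz HX w J) PD _ s sT.
    rewrite -/E mulN1r; have -> : L * (A / 2 ^+ k) * K w / (contraction_rate * K w) = L
      * (A / 2 ^+ k) / contraction_rate.
      by field; rewrite !lt0r_neq0// exprn_gt0.
    apply.
    - by rewrite mulr_gt0.
    - by rewrite mulr_ge0.
    - move=> u uT; rewrite mulN1r.
      have -> : f j J u (Y w u) = clip (N + k)%:R (f j J u (Y w u)).
        rewrite clip_id//; apply: le_trans (NB k); exact: (HB (j, J)).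
      apply: le_trans (clip_lipschitz _ _ _) _ => //.
      apply: le_trans (f_lip _ _ _ _ uT) _.
      by rewrite -mulrA ler_wpM2l// IH.
  rewrite addnS.
  apply: (@le_trans _ _ (\sum_(j < m) \sum_(J < n) L * (A / 2 ^+ k) / contraction_rate
    * E)).
    apply: ler_sum => j _; rewrite picardS_E Y_eq// opprD addrACA subrr add0r -sumrB.
    by apply: le_trans (ler_norm_sum _ _ _) _; apply: ler_sum => J _; exact: term.
  rewrite !sumr_const !card_ord -mulrnA -[X in X <= _]mulr_natl natrM.
  have -> : n%:R * m%:R * (L * (A / 2 ^+ k) / contraction_rate * E) =
     (2 * (m%:R * n%:R * L) / contraction_rate) * (A / 2 ^+ k.+1 * E).
    by rewrite exprS; field; rewrite !lt0r_neq0// exprn_gt0.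
  have Ak1 : 0 <= A / 2 ^+ k.+1 by rewrite divr_ge0// exprn_ge0.
  apply: (@le_trans _ _ (A / 2 ^+ k.+1 * E)).
    rewrite ler_piMl//; first by rewrite mulr_ge0.
    by rewrite ler_pdivrMr// mul1r lerDl.
  by rewrite ler_wpM2l// /E lerBlDr lerDl.
rewrite -(cvg_shiftn N) /=.
have g : A * expR (contraction_rate * K w * t) * (2^-1 ^+ k) @[k --> \oo] --> A * expR
  (contraction_rate * K w * t) * 0.
  by apply: cvgMr; apply: cvg_expr; rewrite ger0_norm ?invr_ge0// invf_lt1// ltr1n.
rewrite mulr0 in g.
apply/cvgrPdist_le => e e0.
move/cvgrPdist_le : g => /(_ e e0); apply: filterS => k.
rewrite sub0r normrN => /(le_trans (ler_norm _)); apply: le_trans.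
rewrite distrC addnC.
apply: (@le_trans _ _ (D (N + k)%N t)).
  by rewrite /D (bigD1 i)//= lerDl sumr_ge0.
apply: le_trans (step k t tT) _.
by rewrite exprVn mulrAC.
Qed.

(** The iterates are approximable, converge pointwise to [Y] and have a common
    exponential bound. *)
Lemma solution_sig_approx i : sig_approx P T X K (fun z => Y z.1 z.2 i 0).
Proof.
pose C' := growth_const + growth_rate * T.
have growth_const0 : 0 <= growth_const by exact: le_trans growth_const_ge1.
have lT0 : 0 <= growth_rate * T by rewrite mulr_ge0// ltW// growth_rate_gt0.
apply: (@sig_approx_lim _ _ _ P T T0 _ X K i0 HX (fun k z => picard k z.1 z.2 i 0) _ C').
- by move=> k; case: (picard_sig_approx k i).
- move=> k w t tT /=.
  have K1 := exp_moments_ge1 (driver_moments HX) w.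
  have K0 : 0 <= K w by exact: le_trans K1.
  have := picard_bound k w tT; rewrite (bigD1 i)//= => H.
  apply: (@le_trans _ _ (growth_const * expR (growth_rate * K w * t))).
    apply: le_trans H; rewrite addrCA lerDl addr_ge0// sumr_ge0//.
  apply: ler_pM => //; first by rewrite /C' lerDl.
  rewrite ler_expR /C' [(growth_const + _) * _]mulrDl.
  apply: (@le_trans _ _ (growth_rate * T * K w)); last by rewrite lerDr mulr_ge0.
  rewrite mulrAC; apply: ler_wpM2r => //; apply: ler_wpM2l; first exact: ltW
    growth_rate_gt0.
  by case/andP: tT.
- by move=> w t; exact: picard_cvg.
Qed.

End Picard.

(** * Gaussian exponential moments *)

Section NormalDensity.
Context {R : realType} (a s : R).
Local Notation mu := lebesgue_measure.
Local Notation nrm := (@normal_prob R a s).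
Local Notation pdf := (@normal_pdf R a s).
Import HBNNSimple.

Let mpdf : measurable_fun [set: R] (fun x => (pdf x)%:E).
Proof. by apply/measurable_EFinP; exact: measurable_normal_pdf. Qed.

Let pdf0 x : (0 <= (pdf x)%:E)%E.
Proof. by rewrite lee_fin normal_pdf_ge0. Qed.

Lemma integral_normal_indic E : measurable E ->
  (\int[nrm]_x (\1_E x)%:E = \int[mu]_x ((\1_E x)%:E * (pdf x)%:E))%E.
Proof.
move=> mE; rewrite integral_indic// setIT.
transitivity (\int[mu]_(x in E) (pdf x)%:E)%E; first by [].
rewrite [LHS]integral_mkcond.
apply: eq_integral => x _; rewrite patchE indicE.
by case: ifPn => _; rewrite ?mul1e ?mul0e.
Qed.

Lemma integral_normal_nnsfun (f : {nnsfun _ >-> R}) :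
  (\int[nrm]_x (f x)%:E = \int[mu]_x ((f x)%:E * (pdf x)%:E))%E.
Proof.
under [LHS]eq_integral do rewrite fimfunE -fsumEFin//.
rewrite [LHS]ge0_integral_fsum//; last 2 first.
  - by move=> r; exact/measurable_EFinP/measurableT_comp.
  - by move=> n x _; rewrite EFinM nnfun_muleindic_ge0.
under [RHS]eq_integral.
  move=> x xD; rewrite fimfunE -fsumEFin// muleC ge0_mule_fsumr; last first.
    by move=> r; rewrite EFinM nnfun_muleindic_ge0.
  over.
rewrite [RHS]ge0_integral_fsum//; last 2 first.
  - by move=> r; apply: emeasurable_funM => //; apply/measurable_EFinP/measurableT_comp.
  - by move=> n x _; rewrite EFinM mule_ge0//; rewrite nnfun_muleindic_ge0.
apply: eq_fsbigr => r; rewrite inE => -[x0 _ <-].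
have fx0 : 0 <= f x0 by [].
under [LHS]eq_integral do rewrite EFinM.
rewrite ge0_integralZl//; last exact/measurable_EFinP/measurable_indic.
under [RHS]eq_integral do rewrite EFinM muleC -muleA.
rewrite [RHS]ge0_integralZl//; last 2 first.
- by apply: emeasurable_funM => //; exact/measurable_EFinP/measurable_indic.
- by move=> t _; rewrite mule_ge0// lee_fin.
by rewrite integral_normal_indic.
Qed.

(** The normal distribution is defined by its density; simple functions and
    monotone convergence extend this from sets to functions. *)
Lemma integral_normal_prob (f : _ -> \bar R) :
  measurable_fun setT f -> (forall x, 0 <= f x)%E ->
  (\int[nrm]_x f x = \int[mu]_x (f x * (pdf x)%:E))%E.
Proof.
move=> mf f0.
pose f_ := nnsfun_approx measurableT mf.
transitivity (lim (\int[nrm]_x (f_ n x)%:E @[n --> \oo])%E).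
  rewrite -monotone_convergence//=.
  - apply: eq_integral => ? /[!inE] xD; apply/esym/cvg_lim => //=.
    exact: cvg_nnsfun_approx.
  - by move=> n; exact/measurable_EFinP/measurable_funTS.
  - by move=> n ? _; rewrite lee_fin.
  - by move=> ? _ ? ? mn; rewrite lee_fin; exact/lefP/nd_nnsfun_approx.
transitivity (lim (\int[mu]_x ((f_ n x)%:E * (pdf x)%:E) @[n --> \oo])%E).
  by apply: congr_lim; apply/funext => n; exact: integral_normal_nnsfun.
rewrite -monotone_convergence//=.
- apply: eq_integral => x /[!inE] xD; apply/cvg_lim => //.
  rewrite muleC; under eq_cvg do rewrite muleC.
  by apply: cvgeZl => //; exact: cvg_nnsfun_approx.
- by move=> n; apply: emeasurable_funM => //; exact/measurable_EFinP/measurable_funTS.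
- by move=> n x _; rewrite mule_ge0// lee_fin.
- move=> x _ i j ij; rewrite lee_wpmul2r// lee_fin; exact/lefP/nd_nnsfun_approx.
Qed.
End NormalDensity.

Section NormalExponential.
Context {R : realType} (s : R).
Hypothesis s0 : s != 0.
Local Notation mu := lebesgue_measure.

(** Completing the square turns the tilted density into the density of another
    normal distribution. *)
Lemma normal_mgf (l : R) :
  (\int[normal_prob 0 s]_x (expR (l * x))%:E < +oo)%E.
Proof.
rewrite integral_normal_prob//; last first.
- by apply/measurable_EFinP; apply: measurableT_comp => //; exact: measurable_funM.
have E x : ((expR (l * x))%:E * (normal_pdf 0 s x)%:E =
   (expR (l ^+ 2 * s ^+ 2 / 2))%:E * (normal_pdf (l * s ^+ 2) s x)%:E)%E.
  rewrite -!EFinM !normal_pdfE//; congr (_%:E); rewrite mulrCA [RHS]mulrCA; congr (_ * _).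
  rewrite /normal_fun -!expRD; congr expR.
  by field.
under eq_integral do rewrite E.
rewrite ge0_integralZl//=.
all: try by apply/measurable_EFinP; exact: measurable_normal_pdf.
all: try by move=> x _; rewrite lee_fin normal_pdf_ge0.
all: try by rewrite lee_fin expR_ge0.
by rewrite integral_normal_pdf mule1 ltry.
Qed.

Lemma normal_exp_abs (l : R) :
  (\int[normal_prob 0 s]_x (expR (l * `|x|))%:E < +oo)%E.
Proof.
have me c : measurable_fun [set: R] (fun x : R => (expR (c * x))%:E).
  by apply/measurable_EFinP; apply: measurableT_comp => //; exact: measurable_funM.
apply: (@le_lt_trans _ _ (\int[normal_prob 0 s]_x ((expR (l * x))%:E + (expR (- l *
  x))%:E))%E).
  apply: ge0_le_integral => //.
  - by apply/measurable_EFinP; apply: measurableT_comp => //; exact: measurable_funM.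
  - by apply: emeasurable_funD; exact: me.
  - move=> x _; rewrite -EFinD lee_fin.
    have [x0|x0] := leP 0 x; first by rewrite ger0_norm// lerDl expR_ge0.
    by rewrite ltr0_norm// mulrN mulNr lerDr expR_ge0.
rewrite ge0_integralD//=; try exact: me.
by rewrite lte_add_pinfty// normal_mgf.
Qed.
End NormalExponential.

Section ExponentialMoments.
Context {R : realType} {disp : measure_display} {Omega : measurableType disp}.
Variable P : probability Omega R.

(** Some [x i] is at least the average of the family; the summand 1 covers the
    empty family. *)
Lemma expR_sum_le (I : finType) (x : I -> R) :
  expR (\sum_i x i) <= 1 + \sum_i expR (#|I|%:R * x i).
Proof.
case: (pickP (fun i => \sum_j x j <= #|I|%:R * x i)) => [i xi|none].
  apply: (@le_trans _ _ (expR (#|I|%:R * x i))); first by rewrite ler_expR.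
  rewrite (bigD1 i)//= addrCA lerDl addr_ge0// sumr_ge0// => j _; exact: expR_ge0.
case: (pickP (fun _ : I => true)) => [i _|e].
  have : \sum_j #|I|%:R * x j < \sum_(k : I) \sum_j x j.
    rewrite (bigD1 i)//= [ltRHS](bigD1 i)//=; apply: ltr_leD.
      by rewrite ltNge none.
    by apply: ler_sum => j _; rewrite ltW// ltNge none.
  by rewrite -mulr_sumr sumr_const -[X in _ < X]mulr_natl ltxx.
rewrite big_pred0 ?expR0; last by move=> i; have := e i.
by rewrite lerDl sumr_ge0// => i _; exact: expR_ge0.
Qed.

Lemma increment_exp_finite (V : Omega -> R) (s : R) : s != 0 ->
  measurable_fun [set: Omega] V ->
  (forall B : set R, measurable B -> pushforward P V B = normal_prob 0 s B) ->
  forall l, (\int[P]_w (expR (l * `|V w|))%:E < +oo)%E.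
Proof.
move=> s0 mV VN l.
have mE : measurable_fun [set: R] (fun x : R => (expR (l * `|x|))%:E).
  by apply/measurable_EFinP; apply: measurableT_comp => //; exact: measurable_funM.
have mV' : @measurable_fun _ _ Omega (measurableTypeR R) [set: Omega] V by exact: mV.
pose V' : {mfun Omega >-> measurableTypeR R} := @mfun_Sub _ _ Omega (measurableTypeR R)
  V (mem_set mV').
have V'E : V' = V :> (Omega -> R) by [].
have -> : (\int[P]_w (expR (l * `|V w|))%:E =
    \int[pushforward P V']_x (expR (l * `|x|))%:E)%E.
  by rewrite ge0_integral_pushforward//= => x _; rewrite lee_fin expR_ge0.
have -> : (\int[pushforward P V']_x (expR (l * `|x|))%:E =
    \int[normal_prob 0 s]_x (expR (l * `|x|))%:E)%E.
  by apply: eq_measure_integral => A mA _; exact: VN.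
exact: normal_exp_abs.
Qed.

(** The exponential of a sum is bounded by a sum of exponentials, so only the
    laws of the single [V i] enter. *)
Lemma exp_moments_sum (I : finType) (c : R) (b : I -> R) (V : I -> Omega -> R) :
  1 <= c -> (forall i, 0 <= b i) ->
  (forall i, measurable_fun [set: Omega] (V i)) ->
  (forall i l, (\int[P]_w (expR (l * `|V i w|))%:E < +oo)%E) ->
  exp_moments P (fun w => c + \sum_i b i * `|V i w|).
Proof.
move=> c1 b0 mV expV.
have mK : measurable_fun [set: Omega] (fun w => c + \sum_i b i * `|V i w|).
  apply: measurable_funD => //; apply: measurable_sum => i; apply: measurable_funM => //.
  exact: measurableT_comp.
split => // [w|l]; first by rewrite (le_trans c1)// lerDl sumr_ge0// => i _; rewrite
  mulr_ge0.
have me (i : I) (u : R) : measurable_fun [set: Omega] (fun w => (expR (u * `|V i w|))%:E).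
  apply/measurable_EFinP; apply: measurableT_comp => //; apply: measurable_funM => //.
  exact: measurableT_comp.
apply: (@le_lt_trans _ _ (\int[P]_w ((expR (l * c))%:E *
    (1 + \sum_i (expR (#|I|%:R * (l * b i) * `|V i w|))%:E)))%E).
  apply: ge0_le_integral => //.
  - by apply/measurable_EFinP; apply: measurableT_comp => //; exact: measurable_funM.
  - by apply: emeasurable_funM => //; apply: emeasurable_funD => //; apply:
    emeasurable_sum => i; exact: me.
  - move=> w _; rewrite sumEFin -EFinD -EFinM lee_fin mulrDr expRD ler_wpM2l ?expR_ge0//.
    rewrite mulr_sumr; apply: le_trans (expR_sum_le _) _; rewrite lerD2l.
    by apply: ler_sum => i _; rewrite !mulrA.
have S0 w : (0 <= \sum_i (expR (#|I|%:R * (l * b i) * `|V i w|))%:E)%E.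
  by apply: sume_ge0 => i _; rewrite lee_fin expR_ge0.
rewrite ge0_integralZl//=.
all: try by apply: emeasurable_funD => //; apply: emeasurable_sum => i; exact: me.
all: try by move=> w _; rewrite adde_ge0.
all: try by rewrite lee_fin expR_ge0.
apply: lte_mul_pinfty => //.
rewrite ge0_integralD//=.
all: try by apply: emeasurable_sum => i; exact: me.
apply: lte_add_pinfty.
  by rewrite integral_cst//= probability_setT mule1 ltry.
rewrite ge0_integral_sum//=.
all: try by move=> i w _; rewrite lee_fin expR_ge0.
by apply: lte_sum_pinfty => i _; exact: expV.
Qed.
End ExponentialMoments.

(** * The interpolated Brownian motion *)

(** A piecewise linear path is a combination of the functions
    min (t, b) - min (t, a) over the intervals [a, b] of the partition, with
    the slopes as weights. *)
Lemma linear_interpolationE (R : realType) (a : R) (s : seq R) (f : R -> R) (t : R) :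
  path <%R a s -> a <= t -> t <= last a s ->
  linear_interpolation a s (f : R -> R^o) t = f a + \sum_(k < size s)
    (f (a :: s)`_k.+1 - f (a :: s)`_k) / ((a :: s)`_k.+1 - (a :: s)`_k) *
    (Num.min t (a :: s)`_k.+1 - Num.min t (a :: s)`_k).
Proof.
elim: s a => [a _ _ _|b s IH a /= /andP[ab bs] at_ tl]; first by rewrite big_ord0 addr0.
rewrite big_ord_recl/= (min_r at_).
have ba : b - a != 0 by rewrite subr_eq0 gt_eqF.
have [tb|bt] := leP t b.
  rewrite big1 ?addr0; first by rewrite /GRing.scale/=; field.
  move=> i _; have b0 : bump 0 i = i.+1 by []. rewrite ?b0 ?add1n /=.
  have bi k : (k <= size s)%N -> b <= (b :: s)`_k.
    case: k => [|k] // ks; move: bs; rewrite lt_path_sortedE => /andP[/allP/(_ s`_k)].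
    by rewrite mem_nth// => /(_ isT) /ltW.
  rewrite (min_l (le_trans tb (bi i.+1 (ltn_ord i)))).
  by rewrite (min_l (le_trans tb (bi i (ltnW (ltn_ord i))))) subrr mulr0.
rewrite (IH b bs (ltW bt) tl) addrA; congr (_ + _).
by field.
Qed.

Section BrownianDriver.
Context {R : realType} {disp : measure_display} {Omega : measurableType disp}.
Variables (P : probability Omega R) (T : R).
Hypothesis T0 : 0 < T.
Variables (d : nat) (W : R -> Omega -> 'cV[R]_d) (hW : brownian_motion P T W).
Variables (s : seq R) (sp : itv_partition 0 T s).

Let x k := (0 :: s)`_k.
Local Notation X w := (time_extended (linear_interpolation 0 s (W ^~ w))).

Lemma linear_interpolation_coord (a : R) (r : seq R) (g : R -> 'cV[R]_d) t j :
  linear_interpolation a r g t j 0 =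
  linear_interpolation a r (fun u => g u j 0 : R^o) t.
Proof. by elim: r a => //= b r IH a; case: ifP => // _; rewrite !mxE. Qed.

Definition slope (k : nat) (J : 'I_d.+1) (w : Omega) : R :=
  if unlift ord0 J is Some j then increment W (x k) (x k.+1) j w / (x k.+1 - x k) else 1.

Lemma grid_in k : (k <= size s)%N -> 0 <= x k <= T.
Proof.
move=> ks; have -> : x k = nth T (0 :: s) k by apply: set_nth_default; rewrite /= ltnS.
by rewrite (itv_partition_nth_ge _ sp) ?(itv_partition_nth_le _ sp).
Qed.

Lemma grid_lt k : (k < size s)%N -> x k < x k.+1.
Proof. by move=> ks; case: sp => /(pathP 0)/(_ _ ks). Qed.

Lemma extended_time w t : X w t ord0 0 = t.
Proof.
have -> : ord0 = lshift d ord0 :> 'I_(1 + d) by apply/val_inj.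
by rewrite /time_extended; transitivity ((t%:M : 'M[R]_1) ord0 0);
  [exact: col_mxEu|rewrite mxE eqxx].
Qed.

Lemma extended_space w t j : X w t (lift ord0 j) 0 =
  linear_interpolation 0 s (fun u => W u w j 0 : R^o) t.
Proof.
have -> : lift ord0 j = rshift 1 j :> 'I_(1 + d) by apply/val_inj.
by rewrite -linear_interpolation_coord; exact: col_mxEd.
Qed.

Lemma extended_space0 w j : X w 0 (lift ord0 j) 0 = W 0 w j 0.
Proof.
have [ps /eqP ls] := sp.
rewrite extended_space (linear_interpolationE _ ps (lexx 0)) ?ls ?ltW//.
rewrite big1 ?addr0// => k _.
have /andP[h1 _] := grid_in (ltnW (ltn_ord k)); have /andP[h2 _] := grid_in (ltn_ord k).
by rewrite !min_l// subrr mulr0.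
Qed.

Lemma extended_coordE w J t : 0 <= t <= T -> X w t J 0 = X w 0 J 0 +
  \sum_(k < size s) slope k J w * (Num.min t (x k.+1) - Num.min t (x k)).
Proof.
move=> /andP[t0 tT]; have [ps /eqP ls] := sp.
case: (unliftP ord0 J) => [j|] ->.
  rewrite extended_space0 extended_space (linear_interpolationE _ ps t0) ?ls//.
  by congr (_ + _); apply: eq_bigr => k _; rewrite /slope liftK.
rewrite !extended_time add0r /slope unlift_none.
under eq_bigr do rewrite mul1r.
rewrite -(big_mkord xpredT (fun k => Num.min t (x k.+1) - Num.min t (x k)))
  telescope_sumr//.
have -> : x (size s) = T by exact: (itv_partition_nth_size 0 sp).
by rewrite /x/= min_l// min_r// subr0.
Qed.

(** A bound for the sums of the absolute values of the slopes of any coordinate.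
    The summand [size s] accounts for the coordinate of time, and the summand 1
    makes the bound at least 1. *)
Definition speed (w : Omega) : R := 1 + (size s)%:R +
  \sum_(kj : 'I_(size s) * 'I_d) (x kj.1.+1 - x kj.1)^-1 * `|increment W (x kj.1) (x
    kj.1.+1) kj.2 w|.

Lemma measurable_increment k j : (k < size s)%N ->
  measurable_fun [set: Omega] (increment W (x k) (x k.+1) j).
Proof.
move=> ks; apply: measurable_funB; apply: (bm_measurable hW); apply: grid_in => //.
exact: ltnW.
Qed.

Lemma speed_moments : exp_moments P speed.
Proof.
apply: (@exp_moments_sum _ _ _ P ('I_(size s) * 'I_d)%type (1 + (size s)%:R)
  (fun kj => (x kj.1.+1 - x kj.1)^-1) (fun kj => increment W (x kj.1) (x kj.1.+1) kj.2)).
- by rewrite lerDl.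
- by move=> kj; rewrite invr_ge0 subr_ge0 ltW// grid_lt.
- by move=> kj; exact: measurable_increment.
- move=> kj; have lt := grid_lt (ltn_ord kj.1).
  have /andP[h0 _] := grid_in (ltnW (ltn_ord kj.1)); have /andP[_ hT] := grid_in
    (ltn_ord kj.1).
  apply: (@increment_exp_finite _ _ _ P _ (Num.sqrt (x kj.1.+1 - x kj.1))).
  + by rewrite gt_eqF// sqrtr_gt0 subr_gt0.
  + exact: measurable_increment.
  + by move=> B mB; exact: (bm_gaussian hW).
Qed.

Lemma slope_speed w J : \sum_(k < size s) `|slope k J w| <= speed w.
Proof.
rewrite /speed /slope; case: (unliftP ord0 J) => [j|] _.
  rewrite -[leLHS]add0r; apply: lerD; first by rewrite addr_ge0.
  rewrite -(pair_bigA _ (fun (k : 'I_(size s)) (i : 'I_d) => (x k.+1 - x k)^-1 *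
    `|increment W (x k) (x k.+1) i w|))/=.
  apply: ler_sum => k _; rewrite (bigD1 j)//= normrM mulrC.
  have lt := grid_lt (ltn_ord k).
  have dx : 0 <= (x k.+1 - x k)^-1 by rewrite invr_ge0 subr_ge0 ltW.
  rewrite [`|_^-1|]ger0_norm// lerDl.
  by apply: sumr_ge0 => i _; rewrite mulr_ge0// invr_ge0 subr_ge0 ltW.
under eq_bigr do rewrite normr1.
rewrite sumr_const card_ord -addrA addrCA lerDl addr_ge0//.
by apply: sumr_ge0 => -[k j] _ /=; rewrite mulr_ge0// invr_ge0 subr_ge0 ltW// grid_lt.
Qed.

(** Everything follows from the representation of the coordinates as random
    combinations of clamped times. *)
Lemma brownian_driver : lipschitz_driver P T (fun w => X w) speed ord0.
Proof.
split.
- exact: speed_moments.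
- move=> w J u v u0 uv vT.
  have uT : 0 <= u <= T by rewrite u0 (le_trans uv).
  have vT' : 0 <= v <= T by rewrite vT (le_trans u0).
  rewrite (extended_coordE w J uT) (extended_coordE w J vT') opprD addrACA subrr add0r
    -sumrB.
  apply: (@le_trans _ _ (\sum_(k < size s) `|slope k J w| * (v - u))).
    apply: le_trans (ler_norm_sum _ _ _) _; apply: ler_sum => k _.
    rewrite -mulrBr normrM ler_wpM2l//.
    have lt := grid_lt (ltn_ord k).
    have minB (c : R) : 0 <= Num.min v c - Num.min u c <= v - u.
      by case: (leP v c) => h1; case: (leP u c) => h2; apply/andP; split; lra.
    rewrite ler_norml.
    case: (leP v (x k.+1)) => h1; case: (leP v (x k)) => h2;
    case: (leP u (x k.+1)) => h3; case: (leP u (x k)) => h4; apply/andP; split; lra.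
  by rewrite -mulr_suml ler_wpM2r ?subr_ge0// slope_speed.
- move=> w J a ua.
  have [F PF] := ex_intro (fun F => primitive T a id F) _ (primitive_time
    (unif_cont_continuous ua)).
  exists (fun u => 0 + \sum_(k < size s) slope k J w * (F (Num.min u (x k.+1)) + -1 * F
    (Num.min u (x k)))).
  have PS : primitive T a (fun t => X w 0 J 0 + \sum_(k < size s) slope k J w *
    (Num.min t (x k.+1) + -1 * Num.min t (x k)))
     (fun u => 0 + \sum_(k < size s) slope k J w * (F (Num.min u (x k.+1)) + -1 * F
       (Num.min u (x k)))).
    apply: primitiveD; first exact: primitive_cst.
    apply: (@primitive_sum _ T a (size s) (fun k t => slope k J w * (Num.min t (x k.+1)
      + -1 * Num.min t (x k)))
      (fun k u => slope k J w * (F (Num.min u (x k.+1)) + -1 * F (Num.min u (x k)))))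
        => k.
    apply: primitiveZ; apply: primitiveD.
      by apply: primitive_clamp => //; exact: grid_in.
    by apply: primitiveZ; apply: primitive_clamp => //; apply: grid_in; exact: ltnW.
  apply: (eq_primitive (ltW T0) PS) => // t tT.
  rewrite (extended_coordE w J tT); congr (_ + _); apply: eq_bigr => k _.
  by rewrite mulN1r.
- move=> J.
  apply: (@eq_measurable_fun _ _ _ _ _ (fun z : Omega * R => X z.1 0 J 0 +
    \sum_(k < size s) slope k J z.1 * (Num.min z.2 (x k.+1) - Num.min z.2 (x k)))).
    by move=> [w t]; rewrite inE => /stripP tT /=; rewrite (extended_coordE w J tT).
  apply: measurable_funTS; apply: measurable_funD.
    apply: (@measurableT_comp _ _ _ _ _ _ (fun w => X w 0 J 0)) => //.
    case: (unliftP ord0 J) => [j|] ->.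
      under eq_fun do rewrite extended_space0.
      by apply: (bm_measurable hW); rewrite lexx ltW.
    under eq_fun do rewrite extended_time; exact: measurable_cst.
  apply: measurable_sum => k; apply: measurable_funM.
    apply: (@measurableT_comp _ _ _ _ _ _ (slope k J)) => //.
    rewrite /slope; case: (unliftP ord0 J) => [j|] _; last exact: measurable_cst.
    by apply: measurable_funM => //; apply: measurable_increment.
  by apply: measurable_funB; apply: measurable_minr => //; exact: measurable_snd.
- by move=> w t _; exact: extended_time.
Qed.

End BrownianDriver.

(** * From coordinates to a vector-valued functional *)

Section EuclideanNorm.
Context {R : realType}.

Lemma entry_le_enorm (m n : nat) (A : 'M[R]_(m, n)) i j : `|A i j| <= enorm A.
Proof.
rewrite /enorm -sqrtr_sqr ler_wsqrtr// (bigD1 i)//= (bigD1 j)//= -addrA lerDl.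
by apply: addr_ge0; apply: sumr_ge0 => k _; [exact: sqr_ge0|apply: sumr_ge0 => l _;
  exact: sqr_ge0].
Qed.

Lemma enorm_le_sum (m : nat) (v : 'cV[R]_m) : enorm v <= \sum_i `|v i 0|.
Proof.
rewrite /enorm -[leRHS]ger0_norm ?sumr_ge0// -sqrtr_sqr ler_wsqrtr//.
under eq_bigr do rewrite big_ord1.
elim: m v => [|m IH] v; first by rewrite !big_ord0 expr0n.
rewrite !big_ord_recl/= sqrrD -addrA.
rewrite -[v ord0 0 ^+ 2]real_normK ?num_real// lerD2l.
have /= := IH (\col_i v (lift ord0 i) 0).
under eq_bigr do rewrite mxE.
under [X in _ <= X ^+ 2]eq_bigr do rewrite mxE.
move=> /le_trans; apply; rewrite lerDr mulrn_wge0// mulr_ge0// sumr_ge0//.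
Qed.

Lemma sum_norm_expr (m : nat) (x : 'I_m -> R) r :
  (\sum_i `|x i|) ^+ r.+1 <= (2 ^+ r.+1) ^+ m * \sum_i `|x i| ^+ r.+1.
Proof.
elim: m x => [|m IH] x; first by rewrite !big_ord0 expr0n mulr0.
rewrite !big_ord_recr/=.
have S0 : 0 <= \sum_(i < m) `|x (widen_ord (leqnSn m) i)| by apply: sumr_ge0.
have := normD_expr (\sum_(i < m) `|x (widen_ord (leqnSn m) i)|) `|x ord_max| r.+1.
rewrite (ger0_norm (addr_ge0 S0 (normr_ge0 _))) (ger0_norm S0) normr_id => /le_trans;
  apply.
rewrite [(_ ^+ _) ^+ m.+1]exprS -[X in _ <= X]mulrA; apply: ler_wpM2l; first exact:
  exprn_ge0.
rewrite mulrDr; apply: lerD; first exact: IH.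
by rewrite ler_peMl ?exprn_ge0// exprn_ege1// exprn_ege1// ler1n.
Qed.

(** With d := q ^ (1 / p), either x <= d and x ^ p <= q, or (x / d) ^ p is at
    most (x / d) ^ r. *)
Lemma powR_le_expr (x p q : R) r : 0 <= x -> 0 < p -> p <= r%:R -> 0 < q ->
  x `^ p <= q + q / (q `^ p^-1) ^+ r * x ^+ r.
Proof.
move=> x0 p0 pr q0; set d := q `^ p^-1.
have d0 : 0 < d by exact: powR_gt0.
have dp : d `^ p = q by rewrite /d -powRrM mulVf ?gt_eqF// powRr1// ltW.
have dr : 0 < d ^+ r by exact: exprn_gt0.
have [xd|dx] := leP x d.
  apply: (@le_trans _ _ q).
    by rewrite -dp; apply: ge0_ler_powR; rewrite ?nnegrE// ltW.
  by rewrite lerDl mulr_ge0 ?exprn_ge0// divr_ge0 ?ltW.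
apply: (@le_trans _ _ (q / d ^+ r * x ^+ r)); last by rewrite lerDr ltW.
set y := x / d; have y1 : 1 <= y by rewrite ler_pdivlMr// mul1r ltW.
have y0 : 0 <= y by exact: le_trans y1.
have -> : x = d * y by rewrite /y mulrC divfK// gt_eqF.
rewrite powRM ?(ltW d0)// dp exprMn.
have -> : q / d ^+ r * (d ^+ r * y ^+ r) = q * y ^+ r by rewrite mulrA divfK// gt_eqF.
by rewrite ler_wpM2l ?(ltW q0)// -powR_mulrn// ler_powR.
Qed.
End EuclideanNorm.

Section Functional.
Context {R : realType} (d m N : nat) (l : seq 'I_d.+1 -> 'cV[R]_m).

Definition word_functional (a : tensor_series (R := R) d.+1) : 'cV[R]_m :=
  \sum_(k < N.+1) \sum_(I : k.-tuple 'I_d.+1) a I *: l I.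

Lemma word_functional_linear : linear word_functional.
Proof.
move=> c a b; rewrite /word_functional scaler_sumr -big_split/=; apply: eq_bigr => k _.
rewrite scaler_sumr -big_split/=; apply: eq_bigr => I _.
by rewrite scalerA -scalerDl.
Qed.

HB.instance Definition _ := GRing.isLinear.Build R (tensor_series (R := R) d.+1) 'cV[R]_m
  *:%R word_functional word_functional_linear.
End Functional.

Section CombFunctional.
Context {R : realType} (d m : nat) (c : 'I_m -> seq (R * seq 'I_d.+1)).

Definition max_length : nat := \max_(i < m) \max_(p <- c i) size p.2.

Definition word_coefficient (I : seq 'I_d.+1) : 'cV[R]_m :=
  \col_i \sum_(p <- c i | p.2 == rev I) p.1.

(** Each weighted word of [c i] contributes to exactly one index of the double
    sum, that of its length and of its reversal. *)
Lemma word_functional_signature (X : R -> 'cV[R]_d.+1) t i :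
  word_functional max_length word_coefficient (signature X t) i 0 = word_comb X (c i) t.
Proof.
rewrite /word_functional /word_comb summxE.
under eq_bigr => k _.
  rewrite summxE; under eq_bigr => I _.
    rewrite !mxE mulr_sumr big_mkcond/=.
    over.
  rewrite exchange_big/=; over.
rewrite exchange_big/= big_seq [RHS]big_seq; apply: eq_bigr => p pc.
have pN : (size p.2 < max_length.+1)%N.
  rewrite ltnS /max_length (bigD1 i)//= leq_max; apply/orP; left.
  by rewrite (big_rem p)//= leq_maxl.
have rs : size (rev p.2) == size p.2 by rewrite size_rev.
rewrite (bigD1 (Ordinal pN))//= [X in _ + X]big1 ?addr0; last first.
  move=> k kp; apply: big1 => I _; case: eqP => // pI.
  case/eqP: kp; apply/val_inj; by rewrite /= pI size_rev size_tuple.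
rewrite (bigD1 (Tuple rs))//= [X in _ + X]big1 ?addr0; last first.
  move=> I Ip; case: eqP => // pI.
  by case/eqP: Ip; apply/val_inj; rewrite /= -[LHS]revK -pI.
by rewrite revK eqxx /signature revK mulrC.
Qed.
End CombFunctional.

Section FinalApproximation.
Variables (R : realType) (disp : measure_display)
  (Omega : measurableType disp) (P : probability Omega R)
  (p : R) (hp : 1 <= p) (T : R) (hT : 0 < T) (m d : nat)
  (X : Omega -> R -> 'cV[R]_d.+1) (K : Omega -> R)
  (HX : lipschitz_driver P T X K ord0)
  (Y : Omega -> R -> 'cV[R]_m)
  (LY : forall i, sig_approx P T X K (fun z => Y z.1 z.2 i 0)).

(** The budget eps ^ p is split in two: the constant [q] of [powR_le_expr]
    integrates to a quarter of it, and [eta] is chosen so that the moments of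
    order [r + 1] of the coordinates contribute at most another quarter. *)
Lemma sig_approx_Lp (eps : R) : 0 < eps ->
  exists (ell : {linear tensor_series d.+1 -> 'cV[R]_m})
    (N : nat) (l : seq 'I_d.+1 -> 'cV[R]_m),
    (forall a : tensor_series d.+1,
       ell a = \sum_(k < N.+1) \sum_(I : k.-tuple 'I_d.+1) a I *: l I) /\
    (\int[P]_w \int[lebesgue_measure]_(t in `[0%R, T])
        (enorm (Y w t - ell (signature (X w) t))%R `^ p)%:E < (eps `^ p)%:E)%E.
Proof.
move=> e0; have T0' := ltW hT; have HK := driver_moments HX.
have p0 : 0 < p by exact: lt_le_trans hp.
pose E := eps `^ p; have E0 : 0 < E by exact: powR_gt0.
pose q := E / (4 * T).
have q0 : 0 < q by rewrite divr_gt0// mulr_gt0.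
pose r := Num.truncn p.
have pr : p <= r.+1%:R by apply: ltW; exact: truncnS_gt.
pose A := q / (q `^ p^-1) ^+ r.+1 * (2 ^+ r.+1) ^+ m.
have A0 : 0 < A by rewrite mulr_gt0 ?exprn_gt0// divr_gt0// exprn_gt0// powR_gt0.
pose eta := E / (4 * (A * m.+1%:R)).
have eta0 : 0 < eta by rewrite divr_gt0// mulr_gt0// mulr_gt0.
have ex i : exists c, mean P T (fun z => `|Y z.1 z.2 i 0 - sig_comb X c z| ^+ r.+1) < eta.
  by have [_ /(_ r _ eta0)] := LY i.
have [c Hc] := choice ex.
pose ell : {linear tensor_series d.+1 -> 'cV[R]_m} := word_functional (max_length c)
  (word_coefficient c).
exists ell, (max_length c), (word_coefficient c); split => //.
pose D i (z : Omega * R) := Y z.1 z.2 i 0 - sig_comb X (c i) z.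
have tD i : tame T K (D i).
  by apply: (tameB HK); [case: (LY i)|exact: (tame_sig_comb hT HX)].
have DE w t i : (Y w t - ell (signature (X w) t)) i 0 = D i (w, t).
  by rewrite !mxE word_functional_signature.
pose B (z : Omega * R) := q + A * \sum_i `|D i z| ^+ r.+1.
have tsum (I : seq 'I_m) : tame T K (fun z => \sum_(i <- I) `|D i z| ^+ r.+1) /\
    mean P T (fun z => \sum_(i <- I) `|D i z| ^+ r.+1) <= (size I)%:R * eta.
  elim: I => [|i I [IH1 IH2]].
    under eq_fun do rewrite big_nil; split; first exact: tame_cst HK 0.
    by rewrite mul0r mean0.
  under eq_fun do rewrite big_cons; have ti := tame_normX HX r.+1 (tD i).
  split; first exact: (tameD HK).
  rewrite (meanD hT HK)// /= -natr1 mulrDl mul1r addrC lerD// ltW//; exact: Hc.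
have [tS mS] := tsum (index_enum 'I_m).
have tB : tame T K B by apply: (tameD HK); [exact: tame_cst HK q|exact: (tameZ HK)].
have BD w t : enorm (Y w t - ell (signature (X w) t)) `^ p <= B (w, t).
  apply: (@le_trans _ _ ((\sum_i `|D i (w, t)|) `^ p)).
    apply: ge0_ler_powR; first exact: ltW.
    - by rewrite nnegrE sqrtr_ge0.
    - by rewrite nnegrE sumr_ge0.
    - by apply: le_trans (enorm_le_sum _) _; apply: ler_sum => i _; rewrite DE.
  apply: le_trans (powR_le_expr _ p0 pr q0) _; first exact: sumr_ge0.
  rewrite /B lerD2l /A -[X in _ <= X]mulrA ler_wpM2l//; last exact: sum_norm_expr.
  by rewrite divr_ge0 ?ltW// exprn_gt0// powR_gt0.
pose G (z : Omega * R) := enorm (Y z.1 z.2 - ell (signature (X z.1) z.2)) `^ p.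
have mG : measurable_fun (strip T) (fun z => (G z)%:E).
  apply/measurable_EFinP.
  apply: (@measurableT_comp _ _ _ _ _ _ (fun x : R => x `^ p)); first exact:
    measurable_powR.
  rewrite /enorm; apply: measurableT_comp; first by apply: continuous_measurable_fun;
    exact: sqrt_continuous.
  apply: measurable_sum => i; apply: measurable_sum => j.
  apply: measurable_funX; rewrite ord1.
  apply: (@eq_measurable_fun _ _ _ _ _ (D i)); last by case: (tD i).
  by move=> [w t] _; rewrite DE.
apply: (@le_lt_trans _ _ (\int[P]_w \int[lebesgue_measure]_(t in `[0%R, T]) (G (w,
  t))%:E)%E) => //.
rewrite -(@integral_strip _ _ _ P T (fun z => (G z)%:E))//; last first.
  by move=> z _; rewrite lee_fin powR_ge0.
apply: (@le_lt_trans _ _ (\int[(P \x lebesgue_measure)%E]_(z in strip T) (B z)%:E)%E).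
  apply: ge0_le_integral => //.
  - exact: measurable_strip.
  - by move=> z _; rewrite lee_fin powR_ge0.
  - by apply/measurable_EFinP; case: tB.
  - by move=> [w t] _; rewrite lee_fin; exact: BD.
rewrite -(meanE hT HK tB) lte_fin /B.
rewrite (meanD hT HK (tame_cst T HK q) (tameZ HK A tS)) (meanZ hT HK A tS).
have -> : mean P T (fun=> q) = T * q.
  apply/EFin_inj; rewrite (meanE hT HK (tame_cst T HK q)).
  rewrite (@integral_strip_fst _ _ _ P T hT (fun=> q))//; last by move=> _; exact: ltW.
  by rewrite integral_cst//= probability_setT mule1.
have -> : T * q = E / 4 by rewrite /q; field; rewrite gt_eqF.
have : A * mean P T (fun z => \sum_(i <- index_enum 'I_m) `|D i z| ^+ r.+1) <= E / 4.
  apply: (@le_trans _ _ (A * (m%:R * eta))).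
    apply: ler_wpM2l; first exact: ltW.
    apply: le_trans mS _; rewrite ler_wpM2r ?(ltW eta0)//.
    by rewrite -sum1_size big_const_ord iter_addn mul1n addn0.
  have -> : A * (m%:R * eta) = E / 4 * (m%:R / m.+1%:R).
    have gen (a b c' k : R) : b != 0 -> k != 0 ->
        b * (c' * (a / (4 * (b * k)))) = a / 4 * (c' / k).
      by move=> b0 k0; field; rewrite b0 k0.
    by apply: gen; [rewrite gt_eqF|rewrite pnatr_eq0].
  rewrite ler_piMr//; first by rewrite divr_ge0// ltW.
  by rewrite ler_pdivrMr// mul1r ler_nat.
rewrite -/E; lra.
Qed.
End FinalApproximation.

(** * The approximation theorem *)

Theorem theorem5p1 (R : realType) (disp : measure_display)
  (Omega : measurableType disp) (P : probability Omega R)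
  (p : R) (hp : 1 <= p)
  (T : R) (hT : 0 < T)
  (m d : nat)
  (W : R -> Omega -> 'cV[R]_d) (hW : brownian_motion P T W)
  (part : nat -> seq R)
  (part_partition : forall k, itv_partition 0 T (part k))
  (part_nested : forall k, {subset part k <= part k.+1})
  (part_mesh : (fun k => mesh 0 (part k)) @ \oo --> (0 : R))
  (n : nat)
  (y0 : 'cV[R]_m)
  (mu : R -> 'cV[R]_m -> 'cV[R]_m) (sigma : R -> 'cV[R]_m -> 'M[R]_(m, d))
  (mu_continuous : {within `[0, T] `*` [set: 'cV[R]_m],
     continuous (fun z : R * 'cV[R]_m => mu z.1 z.2)})
  (sigma_continuous : {within `[0, T] `*` [set: 'cV[R]_m],
     continuous (fun z : R * 'cV[R]_m => sigma z.1 z.2)})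
  (mu_lipschitz : exists L : R, forall (t : R) (x y : 'cV[R]_m), 0 <= t <= T ->
     enorm (mu t x - mu t y) <= L * enorm (x - y))
  (sigma_lipschitz : exists L : R, forall (t : R) (x y : 'cV[R]_m), 0 <= t <= T ->
     enorm (sigma t x - sigma t y) <= L * enorm (x - y))
  (growth : exists2 C : R, 0 < C & forall (t : R) (x : 'cV[R]_m), 0 <= t <= T ->
     enorm (mu t x) + enorm (sigma t x) <= C * (1 + enorm x)) :
  let Wpi (w : Omega) : R -> 'cV[R]_d :=
    linear_interpolation 0 (part n) (W ^~ w) in
  let WWpi (w : Omega) (t : R) : tensor_series d.+1 :=
    signature (time_extended (Wpi w)) t in
  forall (Y : R -> Omega -> 'cV[R]_m)
    (hY : forall w, ode_solution T y0 mu sigma (Wpi w) (Y ^~ w))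
    (eps : R) (heps : 0 < eps),
  exists (ell : {linear tensor_series d.+1 -> 'cV[R]_m})
    (N : nat) (l : seq 'I_d.+1 -> 'cV[R]_m),
    (forall a : tensor_series d.+1,
       ell a = \sum_(k < N.+1) \sum_(I : k.-tuple 'I_d.+1) a I *: l I) /\
    (\int[P]_w \int[lebesgue_measure]_(t in `[0%R, T])
        (enorm (Y t w - ell (WWpi w t))%R `^ p)%:E < (eps `^ p)%:E)%E.
Proof.
move=> Wpi WWpi Y hY eps heps.
have HX := brownian_driver hT hW (part_partition n).
(* the coefficient of dX^J in the equation of coordinate i; dX^0 is dt *)
pose f (i : 'I_m) (J : 'I_d.+1) (t : R) (x : 'cV[R]_m) : R :=
  if unlift ord0 J is Some j then sigma t x i j else mu t x i 0.
have [L1 HL1] := mu_lipschitz; have [L2 HL2] := sigma_lipschitz.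
have [C C0 HC] := growth.
have f_cont i J : {within `[0, T] `*` [set: 'cV[R]_m],
    continuous (fun z : R * 'cV[R]_m => f i J z.1 z.2)}.
  rewrite /f; case: (unliftP ord0 J) => [j|] _ z.
    apply: (@continuous_comp (subspace ([set` `[0, T]] `*` [set: 'cV[R]_m])) 'M[R]_(m,
      d) R
      (fun z : R * 'cV[R]_m => sigma z.1 z.2) (fun A => A i j)); first exact:
        sigma_continuous.
    exact: coord_continuous.
  apply: (@continuous_comp (subspace ([set` `[0, T]] `*` [set: 'cV[R]_m])) 'cV[R]_m R
    (fun z : R * 'cV[R]_m => mu z.1 z.2) (fun A => A i 0)); first exact: mu_continuous.
  exact: coord_continuous.
have f_lip i J t (x y : 'cV[R]_m) : 0 <= t <= T ->
    `|f i J t x - f i J t y| <= (`|L1| + `|L2|) * \sum_j `|x j 0 - y j 0|.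
  move=> tT.
  have S0 : enorm (x - y) <= \sum_j `|x j 0 - y j 0|.
    apply: le_trans (enorm_le_sum _) _.
    by under eq_bigr do rewrite !mxE.
  have E0 : 0 <= enorm (x - y) by exact: sqrtr_ge0.
  have b1 : `|L1| * enorm (x - y) <= (`|L1| + `|L2|) * \sum_j `|x j 0 - y j 0|.
    by apply: ler_pM => //; rewrite lerDl.
  have b2 : `|L2| * enorm (x - y) <= (`|L1| + `|L2|) * \sum_j `|x j 0 - y j 0|.
    by apply: ler_pM => //; rewrite lerDr.
  rewrite /f; case: (unliftP ord0 J) => [j|] _.
    apply: le_trans b2; apply: le_trans (ler_wpM2r E0 (ler_norm L2)).
    apply: le_trans (HL2 t x y tT).
    by have := entry_le_enorm (sigma t x - sigma t y) i j; rewrite !mxE.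
  apply: le_trans b1; apply: le_trans (ler_wpM2r E0 (ler_norm L1)).
  apply: le_trans (HL1 t x y tT).
  by have := entry_le_enorm (mu t x - mu t y) i 0; rewrite !mxE.
have f_growth i J t (x : 'cV[R]_m) : 0 <= t <= T ->
    `|f i J t x| <= C * (1 + \sum_j `|x j 0|).
  move=> tT.
  have b : C * (1 + enorm x) <= C * (1 + \sum_j `|x j 0|).
    by rewrite ler_wpM2l ?(ltW C0)// lerD2l enorm_le_sum.
  apply: le_trans b; apply: le_trans (HC t x tT).
  rewrite /f; case: (unliftP ord0 J) => [j|] _.
    by apply: le_trans (entry_le_enorm (sigma t x) i j) _; rewrite lerDr sqrtr_ge0.
  by apply: le_trans (entry_le_enorm (mu t x) i 0) _; rewrite lerDl sqrtr_ge0.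
have Ycont w : {within `[0, T], continuous (Y ^~ w)} by case: (hY w).
have T0' := ltW hT.
have Yeq w t i : 0 <= t <= T -> Y t w i 0 = y0 i 0 + \sum_(J < d.+1)
    RS_integral (fun u => f i J u (Y u w)) (fun u => time_extended (Wpi w) u J 0) 0 t.
  move=> tT; have [_ /(_ t tT i) ->] := hY w.
  (* the Lebesgue integral of the drift is its integral against X^0 *)
  rewrite big_ord_recl /f unlift_none addrA; congr (_ + _ + _).
    have ua : unif_cont_on T (fun u => mu u (Y u w) i 0).
      have mc : cont_strip T (fun t y => mu t y i 0).
        by have := f_cont i ord0; rewrite /f unlift_none.
      apply: (@unif_cont_along _ T m _ (Y ^~ w) mc).
      have uY := @continuous_unif_cont_path R T m (Y ^~ w) (Ycont w).
      exact: uY.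
    have PT := primitive_time (unif_cont_continuous ua).
    have -> : (fun u => time_extended (Wpi w) u ord0 0) = id.
      by apply/funext => u; exact: extended_time.
    symmetry; apply: (@RS_integralE _ T _ id _ 1 ua _ _ PT t tT) => //.
    by move=> s u s0 su uT; rewrite mul1r ger0_norm ?subr_ge0.
  apply: eq_bigr => j _; rewrite liftK; congr RS_integral.
  by apply/funext => u; rewrite extended_space /Wpi linear_interpolation_coord.
apply: (@sig_approx_Lp _ _ _ P p hp T hT m d _ _ HX (fun w t => Y t w)) => // i.
apply: (@solution_sig_approx _ _ _ P T hT _ _ _ _ HX m f y0 (`|L1| + `|L2|) C _ (ltW C0)
  f_cont f_lip f_growth (fun w t => Y t w)) => //.
Qed.
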